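(* Let $A=(a_{ij})_{i,j\in\mathbb{I}}=\kappa(\mu,g,\nu)$, $B=\kappa(\lambda,\mathbb{1},\mu)$, $C=\kappa(\lambda',\mathbb{1},\mu)$ be elements of $\Xi_{m|n,d}$ (with $\mathbb{1}$ the identity of $W$) and let $h\in\{0,1,\dots,m+n-1\}$. (1) Assume $B-E^\theta_{h,h+1}$ is diagonal. If $h\ne0$, then in $\mathcal{S}^\jmath_{m|n,d}$ $$e_Be_A=\sum_{k\in\mathbb{I}}\dot{\mathbf q}_{h+1}^{\sum_{j<k}a_{h+1,j}}\,\ddot{\mathbf q}_{h}^{\sum_{j>k}a_{hj}}\,[a_{hk}+1]_{\mathbf q_h}\,e_{A_{hk}};$$ if $h=0$, then $$e_Be_A=\dot{\mathbf q}_{1}^{\sum_{j<0}a_{1j}}\,\ddot{\mathbf q}_{0}^{\sum_{j>0}a_{0j}}\,[a_{00}+1]_{\mathfrak c}\,e_{A_{00}}+\sum_{k\neq0}\dot{\mathbf q}_{1}^{\sum_{j<k}a_{1j}}\,\ddot{\mathbf q}_{0}^{\sum_{j>k}a_{0j}}\,[a_{0k}+1]_{\mathbf q_0}\,e_{A_{0k}}.$$ (2) Assume $C-E^\theta_{h+1,h}$ is diagonal. Then $$e_Ce_A=\sum_{k\in\mathbb{I}}\dot{\mathbf q}_{h}^{\sum_{j>k}a_{hj}}\,\ddot{\mathbf q}_{h+1}^{\sum_{j<k}a_{h+1,j}}\,[a_{h+1,k}+1]_{\mathbf q_{h+1}}\,e_{\check A_{hk}}.$$ Here $A_{hk}=A+E^\theta_{hk}-E^\theta_{h+1,k}$,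 $\check A_{hk}=A-E^\theta_{hk}+E^\theta_{h+1,k}$, and $e_{A_{hk}}$ (resp. $e_{\check A_{hk}}$) is understood to be $0$ if $A_{hk}\notin\Xi_{m|n,d}$ (resp. $\check A_{hk}\notin\Xi_{m|n,d}$).
   Context: Fix integers $d\ge1$, $m,n\ge0$. Put $\mathcal{A}=\mathbb{Z}[v,v^{-1}]$, $q=v^2$. $W$ is the group of permutations $w$ of $\{-d,\dots,d\}$ with $w(-i)=-w(i)$, with Coxeter generators $s_0=(-1,1)$, $s_i=(i,i+1)(-i,-i-1)$ ($1\le i<d$), length $\ell$. $\mathcal{H}$ is the Hecke algebra: free over $\mathcal{A}$ with basis $\{T_w\}_{w\in W}$, $T_wT_{w'}=T_{ww'}$ if $\ell(ww')=\ell(w)+\ell(w')$, $(T_{s_i}+1)(T_{s_i}-q)=0$. $\mathbb{I}=\{-m-n,\dots,m+n\}$ with parity $\widehat i=0$ if $|i|\le m$, $\widehat i=1$ if $|i|>m$. $\Lambda(m|n,d)=\{\lambda=(\lambda_0,\dots,\lambda_m|\lambda_{m+1},\dots,\lambda_{m+n})\in\mathbb{N}^{m+n+1}:\sum\lambda_i=d\}$, $\widetilde\lambda_i=\lambda_0+\cdots+\lambda_i$. Put $R_0^\lambda=\{-\lambda_0,\dots,\lambda_0\}$, $R_i^\lambda=\{\widetilde\lambda_{i-1}+1,\dots,\widetilde\lambda_i\}$ for $1\le i\le m+n$, $R_{-i}^\lambda=-R_i^\lambda$. $W_\lambda$ is generated by $\{s_0,\dots,s_{d-1}\}\setminus\{s_{\widetilde\lambda_0},\dots,s_{\widetilde\lambda_{m+n-1}}\}$;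 $W_{\lambda^{(0)}}$ (resp. $W_{\lambda^{(1)}}$) is generated by those $s_i\in W_\lambda$ with $i<\widetilde\lambda_m$ (resp. $i>\widetilde\lambda_m$); $W_\lambda=W_{\lambda^{(0)}}\times W_{\lambda^{(1)}}$ and $w\in W_\lambda$ is written uniquely $w=w^{(0)}w^{(1)}$, $w^{(i)}\in W_{\lambda^{(i)}}$. $[\mathrm{xy}]_\lambda=\sum_{w\in W_\lambda}(-q)^{-\ell(w^{(1)})}T_w$. $\mathcal{D}_{\lambda\mu}$ = shortest $(W_\lambda,W_\mu)$-double coset representatives; $\mathcal{D}^\circ_{\lambda\mu}=\{g\in\mathcal{D}_{\lambda\mu}: g^{-1}W_{\lambda^{(1)}}g\cap W_{\mu^{(0)}}=g^{-1}W_{\lambda^{(0)}}g\cap W_{\mu^{(1)}}=\{\mathbb 1\}\}$. $\Xi_{m|n,d}$ is the set of matrices $A=(a_{ij})_{i,j\in\mathbb{I}}$ over $\mathbb{N}$ with $\sum a_{ij}=2d+1$, $a_{ij}=a_{-i,-j}$, and $a_{ij}\in\{0,1\}$ whenever $\widehat i\ne\widehat j$. The map $\kappa(\lambda,g,\mu)=(|R_i^\lambda\cap gR_j^\mu|)_{i,j\in\mathbb{I}}$ is a bijection from triples with $\lambda,\mu\in\Lambda(m|n,d)$, $g\in\mathcal{D}^\circ_{\lambda\mu}$ onto $\Xi_{m|n,d}$. $\mathcal{S}^\jmath_{m|n,d}=\mathrm{End}_{\mathcal{H}}\big(\bigoplus_{\lambda\in\Lambda(m|n,d)}[\mathrm{xy}]_\lambda\mathcal{H}\big)$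 (right modules, product = composition). For $A=\kappa(\mu,g,\nu)\in\Xi_{m|n,d}$, let $W_\delta=g^{-1}W_\mu g\cap W_\nu$, $\mathcal{D}_\delta\cap W_\nu$ the shortest representatives of the right cosets $W_\delta\backslash W_\nu$, and let $e_A\in\mathcal{S}^\jmath_{m|n,d}$ be the right $\mathcal{H}$-linear map that is zero on $[\mathrm{xy}]_\lambda\mathcal{H}$ for $\lambda\neq\nu$ and sends $[\mathrm{xy}]_\nu\mapsto[\mathrm{xy}]_\mu T_g\sum_{w\in\mathcal{D}_\delta\cap W_\nu}(-q)^{-\ell(w^{(1)})}T_w$ (here $w=w^{(0)}w^{(1)}$, $w^{(i)}\in W_{\nu^{(i)}}$). Notation: $E^\theta_{ij}=E_{ij}+E_{-i,-j}$ with $E_{ij}$ the matrix units (so $E^\theta_{00}=2E_{00}$). $[a]_{\mathrm p}=(\mathrm p^a-1)/(\mathrm p-1)$ for $\mathrm p\in\{q,q^{-1}\}$; $[2a]_{\mathfrak c}=[a]_q(q^a+1)$. $\mathbf q_h=q^{(-1)^{\widehat h}}$; $\dot{\mathbf q}_h=1$, $\ddot{\mathbf q}_h=q$ if $\widehat h=0$; $\dot{\mathbf q}_h=-q^{-1}$, $\ddot{\mathbf q}_h=-1$ if $\widehat h=1$. *)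

(* Defs.v *)
From HB Require Import structures.
From mathcomp Require Import all_boot all_order all_fingroup all_algebra.
From mathcomp Require Import boolp classical_sets functions.

Set Implicit Arguments.
Unset Strict Implicit.
Unset Printing Implicit Defensive.

Import Order.TTheory GRing.Theory Num.Theory.
Local Open Scope ring_scope.

(* The ring Z[v, v^-1], as a subring of the fraction field of Z[v].           *)

Definition is_laurent : {pred {fraction {poly int}}} :=
  [pred x | `[< exists (p : {poly int}) (k : nat),
                  x = tofrac p / tofrac 'X ^+ k >]].

Lemma is_laurentP (x : {fraction {poly int}}) :
  reflect (exists (p : {poly int}) (k : nat), x = tofrac p / tofrac 'X ^+ k)
          (x \in is_laurent).
Proof. exact: asboolP. Qed.

Lemma tofracX_neq0 : tofrac ('X : {poly int}) != 0.
Proof. by rewrite tofrac_eq0 polyX_eq0. Qed.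

Lemma is_laurent_subring : subring_closed is_laurent.
Proof.
have nz k : tofrac ('X : {poly int}) ^+ k != 0 by rewrite expf_neq0 ?tofracX_neq0.
split.
- by apply/is_laurentP; exists 1, 0%N; rewrite tofrac1 expr0 divr1.
- move=> _ _ /is_laurentP[p [k ->]] /is_laurentP[r [l ->]].
  apply/is_laurentP; exists (p * 'X^l - r * 'X^k), (k + l)%N.
  by rewrite -mulNr addf_div ?nz // mulNr tofracB !tofracM !tofracXn exprD.
move=> _ _ /is_laurentP[p [k ->]] /is_laurentP[r [l ->]].
apply/is_laurentP; exists (p * r), (k + l)%N.
by rewrite tofracM exprD mulf_div.
Qed.

HB.instance Definition _ :=
  GRing.isSubringClosed.Build {fraction {poly int}} is_laurent
    is_laurent_subring.

Record laurent := Laurent {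
  laurent_val :> {fraction {poly int}};
  _ : laurent_val \in is_laurent }.

HB.instance Definition _ := [isSub for laurent_val].
HB.instance Definition _ := [Choice of laurent by <:].
HB.instance Definition _ := [SubChoice_isSubComNzRing of laurent by <:].

Definition laurent_unit : {pred laurent} :=
  [pred x : laurent | (val x != 0) && ((val x)^-1 \in is_laurent)].

Definition laurent_inv (x : laurent) : laurent :=
  if x \in laurent_unit then insubd x (val x)^-1 else x.

Fact laurent_mulVx : {in laurent_unit, left_inverse 1 laurent_inv *%R}.
Proof.
move=> x xU; rewrite /laurent_inv xU; have /andP[x_n0 xV] := xU.
have : val (insubd x (val x)^-1) = (val x)^-1 := insubdK x xV.
move: (insubd _ _) => y yE; apply: val_inj.
by apply: etrans (mulVf x_n0); rewrite -yE.
Qed.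

Fact laurent_unitPl (x y : laurent) : y * x = 1 -> x \in laurent_unit.
Proof.
move=> yx1; have vyx : val y * val x = 1 := congr1 val yx1.
have x_n0 : val x != 0.
  by apply: contra_eq_neq vyx => ->; rewrite mulr0 eq_sym oner_eq0.
rewrite inE x_n0 /=; suff -> : (val x)^-1 = val y by apply: valP.
by rewrite -[LHS]mul1r -vyx mulfK.
Qed.

Fact laurent_inv_out : {in [predC laurent_unit], laurent_inv =1 id}.
Proof. by move=> x; rewrite inE /= /laurent_inv => /negPf ->. Qed.

HB.instance Definition _ :=
  GRing.ComNzRing_hasMulInverse.Build laurent
    laurent_mulVx laurent_unitPl laurent_inv_out.

Fact laurent_v_subproof : tofrac ('X : {poly int}) \in is_laurent.
Proof. by apply/is_laurentP; exists 'X, 0%N; rewrite expr0 divr1. Qed.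

Definition v : laurent := Laurent laurent_v_subproof.
Definition q : laurent := v ^+ 2.

Lemma v_unit : v \is a GRing.unit.
Proof.
have vV : (tofrac ('X : {poly int}))^-1 \in is_laurent.
  by apply/is_laurentP; exists 1, 1%N; rewrite tofrac1 expr1 div1r.
apply/unitrP; exists (Laurent vV).
by split; apply: val_inj; rewrite rmorphM rmorph1 /= ?mulVf ?mulfV ?tofracX_neq0.
Qed.

Lemma q_unit : q \is a GRing.unit.
Proof. by rewrite unitrX ?v_unit. Qed.

(* [a]_p is the quotient (p^a - 1)/(p - 1), see qintE; p - 1 is not invertible *)
(* in Z[v, v^-1].                                                             *)
Definition qint (p : laurent) (a : nat) : laurent := \sum_(i < a) p ^+ i.

Lemma qintE p a : (p - 1) * qint p a = p ^+ a - 1.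
Proof. by rewrite subrX1. Qed.

(* [b]_c for even b: [2a]_c = [a]_q (q^a + 1). *)
Definition qintc (b : nat) : laurent := qint q b./2 * (q ^+ b./2 + 1).

(* The set {-N, ..., N} is encoded by 'I_(2N+1), the ordinal i standing for   *)
(* i - N; this preserves the order, and negation is rev_ord.                  *)

Notation sint N := 'I_(N.*2.+1).

Definition sval_int N (i : sint N) : int := (i : nat)%:Z - N%:Z.

(* The ordinal of the integer k in {-N, ..., N}; only meaningful for k <= N. *)
Definition sint_nat N (k : nat) : sint N := inord (N + k).

Lemma sval_intN N (i : sint N) : sval_int (rev_ord i) = - sval_int i.
Proof.
rewrite /sval_int /= subSS opprB; case: i => i /= iN.
by rewrite -subzn // -addnn PoszD addrAC addrK.
Qed.

Lemma sval_int_nat N k : (k <= N)%N -> sval_int (sint_nat N k) = k%:Z.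
Proof.
move=> kN; rewrite /sval_int /sint_nat inordK; last by rewrite ltnS -addnn leq_add2l.
by rewrite PoszD addrC addKr.
Qed.

Record sperm (d : nat) := SPerm {
  sperm_val :> {perm sint d};
  _ : [forall i, sperm_val (rev_ord i) == rev_ord (sperm_val i)] }.

HB.instance Definition _ d := [isSub for @sperm_val d].
HB.instance Definition _ d := [Finite of sperm d by <:].

Section SpermGroup.
Variable d : nat.
Implicit Types u w : sperm d.

Lemma spermN w i : w (rev_ord i) = rev_ord (w i).
Proof. by case: w => w /= /forallP/(_ i)/eqP. Qed.

Fact sperm_mul_subproof u w :
  let x := (sperm_val w * sperm_val u)%g in
  [forall i, x (rev_ord i) == rev_ord (x i)].
Proof. by apply/forallP => i; rewrite !permM !spermN. Qed.

Fact sperm_one_subproof :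
  let x := 1%g : {perm sint d} in [forall i, x (rev_ord i) == rev_ord (x i)].
Proof. by apply/forallP => i; rewrite !perm1. Qed.

Fact sperm_inv_subproof w :
  let x := ((sperm_val w)^-1)%g in [forall i, x (rev_ord i) == rev_ord (x i)].
Proof.
apply/forallP => i; apply/eqP; apply: (@perm_inj _ (sperm_val w)).
by rewrite spermN !permKV.
Qed.

(* Products of permutations in perm.v are read from left to right; the        *)
(* product of W is ordinary composition, (u * w) x = u (w x).                 *)
Definition sperm_mul u w : sperm d := SPerm (sperm_mul_subproof u w).
Definition sperm_one : sperm d := SPerm sperm_one_subproof.
Definition sperm_inv w : sperm d := SPerm (sperm_inv_subproof w).

Fact sperm_mulA : associative sperm_mul.
Proof. by move=> u w x; apply: val_inj; rewrite /= mulgA. Qed.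
Fact sperm_mul1 : left_id sperm_one sperm_mul.
Proof. by move=> u; apply: val_inj; rewrite /= mulg1. Qed.
Fact sperm_mulV : left_inverse sperm_one sperm_inv sperm_mul.
Proof. by move=> u; apply: val_inj; rewrite /= mulgV. Qed.

HB.instance Definition _ :=
  Finite_isGroup.Build (sperm d) sperm_mulA sperm_mul1 sperm_mulV.

Lemma spermM u w x : (u * w)%g x = u (w x).
Proof. exact: permM. Qed.

Definition sgen_perm (i : nat) : {perm sint d} :=
  let e k := sint_nat d k in
  if i == 0%N then tperm (rev_ord (e 1%N)) (e 1%N)
  else (tperm (e i) (e i.+1) * tperm (rev_ord (e i)) (rev_ord (e i.+1)))%g.

Fact sgen_subproof (i : 'I_d) :
  [forall x, sgen_perm i (rev_ord x) == rev_ord (sgen_perm i x)].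
Proof.
have tpN (a b x : sint d) :
    tperm a b (rev_ord x) = rev_ord (tperm (rev_ord a) (rev_ord b) x).
  by rewrite -{1}(rev_ordK a) -{1}(rev_ordK b) inj_tperm //; apply: rev_ord_inj.
apply/forallP => x; apply/eqP; rewrite /sgen_perm; case: (i =P 0%N :> nat) => [_|i0].
  by rewrite tpN rev_ordK tpermC.
rewrite !permM !tpN !rev_ordK; congr rev_ord.
rewrite -!permM; congr (fun_of_perm _ x).
set a := sint_nat d i; set b := sint_nat d i.+1.
have ea : sval_int a = i%:Z by rewrite sval_int_nat // ltnW.
have eb : sval_int b = i.+1%:Z by rewrite sval_int_nat.
have ne (y z : sint d) : 0 < sval_int y -> 0 < sval_int z -> y != rev_ord z.
  move=> y0 z0; apply/eqP => yz; move: y0; rewrite yz sval_intN oppr_gt0.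
  by rewrite ltNge ltW.
have a0 : 0 < sval_int a by rewrite ea ltz_nat lt0n; apply/eqP.
have b0 : 0 < sval_int b by rewrite eb.
have com : commute (tperm a b) (tperm (rev_ord a) (rev_ord b)).
  apply/commgP/conjg_fixP; rewrite tpermJ.
  by rewrite !tpermD // eq_sym; apply: ne.
by rewrite com.
Qed.

(* s_0 = (-1,1), s_i = (i,i+1)(-i,-i-1). *)
Definition sgen (i : 'I_d) : sperm d := SPerm (sgen_subproof i).

(* The Coxeter length: the least k such that w is a product of k generators   *)
(* (some k < #|W| does).                                                      *)
Definition slen (w : sperm d) : nat :=
  find (fun k => w \in ([set sgen i | i : 'I_d] ^+ k)%g) (iota 0 #|{: sperm d}|).

End SpermGroup.

(* By its presentation such an (H, T) is unique up to unique isomorphism.     *)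
Record is_hecke d (H : algType laurent) (T : sperm d -> H) : Prop := IsHecke {
  hecke_basis : forall x : H,
    exists! c : {ffun sperm d -> laurent}, x = \sum_w c w *: T w;
  heckeM : forall w w' : sperm d,
    slen (w * w')%g = (slen w + slen w')%N -> T w * T w' = T (w * w')%g;
  hecke_quad : forall i : 'I_d,
    (T (sgen i) + 1) * (T (sgen i) - q%:A) = 0 }.

(* Lambda(m|n,d); the bound lambda_i <= d is implied by the sum.              *)

Record wcomp (d m n : nat) := WComp {
  wcomp_val :> {ffun 'I_(m + n).+1 -> 'I_d.+1};
  _ : (\sum_i (wcomp_val i : nat))%N == d }.

HB.instance Definition _ d m n := [isSub for @wcomp_val d m n].
HB.instance Definition _ d m n := [Finite of wcomp d m n by <:].

Section Combinatorics.
Variables d m n : nat.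
Implicit Types (lam mu nu : wcomp d m n) (g w : sperm d).

Definition wsum lam (i : nat) : nat :=
  (\sum_(j < (m + n).+1 | j <= i) (lam j : nat))%N.

Definition parity (i : sint (m + n)) : bool := (m < `|sval_int i|)%N.

Definition posblock lam (k : nat) : {set sint d} :=
  [set x | (wsum lam k.-1)%:Z < sval_int x <= (wsum lam k)%:Z].

Definition block lam (i : sint (m + n)) : {set sint d} :=
  if sval_int i == 0 then [set x | (`|sval_int x| <= wsum lam 0)%N]
  else if 0 < sval_int i then posblock lam `|sval_int i|%N
  else [set rev_ord x | x in posblock lam `|sval_int i|%N].

(* If wsum lam j = d the generator s_d to be omitted does not exist, and the  *)
(* condition is vacuous for that j.                                           *)
Definition Wpar lam : {set sperm d} :=
  <<[set sgen i | i : 'I_d &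
      [forall j : 'I_(m + n), (i : nat) != wsum lam j]]>>%g.
Definition Wpar0 lam : {set sperm d} :=
  <<[set sgen i | i : 'I_d & (sgen i \in Wpar lam) && (i < wsum lam m)%N]>>%g.
Definition Wpar1 lam : {set sperm d} :=
  <<[set sgen i | i : 'I_d & (sgen i \in Wpar lam) && (wsum lam m < i)%N]>>%g.

(* For w in W_lambda = W_{lambda^(0)} x W_{lambda^(1)}, this is w^(1).        *)
Definition odd_part lam w : sperm d := remgr (Wpar0 lam) (Wpar1 lam) w.

Definition Dmin lam mu : {set sperm d} :=
  [set g | [forall x in Wpar lam, forall y in Wpar mu,
              (slen g <= slen (x * g * y)%g)%N]].

(* Here K :^ g is g^-1 K g. *)
Definition Dcirc lam mu : {set sperm d} :=
  [set g in Dmin lam mu |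
    ((Wpar1 lam :^ g :&: Wpar0 mu)%g == [set 1%g]) &&
    ((Wpar0 lam :^ g :&: Wpar1 mu)%g == [set 1%g])].

(* D_delta \cap W_nu, where W_delta = g^-1 W_mu g \cap W_nu. *)
Definition Ddelta mu g nu : {set sperm d} :=
  [set w in Wpar nu |
    [forall x in (Wpar mu :^ g :&: Wpar nu)%g, (slen w <= slen (x * w)%g)%N]].

(* Elements of Xi_{m|n,d} are represented as integer matrices with            *)
(* nonnegative entries, so that no truncated subtraction occurs.              *)
Definition Xi : {pred 'M[int]_((m + n).*2.+1)} :=
  [pred A : 'M[int]_((m + n).*2.+1) |
    [&& [forall i, forall j, 0 <= A i j],
        \sum_i \sum_j A i j == d.*2.+1%:Z,
        [forall i, forall j, A i j == A (rev_ord i) (rev_ord j)] &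
        [forall i, forall j,
          (parity i != parity j) ==> (A i j \in [:: 0; 1])]]].

Definition kappa lam g mu : 'M[int]_((m + n).*2.+1) :=
  \matrix_(i, j) (#|block lam i :&: [set g x | x in block mu j]|)%:Z.

End Combinatorics.

Arguments Xi d m n : clear implicits.

Definition Etheta N (i j : sint N) : 'M[int]_(N.*2.+1) :=
  delta_mx i j + delta_mx (rev_ord i) (rev_ord j).

Section QParameters.
Variables m n : nat.
Implicit Type i : sint (m + n).

Definition qpar i : laurent := q ^ ((-1) ^+ parity i : int).
Definition qdot i : laurent := if parity i then - q^-1 else 1.
Definition qddot i : laurent := if parity i then -1 else q.

End QParameters.

Section Schur.
Variables (d m n : nat) (H : algType laurent) (T : sperm d -> H).
Implicit Types (lam mu nu : wcomp d m n).

Definition xy lam : H :=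
  \sum_(w in Wpar lam) (- q) ^- slen (odd_part lam w) *: T w.

Definition is_xymod : {pred {ffun wcomp d m n -> H}} :=
  [pred x : {ffun wcomp d m n -> H} |
    `[< forall lam, exists h, x lam = xy lam * h >]].

Lemma is_xymodP (x : {ffun wcomp d m n -> H}) :
  reflect (forall lam, exists h, x lam = xy lam * h) (x \in is_xymod).
Proof. exact: asboolP. Qed.

Lemma is_xymod_submod : submod_closed is_xymod.
Proof.
split=> [|a x y /is_xymodP xP /is_xymodP yP]; apply/is_xymodP => lam.
  by exists 0; rewrite ffunE mulr0.
have [h xE] := xP lam; have [h' yE] := yP lam; exists (a *: h + h').
by rewrite !ffunE xE yE mulrDr scalerAr.
Qed.

HB.instance Definition _ :=
  GRing.isSubmodClosed.Build laurent {ffun wcomp d m n -> H} is_xymod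
    is_xymod_submod.

(* The direct sum of the right ideals [xy]_lambda H, as families of elements. *)
Record xymod := XYMod {
  xymod_val :> {ffun wcomp d m n -> H};
  _ : xymod_val \in is_xymod }.

HB.instance Definition _ := [isSub for xymod_val].
HB.instance Definition _ := [Choice of xymod by <:].
HB.instance Definition _ := [SubChoice_isSubLmodule of xymod by <:].

Fact xymod_ract_subproof (x : xymod) (h : H) :
  [ffun lam => x lam * h] \in is_xymod.
Proof.
apply/is_xymodP => lam; have /is_xymodP/(_ lam)[k xE] := valP x.
by exists (k * h); rewrite ffunE xE mulrA.
Qed.

Definition ract (x : xymod) (h : H) : xymod := XYMod (xymod_ract_subproof x h).

Fact xymod_in_subproof lam (h : H) :
  [ffun l => if l == lam then xy lam * h else 0] \in is_xymod.
Proof.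
apply/is_xymodP => l; rewrite ffunE; case: eqP => [->|_]; first by exists h.
by exists 0; rewrite mulr0.
Qed.

(* [xy]_lambda h, in the lambda-th summand. *)
Definition xymod_in lam (h : H) : xymod := XYMod (xymod_in_subproof lam h).

Definition is_schur : {pred (xymod -> xymod)} :=
  [pred f : xymod -> xymod |
     `[< (forall x y, f (x + y) = f x + f y) /\
                (forall x h, f (ract x h) = ract (f x) h) >]].

Lemma is_schurP (f : xymod -> xymod) :
  reflect ((forall x y, f (x + y) = f x + f y) /\
           (forall x h, f (ract x h) = ract (f x) h)) (f \in is_schur).
Proof. exact: asboolP. Qed.

Lemma is_schur_submod : submod_closed is_schur.
Proof.
split=> [|a f g /is_schurP[fD fM] /is_schurP[gD gM]]; apply/is_schurP.
  split=> [x y|x h]; first by rewrite [RHS]addr0.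
  by apply/val_inj/ffunP => lam; rewrite !ffunE mul0r.
split=> [x y|x h].
  have E z : (a *: f + g) z = a *: f z + g z by [].
  by rewrite !E fD gD scalerDr addrACA.
have E z : (a *: f + g) z = a *: f z + g z by [].
rewrite !E fM gM; apply/val_inj/ffunP => lam.
by rewrite !ffunE mulrDl scalerAl.
Qed.

HB.instance Definition _ :=
  GRing.isSubmodClosed.Build laurent (xymod -> xymod) is_schur is_schur_submod.

(* The right H-linear endomorphisms of xymod. *)
Record schur := Schur {
  schur_val :> xymod -> xymod;
  _ : schur_val \in is_schur }.

HB.instance Definition _ := [isSub for schur_val].
HB.instance Definition _ := [Choice of schur by <:].
HB.instance Definition _ := [SubChoice_isSubLmodule of schur by <:].

Fact schur_mul_subproof (f g : schur) : schur_val f \o schur_val g \in is_schur.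
Proof.
have /is_schurP[fD fM] := valP f; have /is_schurP[gD gM] := valP g.
apply/is_schurP; split=> [x y|x h] /=; first by rewrite gD fD.
by rewrite gM fM.
Qed.

Fact schur_one_subproof : id \in is_schur.
Proof. exact/is_schurP. Qed.

Definition schur_mul (f g : schur) : schur := Schur (schur_mul_subproof f g).
Definition schur_one : schur := Schur schur_one_subproof.

Fact schur_mulA : associative schur_mul.
Proof. by move=> f g h; apply: val_inj. Qed.
Fact schur_mul1l : left_id schur_one schur_mul.
Proof. by move=> f; apply: val_inj. Qed.
Fact schur_mul1r : right_id schur_one schur_mul.
Proof. by move=> f; apply: val_inj. Qed.
Fact schur_mulDl : left_distributive schur_mul +%R.
Proof. by move=> f g h; apply: val_inj. Qed.
Fact schur_mulDr : right_distributive schur_mul +%R.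
Proof.
move=> f g h; apply: val_inj; apply/funext => x.
by have /is_schurP[fD _] := valP f; apply: fD.
Qed.

HB.instance Definition _ :=
  GRing.Zmodule_isPzRing.Build schur
    schur_mulA schur_mul1l schur_mul1r schur_mulDl schur_mulDr.

Lemma schurM (f g : schur) x : (f * g) x = f (g x).
Proof. by []. Qed.

Lemma schurZ (c : laurent) (f : schur) x : (c *: f) x = c *: f x.
Proof. by []. Qed.

Lemma schurD (f g : schur) x : (f + g) x = f x + g x.
Proof. by []. Qed.

(* An H-linear f is determined by these values: [xy]_nu = xymod_in nu 1       *)
(* generates the nu-th summand.                                               *)
Definition is_e mu (g : sperm d) nu (f : schur) : Prop :=
  (forall lam h, lam != nu -> f (xymod_in lam h) = 0) /\
  f (xymod_in nu 1) =
    xymod_in mu (T g * \sum_(w in Ddelta mu g nu)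
                          (- q) ^- slen (odd_part nu w) *: T w).

(* xget 0 P is an element of P if there is one, and 0 otherwise; here kappa   *)
(* is injective and f is determined by is_e, so e_A is a definite description.*)
Definition e_ (A : 'M[int]_((m + n).*2.+1)) : schur :=
  if A \in Xi d m n then
    xget 0 [set f | exists mu g nu,
      [/\ g \in Dcirc mu nu, A = kappa mu g nu & is_e mu g nu f]]%classic
  else 0.

End Schur.

Arguments e_ {d m n H} T A.

(* Main.v *)
(** A combination of the e_A with A = kappa(lam, g, nu) sends [xy]_nu to an
    element z of H with T_s z = chi(s) z for s in W_lam and z T_s = chi(s) z for
    s in W_nu, where chi(s) is q for even and -1 for odd s.  The coefficients of
    such a z are determined by those at the y in W that are minimal both in
    W_lam y and in y W_nu.  For e_A itself, z is
      zeta_A = sum over the x with kappa(x) = A of (- q^-1)^N(x) T_x,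
    where N(x) is half the number of inversions of x inside an odd row block or
    an odd column block.

    If B - E^theta_{al,al+1} is diagonal, the colourings of {-d, ..., d} by the
    blocks of lam and of mu differ only at a point p and at -p.  Writing
    zeta_B = Y [xy]_mu, we get e_B e_A [xy]_nu = Y zeta_A, and Y is a combination
    of the T_x with x in W_lam minimal in x W_mu.  These x correspond to the
    points i = x(p) <> 0 of the block R_al of lam, and the coefficient of
    Y zeta_A at y is a weighted sum over i of the coefficients of zeta_A at
    x^-1 y.  The i such that y^-1(i) lies in the column block k give a geometric
    sum, which is the coefficient of e_(A_hk).

    Part (2) is part (1) for al = -(h+1), because W commutes with negation. *)

Require Import Defs.
From mathcomp Require Import all_boot all_order all_fingroup all_algebra.
From mathcomp Require boolp classical_sets.
From mathcomp Require Import zify ring.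

Set Implicit Arguments.
Unset Strict Implicit.
Unset Printing Implicit Defensive.

Import Order.TTheory GRing.Theory Num.Theory.
Local Open Scope ring_scope.

(** * Signed permutations *)

(* Otherwise simplification moves the group operations of W to {perm _}. *)
Arguments sperm_val : simpl never.

(** The obstacle is that x^-1 y is in general not minimal on either side, so the coefficient of
    zeta_A there cannot be read off from the definition of e_A. This is why N is defined on all of W
    through inversions: those of x^-1 y can be listed, because y is minimal on both sides and x is
    increasing on the blocks of mu. The constants of the theorem come out as follows. Inversions
    inside the row al + 1 give the power of qdot. The factor q^l(x) times the coefficient of Y at
    T_x is a power of qddot; the points of R_al in columns after k give the stated factor, and those
    in column k give the geometric sum, whose ratio is corrected by the inversions inside column k.
    The case h = k = 0 obeys the same rule: a_00 is odd, the point 0 is left out of R_0, and [2a]_c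
    = [2a]_q. *)

Section SignedPermutations.
Variable d : nat.
Implicit Types (i : 'I_d) (a b : sint d) (u w x y g : sperm d).

Lemma val_sint_nat N k : (k <= N)%N -> (sint_nat N k : nat) = (N + k)%N.
Proof. by move=> kN; rewrite /sint_nat inordK // -addnn; lia. Qed.

Lemma val_rev N (a : sint N) : (rev_ord a : nat) = (N.*2 - a)%N.
Proof. by rewrite /= subSS. Qed.

Lemma sint_eq N (a b : sint N) : (a : nat) = b -> a = b.
Proof. exact: val_inj. Qed.

Lemma rev_eqC N (a b : sint N) : (rev_ord a == b) = (a == rev_ord b).
Proof. by rewrite -(inj_eq rev_ord_inj) rev_ordK. Qed.

Lemma ltn_rev N (a b : sint N) : (rev_ord a < rev_ord b)%N = (b < a)%N.
Proof. by rewrite !val_rev; have := ltn_ord a; have := ltn_ord b; lia. Qed.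

Lemma leq_rev N (a b : sint N) : (rev_ord a <= rev_ord b)%N = (b <= a)%N.
Proof. by rewrite leqNgt ltn_rev -leqNgt. Qed.

Lemma spermK w : cancel w (w^-1)%g.
Proof. by move=> a; rewrite -spermM mulVg perm1. Qed.

Lemma spermKV w : cancel (w^-1)%g w.
Proof. by move=> a; rewrite -spermM mulgV perm1. Qed.

Lemma sperm_inj w : injective w.
Proof. exact: can_inj (spermK w). Qed.

Lemma sperm1 a : (1%g : sperm d) a = a.
Proof. exact: perm1. Qed.

Lemma spermP u w : (forall a, u a = w a) -> u = w.
Proof. by move=> uw; apply/val_inj/permP. Qed.

(** The ordinal of the integer k is d + k. This table turns facts on generators into linear
    arithmetic. *)
Lemma sgenE i a : (sgen i a : nat) =
  if (i : nat) == 0%N then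
    if (a : nat) == d.+1 then d.-1 else if (a : nat) == d.-1 then d.+1 else a
  else if (a : nat) == (d + i)%N then (d + i).+1
  else if (a : nat) == (d + i).+1 then (d + i)%N
  else if (a : nat) == (d - i)%N then (d - i).-1
  else if (a : nat) == (d - i).-1 then (d - i)%N else a.
Proof.
have id := ltn_ord i; have ad := ltn_ord a.
have e1 : (sint_nat d 1 : nat) = d.+1 by rewrite val_sint_nat ?addn1; lia.
have ei : (sint_nat d i : nat) = (d + i)%N by rewrite val_sint_nat //; lia.
have ei1 : (sint_nat d i.+1 : nat) = (d + i).+1 by rewrite val_sint_nat ?addnS; lia.
have nv (b c : sint d) : b <> c -> (b : nat) <> c by move=> bc /sint_eq.
change (sgen i a) with (sgen_perm d i a); rewrite /sgen_perm; case: (i =P 0%N :> nat) => i0.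
  by case: tpermP => [->|->|/nv + /nv]; rewrite ?val_rev ?e1; repeat case: eqP; lia.
rewrite permM.
have: [\/ a = sint_nat d i, a = sint_nat d i.+1 |
         a <> sint_nat d i /\ a <> sint_nat d i.+1].
  case: (a =P sint_nat d i) => [|?]; first by constructor 1.
  by case: (a =P sint_nat d i.+1) => [|?]; [constructor 2|constructor 3].
case=> [->|->|[a1 a2]].
- rewrite tpermL; case: tpermP => [/(congr1 val)|/(congr1 val)|_ _];
    rewrite /= ?subSS ?ei ?ei1; repeat case: eqP; lia.
- rewrite tpermR; case: tpermP => [/(congr1 val)|/(congr1 val)|_ _];
    rewrite /= ?subSS ?ei ?ei1; repeat case: eqP; lia.
rewrite (tpermD (x := sint_nat d i)); try exact/eqP/nesym.
move: a1 a2 => /nv a1 /nv a2.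
by case: tpermP => [aE|aE|/nv + /nv]; rewrite ?aE /= ?subSS ?ei ?ei1 in a1 a2 *;
  repeat case: eqP; lia.
Qed.

Lemma sgen_sq i : (sgen i * sgen i = 1)%g.
Proof.
apply: spermP => a; rewrite spermM sperm1; apply: sint_eq; rewrite !sgenE.
have := ltn_ord i; have := ltn_ord a; move: (nat_of_ord i) (nat_of_ord a) => I A.
by case: (I =P 0%N); repeat case: (_ =P _); lia.
Qed.

Lemma sgenV i : ((sgen i)^-1 = sgen i)%g.
Proof. by apply: (mulgI (sgen i)); rewrite mulgV sgen_sq. Qed.

Lemma sgenK i : involutive (sgen i).
Proof. by move=> a; rewrite -spermM sgen_sq sperm1. Qed.

Lemma sgenKl i w : (sgen i * (sgen i * w) = w)%g.
Proof. by rewrite mulgA sgen_sq mul1g. Qed.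

(* The pair (i, i+1), where i may be 0, plays the part of the simple root of   *)
(* s_i: up to negation it is the only pair other than (-1, 1) whose order is   *)
(* reversed by s_i.                                                            *)
Definition lo i : sint d := sint_nat d i.
Definition hi i : sint d := sint_nat d i.+1.

Lemma val_lo i : (lo i : nat) = (d + i)%N.
Proof. by rewrite val_sint_nat // ltnW. Qed.

Lemma val_hi i : (hi i : nat) = (d + i).+1.
Proof. by rewrite val_sint_nat // addnS. Qed.

Lemma lt_lo_hi i : (lo i < hi i)%N.
Proof. by rewrite val_lo val_hi. Qed.

Lemma sgen_hi_lo i : (sgen i (hi i) < sgen i (lo i))%N.
Proof.
rewrite !sgenE val_lo val_hi; have := ltn_ord i; move: (nat_of_ord i) => I.
by case: (I =P 0%N); repeat case: (_ =P _); lia.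
Qed.

Lemma sgen_lt i a b : (a < b)%N -> a != rev_ord b ->
  ~~ ((a == lo i) && (b == hi i)) ->
  ~~ ((a == rev_ord (hi i)) && (b == rev_ord (lo i))) ->
  (sgen i a < sgen i b)%N.
Proof.
rewrite -!(inj_eq val_inj) /= !subSS !val_lo !val_hi !sgenE.
have := ltn_ord i; have := ltn_ord a; have := ltn_ord b.
move: (nat_of_ord i) (nat_of_ord a) (nat_of_ord b) => I A B.
by case: (I =P 0%N); repeat case: (_ =P _); lia.
Qed.

End SignedPermutations.

(** * Inversions and the length function *)

Section Inversions.
Variable d : nat.
Implicit Types (i : 'I_d) (a b : sint d) (u w x y g : sperm d).

(** True exactly when left multiplication by s_i lengthens w, see [len_asc] and [len_desc]. *)
Definition asc i w : bool := ((w^-1)%g (lo i) < (w^-1)%g (hi i))%N.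

(* The pairs (-b, b) are left out, so that every simple reflection changes the *)
(* number of inversions by exactly 2.                                          *)
Definition invset (P : rel (sint d)) w : {set sint d * sint d} :=
  [set ab : sint d * sint d | [&& (ab.1 < ab.2)%N, ab.1 != rev_ord ab.2, P ab.1 ab.2 &
                (w ab.2 < w ab.1)%N]].

Definition rootset i w : {set sint d * sint d} :=
  let a := (w^-1)%g (lo i) in let b := (w^-1)%g (hi i) in
  [set (a, b); (rev_ord b, rev_ord a)].

Lemma invset_asc P i w : asc i w ->
  invset P (sgen i * w)%g =
    invset P w :|: (rootset i w :&: [set ab : sint d * sint d | P ab.1 ab.2])
  /\ [disjoint invset P w & rootset i w].
Proof.
rewrite /asc; set al := (w^-1)%g (lo i); set be := (w^-1)%g (hi i) => ab.
have wal : w al = lo i by rewrite spermKV.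
have wbe : w be = hi i by rewrite spermKV.
have lh : lo i != rev_ord (hi i).
  rewrite -(inj_eq val_inj) /= subSS val_lo val_hi; have := ltn_ord i; lia.
have nab : al != rev_ord be by rewrite -(inj_eq (@sperm_inj d w)) spermN wal wbe.
have root : forall c : sint d * sint d, (c \in rootset i w) =
    ((w c.1 == lo i) && (w c.2 == hi i)) ||
    ((w c.1 == rev_ord (hi i)) && (w c.2 == rev_ord (lo i))).
  case=> c c'; rewrite /rootset !inE !xpair_eqE /= -/al -/be.
  by rewrite -[c == al](inj_eq (@sperm_inj d w)) -[c' == be](inj_eq (@sperm_inj d w))
    -[c == _](inj_eq (@sperm_inj d w)) -[c' == _](inj_eq (@sperm_inj d w)) !spermN wal wbe.
have rootlt c1 c2 : (c1, c2) \in rootset i w -> [/\ (c1 < c2)%N, c1 != rev_ord c2,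
     (w c1 < w c2)%N & (sgen i (w c2) < sgen i (w c1))%N].
  rewrite !inE !xpair_eqE => /orP[]/andP[/eqP-> /eqP->].
    by rewrite wal wbe lt_lo_hi sgen_hi_lo nab.
  by rewrite !spermN !ltn_rev ?rev_ordK wal wbe lt_lo_hi sgen_hi_lo eq_sym nab.
split; last first.
  apply/pred0Pn => -[[c1 c2] /andP[/= + /rootlt[]]].
  by rewrite inE => /and4P[_ _ _ /=]; lia.
apply/setP => c; rewrite in_setU in_setI !inE !spermM.
have := rootlt c.1 c.2; rewrite -surjective_pairing; have := root c; rewrite !inE -/al -/be => ->.
case: (boolP (_ || _)) => /= [_ /(_ isT)[-> -> c12 ->]|].
  by rewrite andbT; case: (P _ _) => //=; rewrite ?orbT // andbF.
rewrite negb_or => /andP[n1 n2] _; rewrite orbF.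
case: (boolP (c.1 < c.2)%N) => //= c12; case: (c.1 =P rev_ord c.2) => //= cN.
have wcN : w c.1 != rev_ord (w c.2).
  by rewrite -spermN (inj_eq (@sperm_inj d w)); apply/eqP.
case: (P _ _) => //=; apply/idP/idP => [|w21]; last first.
  apply: sgen_lt => //; first by rewrite -rev_eqC eq_sym.
    apply/negP => /andP[/eqP]; rewrite -wal -wbe => /sperm_inj e1 /eqP/sperm_inj e2.
    by move: c12; rewrite e1 e2 ltnNge ltnW.
  apply/negP => /andP[/eqP]; rewrite -wal -wbe -!(spermN w) => /sperm_inj e1 /eqP/sperm_inj e2.
  by move: c12; rewrite e1 e2 ltn_rev ltnNge ltnW.
apply: contraLR; rewrite -!leqNgt leq_eqVlt => /orP[/eqP/sint_eq/sperm_inj cE|w12].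
  by move: c12; rewrite cE ltnn.
by rewrite ltnW // sgen_lt.
Qed.

Lemma invset_sub (P Q : rel (sint d)) w :
    (forall a b, (w b < w a)%N -> P a b -> Q a b) ->
  invset P w \subset invset Q w.
Proof.
move=> PQ; apply/fintype.subsetP => c; rewrite !inE => /and4P[-> -> p lt].
by rewrite lt (PQ _ _ lt p).
Qed.

Lemma eq_invset (P Q : rel (sint d)) w :
    (forall a b, (w b < w a)%N -> P a b = Q a b) ->
  invset P w = invset Q w.
Proof.
move=> PQ; apply/eqP; rewrite eqEsubset.
by apply/andP; split; apply: invset_sub => a b /PQ->.
Qed.

Lemma card_rootset i w : #|rootset i w| = 2.
Proof.
rewrite cards2 xpair_eqE negb_and; case: eqP => //= wE.
have /(congr1 w) := wE; rewrite spermN !spermKV => /(congr1 val).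
by rewrite /= subSS val_lo val_hi; have := ltn_ord i; lia.
Qed.

(** Sign changes are still counted, through the pairs (0, b) and (-b, 0). Inversions come in twos
    exchanged by negation, whence the half in [len]. *)
Definition len2 w := #|invset (fun _ _ => true) w|.
Definition len w := (len2 w)./2.

Lemma len_asc i w : asc i w -> len (sgen i * w)%g = (len w).+1.
Proof.
move=> /(invset_asc (fun _ _ => true))[iE dj]; rewrite /len /len2 iE.
have -> : rootset i w :&: [set _ | true] = rootset i w.
  by apply/setP => c; rewrite !inE andbT.
by rewrite cardsU (disjoint_setI0 dj) cards0 subn0 card_rootset addn2.
Qed.

Lemma sperm_leq w a b : a != b -> (w a <= w b)%N = (w a < w b)%N.
Proof.
by move=> ab; rewrite leq_eqVlt (inj_eq val_inj) (inj_eq (@sperm_inj d w)) (negPf ab).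
Qed.

Lemma asc_sgen i w : asc i (sgen i * w)%g = ~~ asc i w.
Proof.
rewrite /asc invMg sgenV !spermM -leqNgt.
(* For i > 0, s_i exchanges [lo i] and [hi i]; for i = 0 it fixes [lo i], which is the point 0, and
   negates [hi i]. *)
have slo : sgen i (lo i) = hi i \/ sgen i (lo i) = lo i /\ sgen i (hi i) = rev_ord (hi i).
  have := ltn_ord i => id; case: (i =P 0%N :> nat) => i0; [right|left].
    split; apply: sint_eq; rewrite sgenE ?val_rev !(val_lo, val_hi) i0 /=;
    repeat case: eqP; lia.
  apply: sint_eq; rewrite sgenE !(val_lo, val_hi); repeat case: eqP; lia.
have hl : hi i != lo i by rewrite neq_ltn lt_lo_hi orbT.
case: slo => [s1|[s1 s2]]; first by rewrite s1 -s1 sgenK s1 sperm_leq.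
have lo0 : rev_ord (lo i) = lo i.
  apply: sint_eq; move: s2 => /(congr1 val) /=; rewrite sgenE subSS !val_lo !val_hi.
  have := ltn_ord i; repeat case: eqP; lia.
by rewrite s1 s2 spermN -{1}lo0 spermN ltn_rev sperm_leq.
Qed.

Lemma len_desc i w : ~~ asc i w -> len w = (len (sgen i * w)%g).+1.
Proof. by rewrite -asc_sgen => /len_asc; rewrite sgenKl. Qed.

Lemma card_invsetV (P : rel (sint d)) w :
  #|invset P (w^-1)%g| = #|invset (fun a b => P (w b) (w a)) w|.
Proof.
pose f (c : sint d * sint d) := (w c.2, w c.1).
have f_inj : injective f.
  by move=> [a b] [a' b'] [/sperm_inj-> /sperm_inj->].
rewrite -[RHS](card_imset _ f_inj); apply: eq_card => -[a b]; apply/idP/imsetP.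
  rewrite !inE /= => /and4P[ab nab p wba].
  exists (w^-1%g b, w^-1%g a); last by rewrite /f /= !spermKV.
  rewrite inE /= !spermKV ab wba p !andbT /=.
  by rewrite -spermN (inj_eq (@sperm_inj d _)) -rev_eqC eq_sym.
case=> -[a' b']; rewrite !inE /= => /and4P[ab nab p wba] [-> ->] /=.
rewrite !spermK ab wba p /= andbT -spermN (inj_eq (@sperm_inj d _)).
by rewrite -rev_eqC eq_sym.
Qed.

Lemma lenV w : len (w^-1)%g = len w.
Proof. by rewrite /len /len2 card_invsetV. Qed.

Lemma len1 : len 1%g = 0%N.
Proof.
rewrite /len /len2 (_ : invset _ _ = finset.set0) ?cards0 //.
apply/setP => c; rewrite !inE !sperm1.
by apply/negP => /and4P[lt _ _]; rewrite ltnNge ltnW.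
Qed.

Lemma consecutive a b : (b : nat) = a.+1 ->
  exists i, a = lo i /\ b = hi i \/ a = rev_ord (hi i) /\ b = rev_ord (lo i).
Proof.
move=> ba; have := ltn_ord b; have := ltn_ord a; rewrite ba => aN bN.
case: (leqP d a) => da.
  have id : (a - d < d)%N by lia.
  exists (Ordinal id); left; split; apply: sint_eq; rewrite ?val_lo ?val_hi /=; lia.
have id : (d - a.+1 < d)%N by lia.
exists (Ordinal id); right; split; apply: sint_eq; rewrite val_rev ?val_lo ?val_hi /=; lia.
Qed.

End Inversions.

(** * Parabolic subgroups as stabilisers of odd monotone maps *)

Section Parabolic.
Variables (d N : nat) (f : sint d -> sint N).
Hypothesis f_mono : forall a b : sint d, (a <= b)%N -> (f a <= f b)%N.
Hypothesis f_rev : forall a : sint d, f (rev_ord a) = rev_ord (f a).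
Implicit Types (i : 'I_d) (a b : sint d) (u w x y g : sperm d).

Definition preserves w := forall a, f (w a) = f a.

Definition increasing w := forall a b, (a < b)%N -> f a = f b -> (w a < w b)%N.

Definition simple i := f (lo i) == f (hi i).

(** By monotonicity f is constant between a and b, so a chain of consecutive points works; each link
    is a simple pair or the negative of one. *)
Lemma increasing_ofP w :
  (forall i, simple i -> (w (lo i) < w (hi i))%N) -> increasing w.
Proof.
move=> winc a b; move: {-1}(b - a.+1)%N (erefl (b - a.+1)%N) => k.
elim: k b => [|k IHk] b bk ab fab.
  have ba : (b : nat) = a.+1 by lia.
  have [i [[aE bE]|[aE bE]]] := consecutive ba.
    by rewrite aE bE winc // /simple -aE -bE fab.
  rewrite aE bE !spermN ltn_rev winc //.
  by rewrite /simple -(inj_eq rev_ord_inj) -!f_rev -aE -bE fab.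
have b'N : (b.-1 < d.*2.+1)%N by have := ltn_ord b; lia.
pose b' : sint d := Ordinal b'N.
have fa' : f a = f b'.
  apply: sint_eq; apply/eqP; rewrite eqn_leq f_mono /=; last by lia.
  by rewrite fab f_mono //= leq_pred.
apply: (@ltn_trans (w b')); first by apply: IHk => //=; lia.
have bb' : (b : nat) = b'.+1 by rewrite /=; lia.
have [i [[aE bE]|[aE bE]]] := consecutive bb'.
  by rewrite aE bE winc // /simple -aE -bE -fab fa'.
rewrite aE bE !spermN ltn_rev winc //.
by rewrite /simple -(inj_eq rev_ord_inj) -!f_rev -aE -bE -fab fa'.
Qed.

Lemma preserves1 : preserves 1%g.
Proof. by move=> a; rewrite sperm1. Qed.

Lemma preservesV w : preserves w -> preserves (w^-1)%g.
Proof. by move=> wf a; rewrite -{2}(spermKV w a) wf. Qed.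

Lemma preservesM u w : preserves u -> preserves w -> preserves (u * w)%g.
Proof. by move=> uf wf a; rewrite spermM uf wf. Qed.

Lemma preserves_sgen i : simple i -> preserves (sgen i).
Proof.
move=> /eqP fi a; have := ltn_ord i; have := ltn_ord a => ad id.
have f0 : (i : nat) = 0%N -> f (rev_ord (hi i)) = f (hi i).
  move=> i0; rewrite f_rev -fi -f_rev; congr f.
  by apply: sint_eq; rewrite val_rev val_lo i0; lia.
have eqs (b c : sint d) : (b : nat) = c -> b = c by exact: sint_eq.
have := sgenE i a; case: (i =P 0%N :> nat) => i0.
  case: eqP => [a1|_]; [|case: eqP => [a1|_ /eqs->//]] => s1.
    have -> : sgen i a = rev_ord (hi i) by apply: eqs; rewrite s1 val_rev val_hi; lia.
    by rewrite f0 //; congr f; apply: eqs; rewrite val_hi; lia.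
  have -> : sgen i a = hi i by apply: eqs; rewrite s1 val_hi; lia.
  by rewrite -f0 //; congr f; apply: eqs; rewrite val_rev val_hi; lia.
case: eqP => [a1 s1|_].
  have -> : sgen i a = hi i by apply: eqs; rewrite s1 val_hi; lia.
  by rewrite -fi; congr f; apply: eqs; rewrite val_lo; lia.
case: eqP => [a1 s1|_].
  have -> : sgen i a = lo i by apply: eqs; rewrite s1 val_lo; lia.
  by rewrite fi; congr f; apply: eqs; rewrite val_hi; lia.
case: eqP => [a1 s1|_].
  have -> : sgen i a = rev_ord (hi i) by apply: eqs; rewrite s1 val_rev val_hi; lia.
  by rewrite f_rev -fi -f_rev; congr f; apply: eqs; rewrite val_rev val_lo; lia.
case: eqP => [a1 s1|_ /eqs->//].
have -> : sgen i a = rev_ord (lo i) by apply: eqs; rewrite s1 val_rev val_lo; lia.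
by rewrite f_rev fi -f_rev; congr f; apply: eqs; rewrite val_rev val_hi; lia.
Qed.

Lemma increasing1 : increasing 1%g.
Proof. by move=> a b; rewrite !sperm1. Qed.

Lemma asc_incr x : (forall i, simple i -> asc i x) -> increasing (x^-1)%g.
Proof. exact: increasing_ofP. Qed.

Lemma incr_preserves1 w : preserves w -> increasing w -> w = 1%g.
Proof.
move=> wf winc.
have {}winc a b : (a < b)%N -> (w a < w b)%N.
  move=> ab; have := f_mono (ltnW ab); rewrite leq_eqVlt => /orP[/eqP/sint_eq|fab].
    exact: winc.
  by rewrite ltnNge; apply: contraL fab => /f_mono; rewrite !wf -leqNgt.
(* A strictly increasing w satisfies a <= w a; at -a this gives w a <= a. *)
have le k : forall a, (a : nat) = k -> (a <= w a)%N.
  elim: k => [|k IHk] a ak; first by rewrite ak.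
  have kN : (k < d.*2.+1)%N by have := ltn_ord a; lia.
  have := IHk (Ordinal kN) erefl; have : (w (Ordinal kN) < w a)%N by apply: winc; rewrite /= ak.
  rewrite /=; lia.
apply: spermP => a; rewrite sperm1; apply: sint_eq; apply/eqP.
by rewrite eqn_leq (le _ a erefl) andbT -leq_rev -spermN (le _ _ erefl).
Qed.

Lemma asc_or_simple u i : preserves u -> ~~ asc i u -> simple i.
Proof.
move=> /preservesV uf; rewrite /asc -leqNgt => /f_mono; rewrite !uf => le.
by apply/eqP/sint_eq/eqP; rewrite eqn_leq le f_mono // ltnW // lt_lo_hi.
Qed.

(** A descent of an element of the stabiliser is simple ([asc_or_simple]), so it can be stripped
    without leaving the stabiliser. An element without descents is 1. *)
Lemma preserves_ind (P : sperm d -> Prop) : P 1%g ->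
  (forall i u, simple i -> preserves u -> asc i u -> P u -> P (sgen i * u)%g) ->
  forall u, preserves u -> P u.
Proof.
move=> P1 PS u; move: {-1}(len u) (leqnn (len u)) => k; elim: k u => [|k IHk] u uk uf.
all: have [/forallP asc_u|] := boolP [forall i, asc i u].
1,3: suff -> : u = 1%g by [].
1,2: apply: (mulgI (u^-1)%g); rewrite mulVg mulg1; apply/esym/incr_preserves1;
  [exact: preservesV|by apply: asc_incr => i _].
  by rewrite negb_forall => /existsP[i /len_desc]; lia.
rewrite negb_forall => /existsP[i ui].
have si := asc_or_simple uf ui; rewrite -(sgenKl i u).
have u'f : preserves (sgen i * u)%g by apply: preservesM => //; apply: preserves_sgen.
apply: PS => //; first by rewrite asc_sgen.
by apply: IHk => //; have := len_desc ui; lia.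
Qed.

Lemma len_preserves u x : preserves u -> increasing (x^-1)%g ->
  len (u * x)%g = (len u + len x)%N.
Proof.
move=> uf xinc; elim/preserves_ind: u / uf => [|i u si uf ui IHu]; first by rewrite mul1g len1.
rewrite -mulgA !len_asc // ?IHu //; rewrite /asc invMg !spermM; apply: xinc => //.
by rewrite !(preservesV uf); apply/eqP.
Qed.

End Parabolic.

(** * Agreement with the Coxeter length *)

Section Length.
Variable d : nat.
Implicit Types (i : 'I_d) (u w x y g : sperm d).

Lemma sperm_ind (P : sperm d -> Prop) : P 1%g ->
  (forall i u, asc i u -> P u -> P (sgen i * u)%g) -> forall u, P u.
Proof.
(* All of W preserves a constant map. *)
move=> P1 PS u; pose f (_ : sint d) : sint 0 := ord0.
apply: (@preserves_ind d 0 f) => // [a|i {}u _ _]; last exact: PS.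
exact: sint_eq.
Qed.

Lemma len_gens k w : w \in ([set sgen i | i : 'I_d] ^+ k)%g -> (len w <= k)%N.
Proof.
elim: k w => [|k IHk] w; first by rewrite expg0 inE => /eqP->; rewrite len1.
rewrite expgS => /mulsgP[_ x /imsetP[i _ ->] /IHk xk ->].
have [/len_asc->//|xi] := boolP (asc i x).
by apply/leqW/(leq_trans _ xk); rewrite [leqRHS](len_desc xi).
Qed.

Lemma mem_gens_len w : w \in ([set sgen i | i : 'I_d] ^+ len w)%g.
Proof.
elim/sperm_ind: w => [|i w iw IHw]; first by rewrite len1 expg0 inE.
by rewrite len_asc // expgS mem_mulg // imset_f.
Qed.

(** [slen] searches only below #|W|. Building w up one generator at a time meets every length up to
    [len w], so W has more than [len w] elements. *)
Lemma len_lt_card w : (len w < #|{: sperm d}|)%N.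
Proof.
suff le : {subset iota 0 (len w).+1 <= map (@len d) (enum {: sperm d})}.
  by have := uniq_leq_size (iota_uniq _ _) le; rewrite size_iota size_map -cardE.
move=> k; rewrite mem_iota add0n ltnS /=; elim/sperm_ind: w => [|i w iw IHw].
  by rewrite len1 leqn0 => /eqP->; rewrite -{1}(len1 d) map_f // mem_enum.
rewrite len_asc // leq_eqVlt => /orP[/eqP->|/IHw//].
by rewrite -(len_asc iw) map_f // mem_enum.
Qed.

Lemma slenE w : slen w = len w.
Proof.
rewrite /slen; set p := (fun k : nat => _); set s := iota _ _.
have s_len : (len w < size s)%N by rewrite size_iota len_lt_card.
have nths k : (k < size s)%N -> nth 0%N s k = k.
  by rewrite size_iota => ks; rewrite nth_iota.
have hasp : has p s.
  by apply/hasP; exists (len w); rewrite ?mem_iota ?len_lt_card // /p mem_gens_len.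
apply/eqP; rewrite eqn_leq; apply/andP; split.
  rewrite leqNgt; apply/negP => /(before_find 0%N); rewrite nths // /p.
  by rewrite mem_gens_len.
have := nth_find 0%N hasp; rewrite nths -?has_find // => /len_gens.
by [].
Qed.

End Length.

Section Hecke.
Variables (d : nat) (H : algType laurent) (T : sperm d -> H).
Hypothesis HT : is_hecke T.
Implicit Types (i : 'I_d) (u w x y g : sperm d) (c : {ffun sperm d -> laurent}).

Definition elt c : H := \sum_w c w *: T w.

Lemma elt_inj : injective elt.
Proof.
move=> c c' cc'; have [c0 [_ u]] := hecke_basis HT (elt c).
by rewrite -(u c) // -(u c').
Qed.

Definition coefs (z : H) : {ffun sperm d -> laurent} :=
  sval (boolp.cid (hecke_basis HT z)).

Lemma coefsK z : elt (coefs z) = z.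
Proof. by rewrite /coefs; case: boolp.cid => c [/= zc _]. Qed.

Lemma eltK : cancel elt coefs.
Proof. by move=> c; apply: elt_inj; rewrite coefsK. Qed.

Lemma elt_linear a c c' : elt [ffun w => a * c w + c' w] = a *: elt c + elt c'.
Proof.
rewrite /elt scaler_sumr -big_split; apply: eq_bigr => w _ /=.
by rewrite ffunE scalerDl scalerA.
Qed.

Lemma coefs_linear a z z' w : coefs (a *: z + z') w = a * coefs z w + coefs z' w.
Proof.
by rewrite -{1}(coefsK z) -{1}(coefsK z') -elt_linear eltK ffunE.
Qed.

Lemma coefs0 w : coefs 0 w = 0.
Proof.
have -> : 0 = elt [ffun => 0] by rewrite /elt big1 // => x _; rewrite ffunE scale0r.
by rewrite eltK ffunE.
Qed.

Lemma coefsZ a z w : coefs (a *: z) w = a * coefs z w.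
Proof. by rewrite -[_ *: _]addr0 coefs_linear coefs0 addr0. Qed.

Lemma coefsD z z' w : coefs (z + z') w = coefs z w + coefs z' w.
Proof. by rewrite -[z]scale1r coefs_linear mul1r scale1r. Qed.

Lemma coefs_sum (I : finType) (P : pred I) (F : I -> H) w :
  coefs (\sum_(k | P k) F k) w = \sum_(k | P k) coefs (F k) w.
Proof.
elim/big_rec2: _ => [|k a z _ <-]; first exact: coefs0.
by rewrite coefsD.
Qed.

Lemma coefsT w x : coefs (T w) x = (x == w)%:R.
Proof.
have -> : T w = elt [ffun x => (x == w)%:R].
  rewrite /elt (bigD1 w) //= ffunE eqxx scale1r big1 ?addr0 // => y /negPf yw.
  by rewrite ffunE yw scale0r.
by rewrite eltK ffunE.
Qed.

Lemma coefsP z z' : coefs z =1 coefs z' -> z = z'.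
Proof. by move/ffunP=> zz'; rewrite -(coefsK z) zz' coefsK. Qed.

Lemma TM u w : len (u * w)%g = (len u + len w)%N -> T u * T w = T (u * w)%g.
Proof. by move=> uw; rewrite (heckeM HT) // !slenE. Qed.

Lemma T1 : T 1%g = 1.
Proof.
rewrite -[RHS]coefsK -[LHS]mulr1 -[X in _ * X]coefsK /elt mulr_sumr.
by apply: eq_bigr => w _; rewrite -scalerAr TM ?mul1g ?len1.
Qed.

Lemma len_sgen i : len (sgen i) = 1%N.
Proof.
by rewrite -[sgen i]mulg1 len_asc ?len1 // /asc invg1 !sperm1 lt_lo_hi.
Qed.

Lemma sgen_quad i : T (sgen i) * T (sgen i) = (q - 1) *: T (sgen i) + q *: 1.
Proof.
have := hecke_quad HT i; rewrite mulrDl mul1r !mulrBr -scalerAr mulr1 => E.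
apply/subr0_eq; rewrite -E scalerBl scale1r opprD opprB !addrA.
by congr (_ - _); rewrite addrAC.
Qed.

End Hecke.

(** * The Hecke algebra *)

(* If z = sum_w c_w T_w satisfies T_s z = q z (s even) or T_s z = - z (s odd), *)
(* then c_(s w) = chi c_w whenever l(s w) > l(w).                              *)
Definition chi (o : bool) : laurent := if o then - q^-1 else 1.

Lemma q_mulIr (a b : laurent) : q * a = q * b -> a = b.
Proof. exact: (mulrI q_unit). Qed.

(** This is the relation t^2 = (q - 1) t + q at the eigenvalue t = q chi, divided by q. *)
Lemma chi_quad o : 1 + (q - 1) * chi o = q * chi o * chi o.
Proof.
case: o; rewrite /chi; last by rewrite !mulr1 addrC subrK.
have qV : q * q^-1 = 1 by rewrite divrr ?q_unit.
transitivity (1 - q * q^-1 + q^-1); first by ring.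
by rewrite qV subrr add0r !mulrN qV mulN1r opprK.
Qed.

Section HeckeAction.
Variables (d : nat) (H : algType laurent) (T : sperm d -> H).
Hypothesis HT : is_hecke T.
Implicit Types (i : 'I_d) (u w x y g : sperm d) (c : {ffun sperm d -> laurent}).
Notation elt := (elt T).
Notation coefs := (coefs HT).

Lemma Tl_asc i w : asc i w -> T (sgen i) * T w = T (sgen i * w)%g.
Proof. by move=> iw; rewrite (TM HT) // len_asc // len_sgen. Qed.

Lemma Tl_desc i w : ~~ asc i w ->
  T (sgen i) * T w = (q - 1) *: T w + q *: T (sgen i * w)%g.
Proof.
rewrite -asc_sgen => /Tl_asc; rewrite sgenKl => <-.
by rewrite mulrA (sgen_quad HT) mulrDl -!scalerAl mul1r.
Qed.

Lemma Tr_asc i w : asc i (w^-1)%g -> T w * T (sgen i) = T (w * sgen i)%g.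
Proof.
move=> iw; rewrite (TM HT) // -lenV invMg sgenV len_asc // len_sgen lenV.
by rewrite addnC.
Qed.

Lemma Tr_desc i w : ~~ asc i (w^-1)%g ->
  T w * T (sgen i) = (q - 1) *: T w + q *: T (w * sgen i)%g.
Proof.
rewrite -asc_sgen -[X in asc i X]invgK invMg invgK sgenV => /Tr_asc.
rewrite -mulgA sgen_sq mulg1 => <-.
by rewrite -mulrA (sgen_quad HT) mulrDr -!scalerAr mulr1.
Qed.

(** * Multiplication by a generator, from either side *)

Section Operator.
Variables (op : H -> H) (sig : sperm d -> sperm d) (A : pred (sperm d)).
Hypothesis op_elt : forall c, op (elt c) = \sum_w c w *: op (T w).
Hypothesis sigK : involutive sig.
Hypothesis A_sig : forall w, A (sig w) = ~~ A w.
Hypothesis op_asc : forall w, A w -> op (T w) = T (sig w).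
Hypothesis op_desc : forall w, ~~ A w -> op (T w) = (q - 1) *: T w + q *: T (sig w).

Lemma op_coefs c w : coefs (op (elt c)) w =
  if A w then q * c (sig w) else c (sig w) + (q - 1) * c w.
Proof.
pose c' := [ffun w => if A w then q * c (sig w) else c (sig w) + (q - 1) * c w].
suff -> : op (elt c) = elt c' by rewrite eltK ffunE.
rewrite op_elt /elt (bigID A) [RHS](bigID A) /= addrC.
have -> : \sum_(x | A x) c x *: op (T x) = \sum_(x | ~~ A x) c (sig x) *: T x.
  rewrite (reindex_inj (can_inj sigK)) /=; apply: eq_big => [x|x Ax]; first exact: A_sig.
  by rewrite op_asc // sigK.
have -> : \sum_(x | ~~ A x) c x *: op (T x) =
    \sum_(x | ~~ A x) ((q - 1) * c x) *: T x + \sum_(x | A x) (q * c (sig x)) *: T x.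
  rewrite [X in _ + X](reindex_inj (can_inj sigK)) /=.
  under [X in _ + X]eq_bigl do rewrite A_sig.
  rewrite -big_split; apply: eq_bigr => x Ax /=.
  by rewrite op_desc // sigK scalerDr !scalerA ![c x * _]mulrC.
rewrite addrAC addrC; congr (_ + _).
  by apply: eq_bigr => x Ax; rewrite ffunE Ax.
rewrite -big_split; apply: eq_bigr => x /negPf Ax /=.
by rewrite ffunE Ax addrC scalerDl.
Qed.

(** The eigenvalue equation at a w outside A follows from the condition at [sig w] and [chi_quad];
    conversely, its coefficient at a w in A, divided by q, is the condition. *)
Lemma op_eigenP o c :
  (forall w, A w -> c (sig w) = chi o * c w) <-> op (elt c) = (q * chi o) *: elt c.
Proof.
split=> [ce|ce w Aw].
  apply: (coefsP (HT := HT)) => w; rewrite coefsZ eltK op_coefs; case: ifP => Aw.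
    by rewrite ce // mulrA.
  have [u Au ->] : exists2 u, A u & w = sig u.
    by exists (sig w); rewrite ?A_sig ?Aw ?sigK.
  by rewrite sigK ce // mulrA -[X in X + _]mul1r -mulrDl chi_quad mulrA.
have /(congr1 (fun z => coefs z w)) := ce; rewrite coefsZ eltK op_coefs Aw -[_ * chi o * _]mulrA.
by move/q_mulIr.
Qed.

End Operator.

Lemma Tl_coefs i c w : coefs (T (sgen i) * elt c) w =
  if asc i w then q * c (sgen i * w)%g else c (sgen i * w)%g + (q - 1) * c w.
Proof.
apply: (op_coefs (op := fun z => T (sgen i) * z)
         (sig := fun w => (sgen i * w)%g)) => [{}c|{}w|{}w||].
- by rewrite mulr_sumr; apply: eq_bigr => x _; rewrite -scalerAr.
- exact: sgenKl.
- exact: asc_sgen.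
- exact: Tl_asc.
- exact: Tl_desc.
Qed.

Lemma leigenP i o c :
  (forall w, asc i w -> c (sgen i * w)%g = chi o * c w) <->
  T (sgen i) * elt c = (q * chi o) *: elt c.
Proof.
apply: (op_eigenP (op := fun z => T (sgen i) * z)
         (sig := fun w => (sgen i * w)%g)) => [{}c|w|w||].
- by rewrite mulr_sumr; apply: eq_bigr => x _; rewrite -scalerAr.
- exact: sgenKl.
- exact: asc_sgen.
- exact: Tl_asc.
- exact: Tl_desc.
Qed.

Lemma reigenP i o c :
  (forall w, asc i (w^-1)%g -> c (w * sgen i)%g = chi o * c w) <->
  elt c * T (sgen i) = (q * chi o) *: elt c.
Proof.
apply: (op_eigenP (op := fun z => z * T (sgen i)) (sig := fun w => (w * sgen i)%g)
         (A := fun w => asc i (w^-1)%g)) => [{}c|w|w||].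
- by rewrite mulr_suml; apply: eq_bigr => x _; rewrite -scalerAl.
- by rewrite /= -mulgA sgen_sq mulg1.
- by rewrite invMg sgenV asc_sgen.
- exact: Tr_asc.
- exact: Tr_desc.
Qed.

End HeckeAction.

(** * Colourings and parabolic subgroups *)

(** A composition is handled through the map sending a point to the index of its block: W_lambda
    becomes a stabiliser, and minimality in a coset becomes monotonicity on the fibres. *)
Record coloring (d N : nat) := Coloring {
  col :> sint d -> sint N;
  col_mono : forall a b : sint d, (a <= b)%N -> (col a <= col b)%N;
  col_rev : forall a, col (rev_ord a) = rev_ord (col a) }.

(** No s_i is simple for the identity, so [bimin_ind] with [idcol] on one side is a one-sided
    induction. *)
Definition idcol d : coloring d d :=
  @Coloring d d id (fun a b ab => ab) (fun a => erefl).

Section Coloring.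
Variable d : nat.
Implicit Types (i : 'I_d) (a b : sint d) (u w x y g : sperm d).

Definition pres N (f : coloring d N) w := [forall a, f (w a) == f a].

Lemma presP N (f : coloring d N) w : reflect (preserves f w) (pres f w).
Proof. by apply: (iffP forallP) => wf a; apply/eqP. Qed.

Definition inc N (f : coloring d N) w :=
  [forall i : 'I_d, simple f i ==> (w (lo i) < w (hi i))%N].

Lemma incP N (f : coloring d N) w : reflect (increasing f w) (inc f w).
Proof.
apply: (iffP forallP) => [wi|wi i].
  by apply: increasing_ofP => [||i /(implyP (wi i))//]; [exact: col_mono|exact: col_rev].
by apply/implyP => /eqP fi; apply: wi; rewrite ?lt_lo_hi.
Qed.

Lemma incV_asc N (f : coloring d N) w :
  inc f (w^-1)%g = [forall i : 'I_d, simple f i ==> asc i w].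
Proof. by []. Qed.

(** Induction on the length: as long as w has a simple descent on the left or on the right, strip
    it. *)
Lemma bimin_ind N N' (f : coloring d N) (f' : coloring d N') (P : sperm d -> Prop) :
  (forall x, inc f (x^-1)%g -> inc f' x -> P x) ->
  (forall i w, simple f i -> asc i w -> P w -> P (sgen i * w)%g) ->
  (forall i w, simple f' i -> asc i (w^-1)%g -> P w -> P (w * sgen i)%g) ->
  forall w, P w.
Proof.
move=> P0 Pl Pr w; have [k] := ubnP (len w); elim: k w => // k IHk w /ltnSE wk.
have [wl|] := boolP (inc f (w^-1)%g); last first.
  rewrite incV_asc negb_forall => /existsP[i]; rewrite negb_imply => /andP[fi wi].
  rewrite -(sgenKl i w); apply: Pl => //; first by rewrite asc_sgen.
  by apply: IHk; move: wk; rewrite (len_desc wi).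
have [wr|] := boolP (inc f' w); first exact: P0.
rewrite -{1}(invgK w) incV_asc negb_forall => /existsP[i].
rewrite negb_imply => /andP[fi wi].
rewrite -[w]mulg1 -(sgen_sq i) mulgA; apply: Pr => //.
  by rewrite invMg sgenV asc_sgen.
by apply: IHk; move: wk; rewrite -(lenV w) (len_desc wi) -lenV invMg invgK sgenV.
Qed.

Lemma lmin_ind N (f : coloring d N) (P : sperm d -> Prop) :
  (forall x, inc f (x^-1)%g -> P x) ->
  (forall i w, simple f i -> asc i w -> P w -> P (sgen i * w)%g) ->
  forall w, P w.
Proof.
move=> P0 Pl; apply: (@bimin_ind _ _ f (idcol d)) => // [x /P0//|i w /eqP /= lh].
by have := lt_lo_hi i; rewrite lh ltnn.
Qed.

Lemma rmin_ind N (f : coloring d N) (P : sperm d -> Prop) :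
  (forall x, inc f x -> P x) ->
  (forall i w, simple f i -> asc i (w^-1)%g -> P w -> P (w * sgen i)%g) ->
  forall w, P w.
Proof.
move=> P0 Pr; apply: (@bimin_ind _ _ (idcol d) f) => // [x _ /P0//|i w /eqP /= lh].
by have := lt_lo_hi i; rewrite lh ltnn.
Qed.

Lemma pres_sgen N (f : coloring d N) i : simple f i -> pres f (sgen i).
Proof. by move=> fi; apply/presP/preserves_sgen => //; exact: col_rev. Qed.

Lemma pres1 N (f : coloring d N) : pres f 1%g.
Proof. exact/presP/preserves1. Qed.

Lemma presV N (f : coloring d N) w : pres f (w^-1)%g = pres f w.
Proof.
apply/presP/presP => [/preservesV|/preservesV//]; by rewrite invgK.
Qed.

Lemma presMl N (f : coloring d N) u w : pres f u -> pres f (u * w)%g = pres f w.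
Proof.
move=> /presP uf; apply/presP/presP => [uwf|]; last exact: preservesM.
by rewrite -(mulKg u w); apply: preservesM => //; apply: preservesV.
Qed.

Lemma presMr N (f : coloring d N) u w : pres f w -> pres f (u * w)%g = pres f u.
Proof. by move=> wf; rewrite -presV invMg presMl ?presV. Qed.

Lemma len_presl N (f : coloring d N) u x : pres f u -> inc f (x^-1)%g ->
  len (u * x)%g = (len u + len x)%N.
Proof.
move=> /presP uf /incP xf; apply: (@len_preserves d N f) => //.
  exact: col_mono.
exact: col_rev.
Qed.

Lemma len_presr N (f : coloring d N) u x : pres f u -> inc f x ->
  len (x * u)%g = (len x + len u)%N.
Proof.
move=> uf xf; rewrite -lenV invMg (@len_presl N f) ?presV ?invgK //.
by rewrite !lenV addnC.
Qed.

Lemma pres_inc1 N (f : coloring d N) w : pres f w -> inc f w -> w = 1%g.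
Proof.
by move=> /presP wf /incP wi; apply: (@incr_preserves1 d N f) => //; exact: col_mono.
Qed.

Lemma len0 w : len w = 0%N -> w = 1%g.
Proof.
elim/sperm_ind: w => // i u iu _; by rewrite len_asc.
Qed.

(** Lengths add in u x = y and in u^-1 y = x, so [len u] counts twice and is 0. *)
Lemma lmin_eq N (f : coloring d N) u x y : pres f u ->
  inc f (x^-1)%g -> inc f (y^-1)%g -> (u * x)%g = y -> u = 1%g.
Proof.
move=> uf xf yf uxy; have := len_presl uf xf; have : x = (u^-1 * y)%g by rewrite -uxy mulKg.
move=> xE; have := len_presl (etrans (presV f u) uf) yf; rewrite -xE uxy lenV => e1 e2.
by apply: len0; lia.
Qed.

Lemma len_leqM u w : (len (u * w)%g <= len u + len w)%N.
Proof.
elim/sperm_ind: u => [|i u iu IHu]; first by rewrite mul1g leq_addl.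
rewrite -mulgA len_asc //; have [/len_asc->|/len_desc uw] := boolP (asc i (u * w)%g).
  by rewrite addSn ltnS.
by rewrite addSn ltnW // ltnS (leq_trans _ IHu) // [leqRHS]uw.
Qed.

End Coloring.

(** * Eigenvectors in coordinates *)

Section Eigen.
Variables (d N : nat) (par : pred (sint N)).
Variables (H : algType laurent) (T : sperm d -> H).
Hypothesis HT : is_hecke T.
Implicit Types (i : 'I_d) (u w x y g : sperm d) (c e : {ffun sperm d -> laurent}).
Implicit Types (f : coloring d N) (z h : H).
Notation elt := (elt T).
Notation coefs := (coefs HT).

Definition sign_at f i : laurent := chi (par (f (lo i))).

(** By [leigenP] this is T_s z = (q [sign_at f i]) z, for all s = s_i in W_f, read on the
    coefficients of z. *)
Definition leigen f c := forall i w, simple f i -> asc i w ->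
  c (sgen i * w)%g = sign_at f i * c w.

Definition reigen f c := forall i w, simple f i -> asc i (w^-1)%g ->
  c (w * sgen i)%g = sign_at f i * c w.

Lemma leigen_elt f c : leigen f c ->
  forall i, simple f i -> T (sgen i) * elt c = (q * sign_at f i) *: elt c.
Proof. by move=> ce i fi; apply/(leigenP HT) => w; apply: ce. Qed.

Lemma reigen_elt f c : reigen f c ->
  forall i, simple f i -> elt c * T (sgen i) = (q * sign_at f i) *: elt c.
Proof. by move=> ce i fi; apply/(reigenP HT) => w; apply: ce. Qed.

Lemma leigen_mulr f c h : leigen f c -> leigen f (coefs (elt c * h)).
Proof.
move=> /leigen_elt ce i w fi; move: w; apply/(leigenP HT).
by rewrite coefsK mulrA ce // scalerAl.
Qed.

Lemma reigen_mull f c h : reigen f c -> reigen f (coefs (h * elt c)).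
Proof.
move=> /reigen_elt ce i w fi; move: w; apply/(reigenP HT).
by rewrite coefsK -mulrA ce // scalerAr.
Qed.

Lemma leigen_eq f c c' : leigen f c -> leigen f c' ->
  (forall x, inc f (x^-1)%g -> c x = c' x) -> c = c'.
Proof.
move=> ce ce' cc; apply/ffunP; apply: (lmin_ind cc) => i w fi iw cw.
by rewrite ce // ce' // cw.
Qed.

Lemma reigen_eq f c c' : reigen f c -> reigen f c' ->
  (forall x, inc f x -> c x = c' x) -> c = c'.
Proof.
move=> ce ce' cc; apply/ffunP; apply: (rmin_ind cc) => i w fi iw cw.
by rewrite ce // ce' // cw.
Qed.

Lemma bieigen_eq f f' c c' : leigen f c -> leigen f c' -> reigen f' c -> reigen f' c' ->
  (forall x, inc f (x^-1)%g -> inc f' x -> c x = c' x) -> c = c'.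
Proof.
move=> cl cl' cr cr' cc; apply/ffunP; apply: (bimin_ind cc) => i w fi iw cw.
  by rewrite cl // cl' // cw.
by rewrite cr // cr' // cw.
Qed.

(* Both sides are left eigenvectors with the same coefficients at the minimal  *)
(* elements of the cosets W_f x.                                               *)
Lemma leigen_factor f e c : leigen f e -> (forall u, ~~ pres f u -> e u = 0) ->
  e 1%g = 1 -> leigen f c ->
  elt c = elt e * \sum_(x | inc f (x^-1)%g) c x *: T x.
Proof.
move=> el e0 e1 cl; apply: (coefsP (HT := HT)) => w; move: w; apply/ffunP.
rewrite eltK; apply: (leigen_eq (f := f)) => // [|y yf]; first exact: leigen_mulr.
rewrite /elt mulr_sumr coefs_sum (bigD1 y) //= mulr_suml coefs_sum (bigD1 1%g) //=.
rewrite -scalerAl coefsZ e1 mul1r -scalerAr coefsZ (T1 HT) mul1r coefsT eqxx mulr1.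
rewrite -[LHS]addr0 -[LHS]addr0; congr (_ + _ + _); apply/esym;
  [apply: big1 => u u1|apply: big1 => x /andP[xf xy]]; last first.
  rewrite mulr_suml coefs_sum big1 // => u _; rewrite -scalerAl coefsZ -scalerAr coefsZ.
  have [uf|/e0->] := boolP (pres f u); last by rewrite mul0r.
  rewrite (TM HT) ?(len_presl uf) // coefsT; case: eqP => [uxy|_]; last by rewrite !mulr0.
  have u1 : u = 1%g by exact: (lmin_eq uf xf yf (esym uxy)).
  by rewrite uxy u1 mul1g eqxx in xy.
rewrite -scalerAl coefsZ -scalerAr coefsZ.
have [uf|/e0->] := boolP (pres f u); last by rewrite mul0r.
rewrite (TM HT) ?(len_presl uf) // coefsT; case: eqP => [uxy|_]; last by rewrite !mulr0.
by have u1' : u = 1%g; [exact: (lmin_eq uf yf yf (esym uxy))|rewrite u1' eqxx in u1].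
Qed.

Lemma reigen_factor f e c : reigen f e -> (forall u, ~~ pres f u -> e u = 0) ->
  e 1%g = 1 -> reigen f c ->
  elt c = (\sum_(x | inc f x) c x *: T x) * elt e.
Proof.
move=> er e0 e1 cr; apply: (coefsP (HT := HT)) => w; move: w; apply/ffunP.
rewrite eltK; apply: (reigen_eq (f := f)) => // [|y yf]; first exact: reigen_mull.
have key u x : pres f u -> inc f x -> (x * u)%g = y -> u = 1%g.
  move=> uf xf xuy; apply/eqP; rewrite -invg_eq1; apply/eqP.
  apply: (@lmin_eq _ _ f _ (x^-1)%g (y^-1)%g); rewrite ?presV ?invgK //.
  by rewrite -xuy invMg.
rewrite /elt mulr_suml coefs_sum (bigD1 y) //= mulr_sumr coefs_sum (bigD1 1%g) //=.
rewrite -scalerAl coefsZ -scalerAr coefsZ e1 mul1r (T1 HT) mulr1 coefsT eqxx mulr1.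
rewrite -[LHS]addr0 -[LHS]addr0; congr (_ + _ + _); apply/esym;
  [apply: big1 => u u1|apply: big1 => x /andP[xf xy]]; last first.
  rewrite mulr_sumr coefs_sum big1 // => u _; rewrite -scalerAl coefsZ -scalerAr coefsZ.
  have [uf|/e0->] := boolP (pres f u); last by rewrite mul0r mulr0.
  rewrite (TM HT) ?(len_presr uf) // coefsT; case: eqP => [uxy|_]; last by rewrite !mulr0.
  have u1 : u = 1%g by exact: (key _ _ uf xf (esym uxy)).
  by rewrite uxy u1 mulg1 eqxx in xy.
rewrite -scalerAl coefsZ -scalerAr coefsZ.
have [uf|/e0->] := boolP (pres f u); last by rewrite mul0r mulr0.
rewrite (TM HT) ?(len_presr uf) // coefsT; case: eqP => [uxy|_]; last by rewrite !mulr0.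
by have u1' : u = 1%g; [exact: (key _ _ uf yf (esym uxy))|rewrite u1' eqxx in u1].
Qed.

(** The generators of x are applied one at a time. The length hypothesis makes every step an ascent,
    where [Tl_coefs] has a single term. *)
Lemma coefs_Tmul x y z : len (x^-1 * y)%g = (len x + len y)%N ->
  coefs (T x * z) y = q ^+ len x * coefs z (x^-1 * y)%g.
Proof.
elim/sperm_ind: x y => [|i u iu IHu] y; first by rewrite (T1 HT) mul1r len1 mul1r invg1 mul1g.
rewrite invMg sgenV -mulgA len_asc // => lenE.
(* If i were a descent of y, [len (sgen i * y)] would be too small for the triangle inequality. *)
have := len_leqM (u^-1)%g (sgen i * y)%g; rewrite lenE lenV => le.
have iy : asc i y by apply: contraTT le => /len_desc->; rewrite -ltnNge; lia.
rewrite -(Tl_asc HT) // -mulrA -[X in _ * X](coefsK HT) (Tl_coefs HT) iy IHu.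
  by rewrite exprS mulrA.
by rewrite lenE len_asc // addnS.
Qed.

End Eigen.

(** * Even and odd parts of a parabolic subgroup *)

Section ParityParts.
Variables (d N : nat) (f : coloring d N) (par : pred (sint N)).
Hypothesis par_rev : forall k, par (rev_ord k) = par k.
Implicit Types (i : 'I_d) (a b : sint d) (u w x y g : sperm d).

Lemma sub_gen (gT : finGroupType) (A : {set gT}) (P : pred gT) :
  P 1%g -> (forall x y : gT, P x -> P y -> P (x * y)%g) -> {subset A <= P} ->
  {subset <<A>>%g <= P}.
Proof.
move=> P1 PM AP x; have gP : group_set [set y | P y].
  apply/group_setP; split=> [|y z]; first by rewrite inE.
  by rewrite !inE; apply: PM.
have /fintype.subsetP/(_ x) : <<A>>%g \subset Group gP.
  by rewrite gen_subG; apply/fintype.subsetP => y /AP; rewrite inE.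
by move=> sub /sub; rewrite inE.
Qed.

Lemma pres_ind (P : sperm d -> Prop) : P 1%g ->
  (forall i u, simple f i -> pres f u -> asc i u -> P u -> P (sgen i * u)%g) ->
  forall u, pres f u -> P u.
Proof.
move=> P1 PS u /presP uf.
apply: (preserves_ind (@col_mono _ _ f) (@col_rev _ _ f) P1 _ uf) => i x fi xf.
by apply: PS => //; apply/presP.
Qed.

Lemma pres_gen : [set w | pres f w] = <<[set sgen i | i : 'I_d & simple f i]>>%g.
Proof.
apply/setP => w; rewrite inE; apply/idP/idP; last first.
  move: w; apply: (@sub_gen _ _ (pres f)) => [|x y xf yf|_ /imsetP[i + ->]].
  - exact: pres1.
  - by rewrite presMl.
  - by rewrite inE => /pres_sgen.
elim/pres_ind => [|i u fi uf iu IHu]; first exact: group1.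
by rewrite groupM // mem_gen // imset_f // inE.
Qed.

(** For the colouring of lambda these are W_{lambda^(0)} and W_{lambda^(1)}, see [Wpar0_pres] and
    [Wpar1_pres]. *)
Definition presp (o : bool) w :=
  pres f w && [forall a, (par (f a) != o) ==> (w a == a)].

Lemma prespP o w :
  reflect (preserves f w /\ forall a, par (f a) != o -> w a = a) (presp o w).
Proof.
apply: (iffP andP) => -[/presP wf wo]; split=> //.
  by move=> a ao; apply/eqP; move/forallP/(_ a)/implyP: wo; apply.
by apply/forallP => a; apply/implyP => ao; apply/eqP/wo.
Qed.

Lemma sgen_moves i a : sgen i a != a ->
  a \in [:: lo i; hi i; rev_ord (lo i); rev_ord (hi i)].
Proof.
apply: contraR => na; apply/eqP/sint_eq; move: na; rewrite sgenE !inE.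
rewrite -!(inj_eq val_inj) /= !subSS val_lo val_hi.
have := ltn_ord i; have := ltn_ord a; case: (i =P 0%N :> nat) => i0;
repeat case: eqP => ?; lia.
Qed.

Lemma presp_sgen i : simple f i -> presp (par (f (lo i))) (sgen i).
Proof.
move=> fi; apply/prespP; split; first exact/presP/pres_sgen.
move=> a; apply: contraNeq => /sgen_moves; rewrite !inE => /or4P[]/eqP->;
by rewrite ?col_rev ?par_rev -?(eqP fi).
Qed.

Lemma presp1 o : presp o 1%g.
Proof. by apply/prespP; split=> [|a _]; [exact: preserves1|rewrite sperm1]. Qed.

Lemma prespM o x y : presp o x -> presp o y -> presp o (x * y)%g.
Proof.
move=> /prespP[xf xo] /prespP[yf yo]; apply/prespP; split=> [|a ao].
  exact: preservesM.
by rewrite spermM yo // xo.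
Qed.

Lemma prespV o x : presp o x -> presp o (x^-1)%g.
Proof.
move=> /prespP[xf xo]; apply/prespP; split=> [|a ao]; first exact: preservesV.
by rewrite -{1}[a]xo // spermK.
Qed.

Lemma presp_gen o : [set w | presp o w] =
  <<[set sgen i | i : 'I_d & simple f i && (par (f (lo i)) == o)]>>%g.
Proof.
apply/setP => w; rewrite inE; apply/idP/idP; last first.
  move: w; apply: (@sub_gen _ _ (presp o)) => [|x y|_ /imsetP[i + ->]].
  - exact: presp1.
  - exact: prespM.
  - by rewrite inE => /andP[fi /eqP <-]; apply: presp_sgen.
move=> wo; have /andP[wf _] := wo; move: wo; elim/pres_ind: w / wf => [|i u fi uf iu IHu suo].
  by rewrite group1.
(* s_i u has a descent at i, which is impossible for an element fixing both [lo i] and [hi i]. *)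
have io : par (f (lo i)) = o.
  apply/eqP; have /prespV/prespP[_ so] := suo.
  have : ~~ asc i (sgen i * u)%g by rewrite asc_sgen negbK.
  by apply: contraR => io; rewrite /asc !so ?lt_lo_hi // -(eqP fi).
apply: groupM; first by rewrite mem_gen // imset_f // inE fi io eqxx.
by apply: IHu; rewrite -(sgenKl i u) prespM // -io presp_sgen.
Qed.

Definition oddp_fun w a := if par (f a) then w a else a.

(** The guard makes the map injective for every w, so that [oddp] is total; off the stabiliser it is
    the identity. *)
Lemma oddp_inj w : injective (fun a => if pres f w then oddp_fun w a else a).
Proof.
case: presP => // wf a b; rewrite /oddp_fun;
  case: (boolP (par (f a))) => pa; case: (boolP (par (f b))) => pb //.
- exact: sperm_inj.
- by move=> ab; move: pb; rewrite -ab wf pa.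
- by move=> ab; move: pa; rewrite ab wf pb.
Qed.

Fact oddp_subproof w : [forall a, perm (@oddp_inj w) (rev_ord a) == rev_ord (perm (@oddp_inj w) a)].
Proof.
apply/forallP => a; rewrite !permE; case: pres => //.
by rewrite /oddp_fun col_rev par_rev; case: ifP; rewrite ?spermN.
Qed.

Definition oddp w : sperm d := SPerm (oddp_subproof w).

Lemma oddpE w a : pres f w -> oddp w a = if par (f a) then w a else a.
Proof. by move=> wf; rewrite [LHS]permE wf. Qed.

Lemma presp_oddp w : pres f w -> presp true (oddp w).
Proof.
move=> wf; apply/prespP; split=> a; rewrite oddpE //.
  by case: ifP => // _; apply/presP.
by rewrite eqb_id => /negPf->.
Qed.

Lemma presp_evenp w : pres f w -> presp false (w * (oddp w)^-1)%g.
Proof.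
move=> wf; have /prespV := presp_oddp wf => ov; have /andP[ovf _] := ov.
apply/prespP; split; first by apply/presP; rewrite presMl.
move=> a; rewrite eqbF_neg negbK => pa; rewrite spermM.
rewrite -[RHS](spermKV (oddp w)) oddpE //.
by have /presP-> := ovf; rewrite pa.
Qed.

Lemma presp_trivI : [set w | presp false w] :&: [set w | presp true w] = [set 1%g].
Proof.
apply/setP => w; rewrite !inE; apply/andP/eqP => [[/prespP[_ w0] /prespP[_ w1]]|->].
  apply: spermP => a; rewrite sperm1.
  by case: (boolP (par (f a))) => pa; [apply: w0|apply: w1]; rewrite ?pa // (negPf pa).
by rewrite !presp1.
Qed.

(** The coefficients of [xy]_lambda, see [xyE]. *)
Definition eps : {ffun sperm d -> laurent} :=
  [ffun w => if pres f w then (- q) ^- len (oddp w) else 0].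

Lemma chi_oddE k : (- q) ^- k.+1 = - q^-1 * (- q) ^- k.
Proof. by rewrite exprS invrM ?unitrX ?unitrN ?q_unit // invrN mulrC. Qed.

Lemma leigen_eps : leigen par f eps.
Proof.
move=> i w fi iw; rewrite !ffunE presMl ?pres_sgen //.
case: (boolP (pres f w)) => wf; last by rewrite mulr0.
have swf : pres f (sgen i * w)%g by rewrite presMl // pres_sgen.
have osw a : par (f a) -> oddp (sgen i * w)%g a = sgen i (oddp w a).
  by move=> pa; rewrite !oddpE // pa spermM.
rewrite /sign_at /chi; case: (boolP (par (f (lo i)))) => pi.
  have -> : oddp (sgen i * w)%g = (sgen i * oddp w)%g.
    apply: spermP => a; rewrite spermM; have [/osw//|pa] := boolP (par (f a)).
    rewrite !oddpE // (negPf pa); have /prespP[_ ->//] := presp_sgen fi.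
    by rewrite pi; case: (par _) pa.
  rewrite len_asc ?chi_oddE // /asc.
  have vE a : par (f a) -> ((oddp w)^-1)%g a = (w^-1)%g a.
    move=> pa; apply: (@sperm_inj d (oddp w)); rewrite spermKV oddpE //.
    have /presP-> : pres f (w^-1)%g by rewrite presV.
    by rewrite pa spermKV.
  by rewrite !vE // -(eqP fi).
suff -> : oddp (sgen i * w)%g = oddp w by rewrite mul1r.
apply: spermP => a; rewrite !oddpE //; case: ifP => // pa; rewrite spermM.
have /prespP[_ ->//] := presp_sgen fi; have /presP-> := wf.
by rewrite pa (negPf pi).
Qed.

Lemma oddpV w : pres f w -> oddp (w^-1)%g = ((oddp w)^-1)%g.
Proof.
move=> wf; apply: spermP => a; apply: (@sperm_inj d (oddp w)); rewrite spermKV.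
have vf : pres f (w^-1)%g by rewrite presV.
rewrite !oddpE //; case: (boolP (par (f a))) => pa; last by rewrite (negPf pa).
by have /presP-> := vf; rewrite pa spermKV.
Qed.

Lemma epsV w : eps (w^-1)%g = eps w.
Proof. by rewrite !ffunE presV; case: (boolP (pres f w)) => // wf; rewrite oddpV // lenV. Qed.

Lemma reigen_eps : reigen par f eps.
Proof.
move=> i w fi iw; rewrite -epsV invMg sgenV leigen_eps //.
by rewrite epsV.
Qed.

Lemma eps1 : eps 1%g = 1.
Proof.
rewrite ffunE pres1; have -> : oddp 1%g = 1%g; last by rewrite len1 expr0 invr1.
by apply: spermP => a; rewrite oddpE ?pres1 // !sperm1; case: ifP.
Qed.

Lemma eps_out u : ~~ pres f u -> eps u = 0.
Proof. by move=> /negPf uf; rewrite ffunE uf. Qed.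

Lemma leigen_pres c u g : leigen par f c -> pres f u -> inc f (g^-1)%g ->
  c (u * g)%g = eps u * c g.
Proof.
move=> cl uf gf; elim/pres_ind: u / uf.
  by rewrite mul1g eps1 mul1r.
move=> i u fi uf iu IHu; rewrite -mulgA cl ?IHu //; last first.
  rewrite /asc invMg !spermM; have /incP := gf; apply=> //.
  by rewrite !(preservesV (presP _ _ uf)); apply/eqP.
by rewrite leigen_eps // mulrA.
Qed.

Lemma reigen_pres c u g : reigen par f c -> pres f u -> inc f g ->
  c (g * u)%g = eps u * c g.
Proof.
move=> cr; rewrite -presV => uf gf; rewrite -[u]invgK.
elim/pres_ind: (u^-1)%g / uf.
  by rewrite invg1 mulg1 eps1 mul1r.
move=> i {}u fi uf iu IHu; rewrite invMg sgenV mulgA cr ?IHu //; last first.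
  rewrite /asc !invMg !invgK !spermM; have /incP := gf; apply=> //.
  by rewrite !(preservesV (presP _ _ uf)); apply/eqP.
by rewrite reigen_eps ?invgK // mulrA.
Qed.

End ParityParts.

Arguments col : simpl never.

(** * The colouring attached to a composition *)

Section Colour.
Variables d m n : nat.
Implicit Types (lam : wcomp d m n) (i : 'I_d) (a x y : sint d) (k l : sint (m + n)).

Lemma wsum_mono lam (j k : nat) : (j <= k)%N -> (wsum lam j <= wsum lam k)%N.
Proof.
move=> jk; rewrite /wsum big_mkcond [leqRHS]big_mkcond; apply: leq_sum => l _.
by case: ifP => // /leq_trans/(_ jk)->.
Qed.

Lemma wsum_max lam (k : nat) : (m + n <= k)%N -> wsum lam k = d.
Proof.
move=> k_big; rewrite -[RHS](eqP (valP lam)) /wsum; apply: eq_bigl => j.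
by rewrite (leq_trans _ k_big) // -ltnS.
Qed.

Lemma wsum_le lam (k : nat) : (wsum lam k <= d)%N.
Proof.
rewrite -[leqRHS](@wsum_max lam (maxn k (m + n))) ?leq_maxr //.
by rewrite wsum_mono ?leq_maxl.
Qed.

(* The largest element of the block R_k, also for negative k. *)
Definition block_top lam (k : int) : int :=
  match k with Posz j => Posz (wsum lam j) | Negz j => Negz (wsum lam j) end.

Lemma block_top_mono lam (j k : int) : j <= k -> block_top lam j <= block_top lam k.
Proof.
case: j => j; case: k => k //= jk; rewrite ?lez_nat; last 1 first.
- have kj : (k <= j)%N by lia.
  by have := wsum_mono lam kj; lia.
by apply: wsum_mono; lia.
Qed.

Lemma sval_intP N (a : sint N) : - N%:Z <= sval_int a <= N%:Z.
Proof. by rewrite /sval_int; have := ltn_ord a; lia. Qed.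

Lemma sval_int_inj N : injective (@sval_int N).
Proof. by move=> a b; rewrite /sval_int => ab; apply: sint_eq; lia. Qed.

Lemma sval_le N (a b : sint N) : (sval_int a <= sval_int b) = (a <= b)%N.
Proof. by rewrite /sval_int lerD2r lez_nat. Qed.

(** The three cases of [block] become one half-open interval between consecutive values of
    [block_top]. *)
Lemma in_block lam k x : (x \in block lam k) =
  (block_top lam (sval_int k - 1) < sval_int x <= block_top lam (sval_int k)).
Proof.
rewrite /block; case: (sval_int k) => [[|j]|j] /=.
- by rewrite inE subn0; lia.
- by rewrite !inE /= subn1.
rewrite addn0; apply/imsetP/idP => [[y + ->]|xk].
  by rewrite inE sval_intN /=; lia.
exists (rev_ord x); rewrite ?rev_ordK // inE sval_intN /=.
by lia.
Qed.

Lemma block_top_opp lam (k : int) : block_top lam (- k - 1) = - block_top lam k - 1.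
Proof.
case: k => j; first by rewrite (_ : - Posz j - 1 = Negz j) /=; lia.
by rewrite (_ : - Negz j - 1 = Posz j) /=; lia.
Qed.

Lemma in_block_rev lam k x : (rev_ord x \in block lam (rev_ord k)) = (x \in block lam k).
Proof.
rewrite !in_block !sval_intN block_top_opp.
have -> : - (sval_int k) = - (sval_int k - 1) - 1 by lia.
by rewrite block_top_opp; lia.
Qed.

Lemma block_exists lam x : exists k, x \in block lam k.
Proof.
have pos y : 0 <= sval_int y -> exists k, y \in block lam k.
  move=> y0; pose P j := (`|sval_int y| <= wsum lam j)%N.
  have exP : exists j, P j.
    by exists (m + n)%N; rewrite /P wsum_max //; have := sval_intP y; lia.
  case: (ex_minnP exP) => j; rewrite /P => yj jmin.
  have jmn : (j <= m + n)%N.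
    by apply: jmin; rewrite wsum_max //; have := sval_intP y; lia.
  exists (sint_nat (m + n) j); rewrite in_block sval_int_nat //.
  apply/andP; split; last by rewrite /=; lia.
  case: j jmin {yj jmn} => [|j] jmin /=; first by lia.
  rewrite subn1 /= ltNge; apply/negP => yj.
  have /jmin : (`|sval_int y| <= wsum lam j)%N by lia.
  by rewrite ltnn.
case: (lerP 0 (sval_int x)) => [/pos//|x0].
have [|k xk] := pos (rev_ord x); first by rewrite sval_intN; lia.
by exists (rev_ord k); rewrite -[x]rev_ordK in_block_rev.
Qed.

Definition colour_fun lam x : sint (m + n) :=
  xchoose (block_exists lam x).

Lemma in_block_colour lam x : x \in block lam (colour_fun lam x).
Proof. exact: (xchooseP (block_exists lam x)). Qed.

(** The colour and [block_top] are adjoint; uniqueness of the colour and its monotonicity both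
    follow. *)
Lemma colour_fun_le lam x (k : int) :
  (sval_int (colour_fun lam x) <= k) = (sval_int x <= block_top lam k).
Proof.
have := in_block_colour lam x; rewrite in_block => /andP[lt le].
apply/idP/idP => [ck|]; first by rewrite (le_trans le) ?block_top_mono.
apply: contraTT; rewrite -!ltNge => ck; apply: le_lt_trans lt.
by apply: block_top_mono; lia.
Qed.

Lemma block_colour lam x k : (x \in block lam k) = (colour_fun lam x == k).
Proof.
apply/idP/eqP => [|<-]; last exact: in_block_colour.
rewrite in_block -colour_fun_le ltNge -colour_fun_le => /andP[lt le].
by apply: sval_int_inj; lia.
Qed.

Fact colour_mono lam x y :
  (x <= y)%N -> (colour_fun lam x <= colour_fun lam y)%N.
Proof.
rewrite -!sval_le => xy; rewrite colour_fun_le (le_trans xy) //.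
by rewrite -colour_fun_le.
Qed.

Fact colour_rev lam x : colour_fun lam (rev_ord x) = rev_ord (colour_fun lam x).
Proof.
by apply/eqP; rewrite -block_colour in_block_rev in_block_colour.
Qed.

Definition colour lam : coloring d (m + n) := Coloring (@colour_mono lam) (colour_rev lam).

Lemma block_col lam x k : (x \in block lam k) = (colour lam x == k).
Proof. exact: block_colour. Qed.

Lemma colour_le lam x (k : int) :
  (sval_int (colour lam x) <= k) = (sval_int x <= block_top lam k).
Proof. exact: colour_fun_le. Qed.

Lemma sval_lo i : sval_int (lo i) = i%:Z.
Proof. by rewrite sval_int_nat // ltnW. Qed.

Lemma sval_hi i : sval_int (hi i) = i.+1%:Z.
Proof. by rewrite sval_int_nat. Qed.

Lemma colour_ge0 lam x : 0 <= sval_int x -> 0 <= sval_int (colour lam x).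
Proof.
move=> x0; rewrite leNgt; apply/negP => c0; have := colour_le lam x (-1).
by rewrite /=; lia.
Qed.

Lemma simple_colour lam i :
  simple (colour lam) i = [forall j : 'I_(m + n), (i : nat) != wsum lam j].
Proof.
apply/eqP/forallP => [fi j|wi].
  apply/eqP => iw; have := colour_le lam (lo i) j; have := colour_le lam (hi i) j.
  by rewrite -fi => ->; rewrite sval_lo sval_hi /= iw; lia.
apply: sval_int_inj; apply/le_anti/andP; split.
  by rewrite sval_le col_mono // ltnW // lt_lo_hi.
have := colour_ge0 lam (_ : 0 <= sval_int (lo i)); rewrite sval_lo => /(_ isT).
have := colour_le lam (lo i) (sval_int (colour lam (lo i))); rewrite lexx => /esym.
have := sval_intP (colour lam (lo i)).
case: (sval_int (colour lam (lo i))) => // k kmn ik _.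
rewrite colour_le sval_hi /=; rewrite sval_lo /= in ik.
have [kN|kN] := ltnP k (m + n); last by rewrite wsum_max ?lez_nat.
by have := wi (Ordinal kN); rewrite /=; lia.
Qed.

Lemma parity_rev k : parity (rev_ord k) = parity k.
Proof. by rewrite /parity sval_intN abszN. Qed.

Lemma parity_lo lam i : parity (colour lam (lo i)) = (wsum lam m < i)%N.
Proof.
have := colour_ge0 lam (_ : 0 <= sval_int (lo i)); rewrite sval_lo => /(_ isT).
have := colour_le lam (lo i) m; rewrite sval_lo /= /parity.
by lia.
Qed.

Lemma Wpar_pres lam : Wpar lam = [set w | pres (colour lam) w].
Proof.
rewrite pres_gen /Wpar; congr <<_>>%g.
by apply/setP => w; apply/imsetP/imsetP => -[i]; rewrite inE => fi ->; exists i;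
  rewrite // inE ?simple_colour // -simple_colour.
Qed.

Lemma mem_Wpar lam w : (w \in Wpar lam) = pres (colour lam) w.
Proof. by rewrite Wpar_pres inE. Qed.

Lemma sgen_simple lam i : (sgen i \in Wpar lam) = simple (colour lam) i.
Proof.
rewrite mem_Wpar; apply/idP/idP => [/presP si|]; last exact: pres_sgen.
have /(asc_or_simple (@col_mono _ _ _) si)// : ~~ asc i (sgen i).
by rewrite -[sgen i]mulg1 asc_sgen negbK /asc invg1 !sperm1 lt_lo_hi.
Qed.

Lemma Wpar0_pres lam :
  Wpar0 lam = [set w | presp (colour lam) (@parity m n) false w].
Proof.
rewrite (presp_gen _ parity_rev) /Wpar0; congr <<_>>%g.
have E i : (sgen i \in Wpar lam) && (i < wsum lam m)%N =
    simple (colour lam) i && (parity (colour lam (lo i)) == false).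
  rewrite sgen_simple; case: (boolP (simple _ i)) => //= fi.
  (* Even parity gives only i <= [wsum lam m]. Equality would put [lo i] and [hi i] on different
     sides of the end of block m, so s_i would not be simple. *)
  rewrite eqbF_neg parity_lo -leqNgt [RHS]leq_eqVlt; case: eqP => //= iw.
  have := colour_le lam (lo i) m; have := colour_le lam (hi i) m.
  rewrite (eqP fi) => ->.
  by rewrite sval_lo sval_hi /= iw; lia.
by apply/setP => w; apply/imsetP/imsetP => -[i]; rewrite inE => fi ->; exists i;
  rewrite // inE ?E // -E.
Qed.

Lemma Wpar1_pres lam :
  Wpar1 lam = [set w | presp (colour lam) (@parity m n) true w].
Proof.
rewrite (presp_gen _ parity_rev) /Wpar1; congr <<_>>%g.
have E i : (sgen i \in Wpar lam) && (wsum lam m < i)%N =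
    simple (colour lam) i && (parity (colour lam (lo i)) == true).
  by rewrite sgen_simple eqb_id parity_lo.
by apply/setP => w; apply/imsetP/imsetP => -[i]; rewrite inE => fi ->; exists i;
  rewrite // inE ?E // -E.
Qed.

Definition oddw lam := oddp (colour lam) parity_rev.
Definition sgnw lam := eps (colour lam) parity_rev.

Lemma odd_partE lam w : w \in Wpar lam -> odd_part lam w = oddw lam w.
Proof.
rewrite mem_Wpar => wf; rewrite /odd_part -{1}(mulgKV (oddw lam w) w).
have tI : Wpar0 lam :&: Wpar1 lam = 1%g by rewrite Wpar0_pres Wpar1_pres presp_trivI.
have w0 : (w * (oddw lam w)^-1)%g \in Wpar0 lam.
  by rewrite Wpar0_pres inE presp_evenp.
have w1 : oddw lam w \in Wpar1 lam by rewrite Wpar1_pres inE presp_oddp.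
exact: (remgrMid tI w0 w1).
Qed.

Lemma xyE (H : algType laurent) (T : sperm d -> H) lam : xy T lam = elt T (sgnw lam).
Proof.
rewrite /xy /elt [RHS](bigID (mem (Wpar lam))) /= [X in _ = _ + X]big1 ?addr0.
  apply: eq_bigr => w wl; rewrite odd_partE // slenE ffunE -mem_Wpar wl.
  by [].
by move=> w; rewrite mem_Wpar => wf; rewrite /sgnw eps_out ?scale0r.
Qed.

End Colour.

(** * The standard basis *)

Section Zeta.
Variables d m n : nat.
Implicit Types (lam mu : wcomp d m n) (i : 'I_d) (a b r : sint d).
Implicit Types (u w x y g : sperm d) (k l : sint (m + n)) (A : 'M[int]_((m + n).*2.+1)).

Lemma kappa_rows lam x mu k l : kappa lam x mu k l =
  #|[set r | (colour lam r == k) && (colour mu ((x^-1)%g r) == l)]|%:Z.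
Proof.
rewrite mxE; congr (Posz _); apply: eq_card => r; rewrite !inE block_col; congr (_ && _).
apply/imsetP/idP => [[a + ->]|rl]; first by rewrite block_col spermK.
by exists ((x^-1)%g r); rewrite ?spermKV // block_col.
Qed.

Lemma kappa_tr lam x mu : kappa mu (x^-1)%g lam = (kappa lam x mu)^T.
Proof.
apply/matrixP => l k; rewrite [RHS]mxE !kappa_rows invgK; congr (Posz _).
rewrite -[LHS](card_imset _ (@sperm_inj d x)); apply: eq_card => r.
rewrite !inE; apply/imsetP/andP => [[a + ->]|[rk rl]].
  by rewrite !inE spermK => /andP[].
by exists ((x^-1)%g r); rewrite ?spermKV // inE spermKV rl.
Qed.

Lemma kappaE lam x mu k l : kappa lam x mu k l =
  #|[set a | (colour lam (x a) == k) && (colour mu a == l)]|%:Z.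
Proof.
rewrite -[kappa _ _ _]trmxK -kappa_tr [_^T _ _]mxE kappa_rows invgK; congr (Posz _).
by apply: eq_card => a; rewrite !inE andbC.
Qed.

Lemma kappa_presl lam u x mu : pres (colour lam) u ->
  kappa lam (u * x)%g mu = kappa lam x mu.
Proof.
move=> /presP uf; apply/matrixP => k l; rewrite !kappaE; congr (Posz _).
by apply: eq_card => a; rewrite !inE spermM uf.
Qed.

Lemma kappa_presr lam u x mu : pres (colour mu) u ->
  kappa lam (x * u)%g mu = kappa lam x mu.
Proof.
move=> uf; rewrite -[LHS]trmxK -kappa_tr invMg kappa_presl ?presV //.
by rewrite kappa_tr trmxK.
Qed.

(** The one condition of [Xi] that does not hold for every matrix [kappa lam x mu], see
    [kappa_Xi]. *)
Definition parity_bound A := forall k l, parity k != parity l -> A k l <= 1.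

Lemma parity_bound_tr A : parity_bound A -> parity_bound A^T.
Proof. by move=> Ab k l kl; rewrite mxE Ab // eq_sym. Qed.

Lemma kappa_ge2 lam x mu a b : a != b -> colour lam (x a) = colour lam (x b) ->
  colour mu a = colour mu b -> 1 < kappa lam x mu (colour lam (x a)) (colour mu a).
Proof.
move=> ab cl cm; rewrite kappaE ltz_nat.
rewrite (cardsD1 a) inE !eqxx (cardsD1 b) !inE eq_sym ab /=.
by rewrite cl cm !eqxx.
Qed.

Lemma parity_bound_eq lam x mu a b : parity_bound (kappa lam x mu) -> a != b ->
  colour lam (x a) = colour lam (x b) -> colour mu a = colour mu b ->
  parity (colour lam (x a)) = parity (colour mu a).
Proof.
move=> Ab ab cl cm.
have [//|/Ab] := eqVneq (parity (colour lam (x a))) (parity (colour mu a)).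
by rewrite leNgt (kappa_ge2 ab cl cm).
Qed.

(* As kappa lam x mu satisfies the parity bound, two points in the same row    *)
(* and the same column have the same row and column parity.  So the inversions *)
(* of x = u g w that count here are those of the odd parts of u and w, and     *)
(* oddinv is the sum of the lengths of these.                                  *)
Definition oddpair lam mu x : rel (sint d) := fun a b =>
  (colour lam (x a) == colour lam (x b)) && parity (colour lam (x a)) ||
  (colour mu a == colour mu b) && parity (colour mu a).

Definition oddinv lam mu x : nat := #|invset (oddpair lam mu x) x|./2.

Lemma oddinvV lam mu x : oddinv mu lam (x^-1)%g = oddinv lam mu x.
Proof.
rewrite /oddinv card_invsetV (@eq_invset _ _ (oddpair lam mu x)) // => a b _.
rewrite /oddpair !spermK orbC [colour mu b == _]eq_sym [colour lam (x b) == _]eq_sym.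
by congr (_ || _); case: eqP => // ->.
Qed.

(** The new inversions are one pair and its negative, each inside a row block. They count if this
    row is odd; if it is even, the parity bound forbids the two points to share an odd column. *)
Lemma oddinv_asc lam mu x i : parity_bound (kappa lam x mu) ->
  simple (colour lam) i -> asc i x ->
  oddinv lam mu (sgen i * x)%g = (parity (colour lam (lo i)) + oddinv lam mu x)%N.
Proof.
move=> Ab fi ix; have [iE dj] := invset_asc (oddpair lam mu x) ix.
rewrite /oddinv.
have -> : invset (oddpair lam mu (sgen i * x)%g) (sgen i * x)%g =
          invset (oddpair lam mu x) (sgen i * x)%g.
  apply: eq_invset => a b _; rewrite /oddpair !spermM.
  by have /presP si := pres_sgen fi; rewrite !si.
rewrite iE.
set al := (x^-1)%g (lo i); set be := (x^-1)%g (hi i).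
have xal : x al = lo i by rewrite spermKV.
have xbe : x be = hi i by rewrite spermKV.
have albe : al != be by rewrite neq_ltn; apply/orP; left.
have pab : oddpair lam mu x al be = parity (colour lam (lo i)).
  rewrite /oddpair xal xbe (eqP fi) eqxx /=; case: (boolP (parity _)) => //= pi.
  apply/negbTE/negP => /andP[/eqP cm]; apply/negP.
  have := parity_bound_eq Ab albe; rewrite xal xbe (eqP fi) => <- //.
have pba : oddpair lam mu x (rev_ord be) (rev_ord al) = parity (colour lam (lo i)).
  rewrite -pab /oddpair !spermN !col_rev !(inj_eq rev_ord_inj) !parity_rev.
  by rewrite [_ == colour mu al]eq_sym [_ == colour lam (x al)]eq_sym;
    congr (_ || _); case: eqP => // ->.
have -> : rootset i x :&: [set ab | oddpair lam mu x ab.1 ab.2] =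
    if parity (colour lam (lo i)) then rootset i x else finset.set0.
  apply/setP => c; rewrite inE [X in _ && X]inE -/al -/be.
  case: (boolP (c \in rootset i x)) => [|nc] /=; last first.
    by case: ifP => _; rewrite ?in_set0 ?(negPf nc).
  rewrite {1}/rootset inE !in_set1 => cE; have cr : c \in rootset i x by rewrite !inE.
  by case/orP: cE cr => /eqP-> /= cr; rewrite ?pab ?pba; case: ifP; rewrite ?cr ?inE.
case: (parity _) dj => dj; last by rewrite setU0 add0n.
by rewrite cardsU (disjoint_setI0 dj) cards0 subn0 card_rootset addn2.
Qed.

Definition zeta lam mu A : {ffun sperm d -> laurent} :=
  [ffun x => if kappa lam x mu == A then chi true ^+ oddinv lam mu x else 0].

Lemma zetaV lam mu A x : zeta mu lam A^T (x^-1)%g = zeta lam mu A x.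
Proof.
have kE : (kappa mu (x^-1)%g lam == A^T) = (kappa lam x mu == A).
  by rewrite kappa_tr; apply/eqP/eqP => [/trmx_inj|->].
by rewrite [LHS]ffunE [RHS]ffunE kE oddinvV.
Qed.

Lemma leigen_zeta lam mu A : parity_bound A ->
  leigen (@parity m n) (colour lam) (zeta lam mu A).
Proof.
move=> Ab i x fi ix; rewrite !ffunE kappa_presl ?pres_sgen //.
case: eqP => [xA|_]; last by rewrite mulr0.
rewrite oddinv_asc ?xA // /sign_at; case: parity; last by rewrite add0n mul1r.
by rewrite add1n exprS.
Qed.

Lemma reigen_zeta lam mu A : parity_bound A ->
  reigen (@parity m n) (colour mu) (zeta lam mu A).
Proof.
move=> Ab i x fi ix; have E := zetaV lam mu A.
have E1 := E (x * sgen i)%g; rewrite invMg sgenV in E1.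
apply: etrans (esym E1) (etrans (@leigen_zeta mu lam _ (parity_bound_tr Ab) i _ fi ix) _).
by congr (_ * _); apply: E.
Qed.

Lemma oddinv_min lam mu x :
  inc (colour lam) (x^-1)%g -> inc (colour mu) x -> oddinv lam mu x = 0%N.
Proof.
move=> /incP xl /incP xm; rewrite /oddinv (_ : invset _ _ = finset.set0) ?cards0 //.
apply/setP => -[a b]; rewrite !inE /=; apply/negP => /and4P[ab _ + xba].
rewrite /oddpair => /orP[]/andP[/eqP cE _].
  by have := xl _ _ xba (esym cE); rewrite !spermK ltnNge ltnW.
by have := xm _ _ ab cE; rewrite ltnNge ltnW.
Qed.

Lemma zeta_min lam mu A x : inc (colour lam) (x^-1)%g -> inc (colour mu) x ->
  zeta lam mu A x = (kappa lam x mu == A)%:R.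
Proof. by move=> xl xm; rewrite ffunE oddinv_min //; case: eqP. Qed.

Lemma card_rel_split (T : finType) M (P : pred T) (R : pred 'I_M) (F : T -> 'I_M) :
  #|[set r | P r && R (F r)]| = (\sum_(l | R l) #|[set r | P r && (F r == l)]|)%N.
Proof.
rewrite -sum1dep_card (partition_big F R) => [|r /andP[]//].
apply: eq_bigr => l Rl; rewrite -sum1dep_card; apply: eq_bigl => r.
by case: eqP => [->|]; rewrite ?Rl ?andbF // andbT.
Qed.

(** Along a row block the preimages under g increase, so their columns increase weakly. The row of
    the matrix says how often each column occurs, hence which column each point has, and x gives the
    same answer. *)
Lemma left_min_coset lam mu g x : inc (colour lam) (g^-1)%g ->
  inc (colour lam) (x^-1)%g -> kappa lam x mu = kappa lam g mu ->
  pres (colour mu) (g^-1 * x)%g.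
Proof.
have main g' x' : inc (colour lam) (g'^-1)%g -> inc (colour lam) (x'^-1)%g ->
    kappa lam x' mu = kappa lam g' mu ->
    forall r, (colour mu ((x'^-1)%g r) <= colour mu ((g'^-1)%g r))%N.
  move=> /incP gi /incP xi /matrixP kE r; rewrite leqNgt; apply/negP => lt.
  set j := colour mu ((g'^-1)%g r) in lt.
  (* If the column of r were later for x' than for g', then x' would have fewer points of this row
     in the columns up to j. *)
  pose S y := [set r' | (colour lam r' == colour lam r) && (colour mu ((y^-1)%g r') <= j)%N].
  have SE : #|S g'| = #|S x'|.
    pose P r' := colour lam r' == colour lam r; pose R (l : sint (m + n)) := (l <= j)%N.
    have SP y : #|S y| = _ := card_rel_split P R (fun r' => colour mu ((y^-1)%g r')).
    rewrite !SP; by apply: eq_bigr => l _; have := kE (colour lam r) l; rewrite !kappa_rows => -[].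
  have : S x' \proper S g'.
    apply/properP; split; last first.
      by exists r; rewrite !inE eqxx ?leqnn // -ltnNge.
    apply/fintype.subsetP => r'; rewrite !inE => /andP[cr xr']; rewrite cr /=.
    apply: col_mono; case: (ltngtP r' r) => [rr|rr|/sint_eq->//].
      by apply/ltnW/gi => //; apply/eqP.
    have := xi _ _ rr (esym (eqP cr)) => /ltnW/(col_mono (colour mu)).
    by move: xr' lt; rewrite /j; lia.
  by move/proper_card; rewrite SE ltnn.
move=> gi xi kE; apply/presP => a; rewrite spermM; apply: sint_eq.
apply/eqP; rewrite eqn_leq -{2 3}(spermK x a).
by rewrite main ?kE // main.
Qed.

Lemma bimin_unique lam mu g x :
  inc (colour lam) (g^-1)%g -> inc (colour mu) g ->
  inc (colour lam) (x^-1)%g -> inc (colour mu) x ->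
  kappa lam x mu = kappa lam g mu -> x = g.
Proof.
move=> gl gm xl xm /(left_min_coset gl xl) wf.
have : ((g^-1 * x)^-1)%g = 1%g.
  apply: (@lmin_eq _ _ (colour mu) _ (g^-1)%g (x^-1)%g); rewrite ?presV ?invgK //.
  by rewrite invMg invgK mulgK.
by move/eqP; rewrite invg_eq1 => /eqP /(canRL (mulKVg _)); rewrite mulg1.
Qed.

Lemma bimin_exists lam mu x : exists y,
  [/\ inc (colour lam) (y^-1)%g, inc (colour mu) y & kappa lam y mu = kappa lam x mu].
Proof.
elim/(bimin_ind (f := colour lam) (f' := colour mu)): x => [x xl xm|i x fi _|i x fi _].
- by exists x.
- by rewrite kappa_presl ?pres_sgen.
- by rewrite kappa_presr ?pres_sgen.
Qed.

Lemma bimin_len lam mu g x : inc (colour lam) (g^-1)%g -> inc (colour mu) g ->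
  kappa lam x mu = kappa lam g mu -> (len g <= len x)%N.
Proof.
move=> gl gm; elim/(bimin_ind (f := colour lam) (f' := colour mu)): x
  => [x xl xm|i x fi ix IHx|i x fi ix IHx].
- by move/bimin_unique=> ->.
- by rewrite kappa_presl ?pres_sgen // len_asc // => /IHx; apply: leqW.
- rewrite kappa_presr ?pres_sgen // -(lenV (x * _)%g) invMg sgenV len_asc // lenV.
  by move/IHx; apply: leqW.
Qed.

Lemma mem_Dmin lam mu g :
  (g \in Dmin lam mu) = inc (colour lam) (g^-1)%g && inc (colour mu) g.
Proof.
rewrite inE; apply/forallP/andP => [gmin|[gl gm] x]; last first.
  apply/implyP => xl; apply/forallP => y; apply/implyP => ym; rewrite !slenE.
  by apply: (bimin_len (lam := lam) (mu := mu)) => //; rewrite kappa_presr ?kappa_presl -?mem_Wpar.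
have {}gmin x y : pres (colour lam) x -> pres (colour mu) y -> (len g <= len (x * g * y)%g)%N.
  move=> xl ym; have /implyP := gmin x; rewrite mem_Wpar => /(_ xl)/forallP/(_ y)/implyP.
  by rewrite mem_Wpar !slenE; apply.
split.
  rewrite incV_asc; apply/forallP => i; apply/implyP => fi; apply/negPn/negP => /len_desc gi.
  by have := gmin _ _ (pres_sgen fi) (pres1 _); rewrite mulg1 [X in (X <= _)%N]gi ltnn.
rewrite -[g in inc _ g]invgK incV_asc; apply/forallP => i; apply/implyP => fi.
apply/negPn/negP => /len_desc gi.
have := gmin _ _ (pres1 _) (pres_sgen fi); rewrite mul1g -lenV [X in (X <= _)%N]gi.
by rewrite -[X in (_ < X)%N]lenV invMg sgenV ltnn.
Qed.

(** If z and its conjugate both move a point, then a and z a share a column, and their images under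
    g share a row. The parity bound makes these parities equal, whereas they are opposite here. *)
Lemma presp_conj1 lam mu g (o : bool) z : parity_bound (kappa lam g mu) ->
  presp (colour lam) (@parity m n) o (g * z * g^-1)%g ->
  presp (colour mu) (@parity m n) (~~ o) z -> z = 1%g.
Proof.
move=> Ab /prespP[uf uo] /prespP[zf zo]; apply: spermP => a; rewrite sperm1.
have uga : (g * z * g^-1)%g (g a) = g (z a) by rewrite !spermM spermK.
have [pa|/zo//] := eqVneq (parity (colour mu a)) (~~ o).
have [ga|/uo] := eqVneq (parity (colour lam (g a))) o; last first.
  by rewrite uga => /sperm_inj.
apply/eqP; apply: contraT => za.
have : parity (colour lam (g (z a))) = parity (colour mu (z a)).
  apply: (parity_bound_eq Ab za); last exact: zf.
  by rewrite -uga uf.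
by rewrite -uga uf zf ga pa; case: (o).
Qed.

Lemma mem_Dcirc lam mu g : g \in Dmin lam mu -> parity_bound (kappa lam g mu) ->
  g \in Dcirc lam mu.
Proof.
move=> gD Ab; rewrite inE gD /=; apply/andP; split; apply/eqP/setP => z;
  rewrite !inE; apply/andP/eqP => [[]|->]; rewrite ?group1 //.
  rewrite mem_conjg conjgE invgK mulgA Wpar1_pres Wpar0_pres !inE => zl zm.
  exact: (presp_conj1 Ab zl zm).
rewrite mem_conjg conjgE invgK mulgA Wpar1_pres Wpar0_pres !inE => zl zm.
exact: (presp_conj1 Ab zl zm).
Qed.

(** If g w has a simple left descent s_i, then v = g^-1 s_i g lies in W_delta and v w is shorter
    than w. Conversely, lengths add in (g x g^-1)(g w). *)
Lemma mem_Ddelta lam mu g w : inc (colour lam) (g^-1)%g -> inc (colour mu) g ->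
  (w \in Ddelta lam g mu) =
  pres (colour mu) w && inc (colour lam) ((g * w)^-1)%g.
Proof.
move=> gl gm; rewrite inE mem_Wpar; case: (boolP (pres _ w)) => //= wf.
apply/forallP/idP => [wmin|gwl x]; last first.
  apply/implyP; rewrite inE mem_conjg conjgE invgK mulgA !mem_Wpar => /andP[ul xm].
  rewrite !slenE -(leq_add2l (len g)) -!(len_presr _ gm) ?presMl //.
  have -> : (g * (x * w) = (g * x * g^-1) * (g * w))%g by rewrite !mulgA mulgKV.
  by rewrite (len_presl ul gwl) leq_addl.
rewrite incV_asc; apply/forallP => i; apply/implyP => fi; apply/negPn/negP => ni.
pose v := (g^-1 * sgen i * g)%g.
have gi : asc i g by move: gl; rewrite incV_asc => /forallP/(_ i)/implyP; apply.
(* i is an ascent of g and a descent of g w, and w preserves the colours of mu; so both preimages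
   have the same colour. *)
have cE : colour mu ((g^-1)%g (lo i)) = colour mu ((g^-1)%g (hi i)).
  apply: sint_eq; apply/eqP; rewrite eqn_leq col_mono ?(ltnW gi) //=.
  move: ni; rewrite /asc -leqNgt invMg !spermM => /(col_mono (colour mu)).
  by have /presP wV : pres (colour mu) (w^-1)%g; [rewrite presV|rewrite !wV].
have vm : pres (colour mu) v.
  apply/presP => a; rewrite !spermM.
  (* [preserves_sgen] asks only that the map be odd; the colouring moved by g need not be
     monotone. *)
  have := @preserves_sgen d (m + n) (fun r => colour mu ((g^-1)%g r)) _ i.
  move=> /(_ _ _ (g a)) /=; rewrite spermK; apply; last exact/eqP.
  by move=> r; rewrite spermN col_rev.
have /implyP := wmin v; rewrite inE mem_conjg conjgE invgK !mem_Wpar vm andbT.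
have -> : (g * (v * g^-1) = sgen i)%g by rewrite /v !mulgA mulgV mul1g mulgK.
rewrite pres_sgen // => /(_ isT); rewrite !slenE -(leq_add2l (len g)).
have l1 := len_presr wf gm.
have vwf : pres (colour mu) (v * w)%g by rewrite presMl.
have l2 := len_presr vwf gm.
have E : (g * (v * w) = sgen i * (g * w))%g by rewrite /v !mulgA mulgV mul1g.
by rewrite -l1 -l2 E (len_desc ni) ltnn.
Qed.

Lemma zeta_factorl (H : algType laurent) (T : sperm d -> H) (HT : is_hecke T) lam mu A :
  parity_bound A -> elt T (zeta lam mu A) =
  xy T lam * \sum_(x | inc (colour lam) (x^-1)%g) zeta lam mu A x *: T x.
Proof.
move=> Ab; rewrite xyE; apply: (leigen_factor HT (par := @parity m n)).
- exact: leigen_eps.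
- exact: eps_out.
- exact: eps1.
- exact: leigen_zeta.
Qed.

Lemma zeta_factorr (H : algType laurent) (T : sperm d -> H) (HT : is_hecke T) lam mu A :
  parity_bound A -> elt T (zeta lam mu A) =
  (\sum_(x | inc (colour mu) x) zeta lam mu A x *: T x) * xy T mu.
Proof.
move=> Ab; rewrite xyE; apply: (reigen_factor HT (par := @parity m n)).
- exact: reigen_eps.
- exact: eps_out.
- exact: eps1.
- exact: reigen_zeta.
Qed.

(** This identifies the image of the generator prescribed by [is_e]. The left-minimal x with the
    matrix of g lie in g W_mu by [left_min_coset]; they are the g w with w in [Ddelta], and
    [reigen_pres] gives their coefficients. *)
Lemma zeta_Ddelta (H : algType laurent) (T : sperm d -> H) (HT : is_hecke T) lam mu g :
  g \in Dmin lam mu -> parity_bound (kappa lam g mu) ->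
  elt T (zeta lam mu (kappa lam g mu)) = xy T lam *
    (T g * \sum_(w in Ddelta lam g mu) (- q) ^- slen (odd_part mu w) *: T w).
Proof.
rewrite mem_Dmin => /andP[gl gm] Ab; rewrite (zeta_factorl HT) //; congr (_ * _).
rewrite (reindex_inj (mulgI g)) /= (bigID (pres (colour mu))) /= addrC big1 ?add0r.
  rewrite mulr_sumr; apply: eq_big => [w|w /andP[_ wm]].
    by rewrite mem_Ddelta // andbC.
  rewrite (reigen_pres (@parity_rev m n) (@reigen_zeta lam mu _ Ab)) //.
  rewrite zeta_min // eqxx mulr1 -scalerAr (TM HT) ?(len_presr wm) //.
  by rewrite odd_partE ?mem_Wpar // slenE ffunE wm.
move=> w /andP[gwl]; rewrite ffunE; case: eqP => [kE|]; last by rewrite scale0r.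
by have := left_min_coset gl gwl kE; rewrite mulKg => ->.
Qed.

End Zeta.

(** * The maps e_A *)

Section Standard.
Variables d m n : nat.
Implicit Types (lam mu nu : wcomp d m n) (i : 'I_d) (a b r : sint d).
Implicit Types (u w x y g : sperm d) (k l : sint (m + n)) (A : 'M[int]_((m + n).*2.+1)).

Lemma card_fiber_sum (T : finType) M (P : pred T) (F : T -> 'I_M) :
  (\sum_(l < M) #|[set r | P r && (F r == l)]|)%N = #|[set r | P r]|.
Proof.
rewrite -(card_rel_split P xpredT F); apply: eq_card => r.
by rewrite !inE andbT.
Qed.

Lemma block_set lam k : block lam k = [set r | colour lam r == k].
Proof. by apply/setP => r; rewrite inE block_col. Qed.

Lemma kappa_row_sum lam x mu k :
  \sum_l kappa lam x mu k l = #|block lam k|%:Z.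
Proof.
under eq_bigr do rewrite kappa_rows.
rewrite -(big_morph Posz PoszD (erefl _)) block_set; congr Posz.
exact: (card_fiber_sum (fun r => colour lam r == k)).
Qed.

Lemma kappa_col_sum lam x mu l :
  \sum_k kappa lam x mu k l = #|block mu l|%:Z.
Proof.
rewrite -(kappa_row_sum mu (x^-1)%g lam l); apply: eq_bigr => k _.
by rewrite kappa_tr [RHS]mxE.
Qed.

Lemma kappa_Xi lam x mu : parity_bound (kappa lam x mu) -> kappa lam x mu \in Xi d m n.
Proof.
move=> Ab; rewrite inE; apply/and4P; split.
- by apply/forallP => k; apply/forallP => l; rewrite kappaE.
- under eq_bigr do rewrite kappa_row_sum.
  rewrite -(big_morph Posz PoszD (erefl _)); apply/eqP; congr Posz.
  under eq_bigr do rewrite block_set.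
  have := card_fiber_sum xpredT (colour lam); rewrite /= => ->.
  by rewrite -[RHS]card_ord; apply: eq_card => r; rewrite !inE.
- apply/forallP => k; apply/forallP => l; rewrite !kappaE; apply/eqP; congr Posz.
  rewrite -[LHS](card_imset _ (@rev_ord_inj d.*2.+1)); apply: eq_card => r.
  rewrite -[r]rev_ordK (mem_imset _ _ (@rev_ord_inj _)) !inE.
  by rewrite rev_ordK spermN !col_rev !rev_eqC.
apply/forallP => k; apply/forallP => l; apply/implyP => /Ab.
by rewrite kappaE !inE; case: #|_| => [|[]].
Qed.

Lemma Xi_bound A : A \in Xi d m n -> parity_bound A.
Proof.
rewrite inE => /and4P[_ _ _ /forallP Ap] k l kl.
have /forallP/(_ l)/implyP/(_ kl) := Ap k.
by rewrite !inE => /orP[]/eqP->.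
Qed.

Lemma wsumS lam (j : 'I_(m + n).+1) :
  wsum lam j = ((if (j : nat) is j'.+1 then wsum lam j' else 0) + lam j)%N.
Proof.
rewrite /wsum (bigD1 j) //= addnC; congr (_ + _)%N.
case jE: (nat_of_ord j) => [|j'].
  by rewrite big1 // => l; rewrite leqn0 -(inj_eq val_inj) /= jE => /andP[->].
apply: eq_bigl => l; rewrite -(inj_eq val_inj) /= jE; lia.
Qed.

(** The number of points of colour at most j determines [wsum lam j]. *)
Lemma block_card_inj lam mu : (forall k, #|block lam k| = #|block mu k|) -> lam = mu.
Proof.
move=> lm; have wle : forall lam mu, (forall k, #|block lam k| = #|block mu k|) ->
    forall j, (j <= m + n)%N -> (wsum lam j <= wsum mu j)%N.
  move=> {lm}lam {}mu lm j jmn; rewrite leqNgt; apply/negP => lt.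
  pose S (nu : wcomp d m n) := [set r | xpredT r && (colour nu r <= sint_nat (m + n) j)%N].
  have SE nu r : (r \in S nu) = (sval_int r <= (wsum nu j)%:Z).
    rewrite inE /= -sval_le colour_le.
    by rewrite sval_int_nat.
  have S_card : #|S lam| = #|S mu|.
    have SP nu : #|S nu| = _ := card_rel_split xpredT (fun l => l <= _)%N (colour nu).
    rewrite !SP; apply: eq_bigr => l _.
    by have := lm l; rewrite !block_set.
  have : S mu \proper S lam.
    apply/properP; split.
      by apply/fintype.subsetP => r; rewrite !SE; lia.
    have wd := wsum_le lam j.
    by exists (sint_nat d (wsum lam j)); rewrite SE sval_int_nat //; lia.
  by move/proper_card; rewrite S_card ltnn.
have wE j : (j <= m + n)%N -> wsum lam j = wsum mu j.
  by move=> jmn; apply/eqP; rewrite eqn_leq !wle // => k; rewrite lm.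
apply/val_inj/ffunP => j; apply: val_inj.
have := wE j (leq_ord j); rewrite !wsumS; have := leq_ord j.
case: (nat_of_ord j) => [_|j' jmn]; first by rewrite !add0n.
by rewrite wE ?(ltnW jmn) // => /addnI.
Qed.

Section Maps.
Variables (H : algType laurent) (T : sperm d -> H).
Hypothesis HT : is_hecke T.
Notation xymod := (xymod m n T).
Notation schur := (schur m n T).

Definition place lam (z : H) : {ffun wcomp d m n -> H} :=
  [ffun l => if l == lam then z else 0].

Lemma xymod_in_sum (x : xymod) :
  exists h : wcomp d m n -> H, x = \sum_lam xymod_in T lam (h lam).
Proof.
have /is_xymodP xP := valP x.
have [h hE] := boolp.choice xP; exists h; apply: val_inj.
rewrite raddf_sum; apply/ffunP => lam; rewrite sum_ffunE (bigD1 lam) //= !ffunE eqxx.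
rewrite hE big1 ?addr0 // => l /negPf ll.
by rewrite ffunE eq_sym ll.
Qed.

Lemma xymod_in_ract lam (h : H) : xymod_in T lam h = Defs.ract (xymod_in T lam 1 : xymod) h.
Proof.
apply/val_inj/ffunP => l; rewrite !ffunE.
by case: eqP => _; rewrite ?mulr1 ?mul0r.
Qed.

Lemma schur_sum (f : schur) (I : finType) (F : I -> xymod) :
  f (\sum_k F k) = \sum_k f (F k).
Proof.
have /is_schurP[fD _] := valP f.
have f0 : f 0 = 0 by apply: (addrI (f 0)); rewrite -fD !addr0.
exact: (big_morph f fD f0).
Qed.

Lemma schur_eq nu (f f' : schur) :
  (forall mu h, mu != nu -> f (xymod_in T mu h) = 0) ->
  (forall mu h, mu != nu -> f' (xymod_in T mu h) = 0) ->
  f (xymod_in T nu 1) = f' (xymod_in T nu 1) -> f = f'.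
Proof.
move=> f0 f'0 ff'; apply/val_inj/boolp.funext => x; change (f x = f' x).
have [h ->] := xymod_in_sum x; rewrite !schur_sum; apply: eq_bigr => lam _.
have [->|ln] := eqVneq lam nu; last by rewrite f0 ?f'0.
have /is_schurP[_ fM] := valP f; have /is_schurP[_ f'M] := valP f'.
rewrite xymod_in_ract; apply: etrans (fM _ _) (etrans _ (esym (f'M _ _))).
by congr (Defs.ract _ _).
Qed.

Section LeftMult.
Variables (lam nu : wcomp d m n) (Y z : H).
Hypothesis YE : Y * xy T nu = xy T lam * z.

(** Left multiplication by Y is right linear; [YE] is what makes it land in [xy]_lam H. *)
Fact left_subproof (x : xymod) : place lam (Y * x nu) \in is_xymod T.
Proof.
have /is_xymodP/(_ nu)[h xh] := valP x.
apply/is_xymodP => l; rewrite ffunE; case: eqP => [->|_]; last by exists 0; rewrite mulr0.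
by exists (z * h); rewrite xh !mulrA YE.
Qed.

Definition left_fun (x : xymod) : xymod := XYMod (left_subproof x).

Fact left_schur : left_fun \in is_schur (T := T) (m := m) (n := n).
Proof.
apply/is_schurP; split=> [x y|x h]; apply/val_inj/ffunP => l; rewrite !ffunE.
  by case: eqP => _; rewrite ?addr0 // mulrDr.
by case: eqP => _; rewrite ?mul0r // mulrA.
Qed.

Definition left_map : schur := Defs.Schur left_schur.

Lemma left_map_out mu h : mu != nu -> left_map (xymod_in T mu h) = 0.
Proof.
move=> mn; apply/val_inj/ffunP => l; rewrite !ffunE [nu == mu]eq_sym (negPf mn) mulr0.
by case: eqP.
Qed.

Lemma left_map_gen : left_map (xymod_in T nu 1) = xymod_in T lam z.
Proof.
apply/val_inj/ffunP => l; rewrite !ffunE eqxx mulr1 YE.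
by case: eqP.
Qed.

End LeftMult.

(** The row and column sums determine lam and nu. If no x has matrix A, both sides are 0: [xget]
    takes its default value and [zeta lam nu A] vanishes. Otherwise the factorisations of zeta_A on
    the left and on the right produce a map satisfying [is_e]. *)
Lemma e_zeta lam nu A : A \in Xi d m n ->
  (forall k, \sum_l A k l = #|block lam k|%:Z) ->
  (forall l, \sum_k A k l = #|block nu l|%:Z) ->
  (forall mu h, mu != nu -> e_ T A (xymod_in T mu h) = 0) /\
  val (e_ T A (xymod_in T nu 1)) = place lam (elt T (zeta lam nu A)).
Proof.
move=> AXi Arow Acol; have Ab := Xi_bound AXi; rewrite /e_ AXi.
set P := (X in classical_sets.xget _ X).
have Puniq lam' g nu' : A = kappa lam' g nu' -> lam' = lam /\ nu' = nu.
  move=> AE; split; apply: block_card_inj => k; apply: (can_inj absz_nat _).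
    by rewrite -Arow AE kappa_row_sum.
  by rewrite -Acol AE kappa_col_sum.
have [[x xA]|noA] := boolp.pselect (exists x, kappa lam x nu = A); last first.
  have -> : classical_sets.xget 0 P = 0.
    apply: classical_sets.xgetPN => f [mu' [g [nu' [_ AE _]]]].
    have [lE nE] := Puniq _ _ _ AE; apply: noA; exists g.
    by rewrite AE lE nE.
  split=> //; apply/ffunP => l; rewrite !ffunE; case: eqP => // _.
  rewrite /elt big1 // => x _; rewrite ffunE; case: eqP => [xA|]; last by rewrite scale0r.
  by case: noA; exists x.
have [y [yl yn yE]] := bimin_exists lam nu x.
have yD : y \in Dmin lam nu by rewrite mem_Dmin yl.
have yA : kappa lam y nu = A by rewrite yE.
have yC : y \in Dcirc lam nu by rewrite mem_Dcirc // yA.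
have zE := zeta_Ddelta HT yD; rewrite yA in zE.
have /classical_sets.xgetPex : exists f, P f.
  have YE := etrans (esym (zeta_factorr HT lam nu Ab)) (zE Ab).
  exists (left_map YE); exists lam, y, nu; split=> //; split.
    by move=> mu h; apply: left_map_out.
  exact: left_map_gen.
move=> /(_ 0) [lam' [g [nu' [gC AE [eout egen]]]]].
have [lE nE] := Puniq _ _ _ AE; move: lE nE gC AE eout egen => -> -> gC AE eout egen.
split; first exact: eout.
rewrite egen; apply/ffunP => l; rewrite !ffunE; case: eqP => // _.
have gD : g \in Dmin lam nu by move: gC; rewrite inE => /andP[].
by have := zeta_Ddelta HT gD; rewrite -AE => ->.
Qed.

End Maps.
End Standard.

(** * Moving one point between adjacent blocks *)

Lemma rmin_eq d N (f : coloring d N) (u x y : sperm d) : pres f u ->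
  inc f x -> inc f y -> (x * u)%g = y -> u = 1%g.
Proof.
move=> uf xf yf xuy; apply/eqP; rewrite -invg_eq1; apply/eqP.
apply: (@lmin_eq _ _ f _ (x^-1)%g (y^-1)%g); rewrite ?presV ?invgK //.
by rewrite -xuy invMg.
Qed.

(* The hypotheses below hold for some p if B = kappa lam 1 mu is such that      *)
(* B - E^theta_{al,be} is diagonal, see diag_shift.                             *)
Section Shift.
Variables d m n : nat.
Variables (lam mu : wcomp d m n) (p : sint d) (al be : sint (m + n)).
Implicit Types (a b r : sint d) (x y : sperm d) (j k l : sint (m + n)).
Hypothesis lam_p : colour lam p = al.
Hypothesis mu_p : colour mu p = be.
Hypothesis be_al : (be : nat) = al.+1.
Hypothesis off_p : forall a, a != p -> a != rev_ord p -> colour lam a = colour mu a.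

Lemma be_neq_al : be != al.
Proof. by apply/eqP => /(congr1 val); rewrite /= be_al; lia. Qed.

Lemma be_neq_ral : be != rev_ord al.
Proof.
apply/eqP => /(congr1 val); rewrite /= be_al subSS; have := ltn_ord al.
lia.
Qed.

Lemma p_neq_rev : p != rev_ord p.
Proof.
apply/eqP => pE; have := congr1 (colour lam) pE; have := congr1 (colour mu) pE.
rewrite !col_rev lam_p mu_p => /(congr1 val) + /(congr1 val).
by rewrite /= !subSS be_al; lia.
Qed.

(** A point from p upwards has mu-colour at least be, and off p and -p this is also its
    lam-colour. *)
Lemma lam_lt_p a : a != p -> colour lam a = al -> (a < p)%N.
Proof.
move=> ap ca; rewrite ltnNge; apply/negP => /(col_mono (colour mu)); rewrite mu_p.
have [aE|ar] := eqVneq a (rev_ord p).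
  move: ca; rewrite aE !col_rev lam_p mu_p => /(congr1 val); rewrite /= !subSS be_al.
  by have := ltn_ord be; rewrite be_al; lia.
by rewrite -off_p // ca be_al ltnn.
Qed.

Lemma mu_gt_p a : a != p -> colour mu a = be -> (p < a)%N.
Proof.
move=> ap ca; rewrite ltnNge; apply/negP => /(col_mono (colour lam)); rewrite lam_p.
have [aE|ar] := eqVneq a (rev_ord p).
  move: ca; rewrite aE !col_rev lam_p mu_p => /(congr1 val); rewrite /= !subSS be_al.
  by have := ltn_ord be; rewrite be_al; lia.
by rewrite off_p // ca be_al ltnn.
Qed.

Lemma fix_p_pres x : pres (colour lam) x -> x p = p -> pres (colour mu) x.
Proof.
move=> /presP xl xp; apply/presP => a.
have [->|ap] := eqVneq a p; first by rewrite xp.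
have [->|ar] := eqVneq a (rev_ord p); first by rewrite spermN xp.
rewrite -!off_p // ?xl // -xp -?spermN; by rewrite (inj_eq (@sperm_inj d x)).
Qed.

(** The element (p,i)(-p,-i) of W. The order of the tests also covers i = p and i = -p. *)
Definition swap_fun i a := if a == p then i else if a == i then p else
  if a == rev_ord p then rev_ord i else if a == rev_ord i then rev_ord p else a.

Lemma swap_exists i : i != rev_ord i -> colour lam i = al ->
  exists2 x, pres (colour lam) x & x p = i.
Proof.
move=> ir ci; have pr := p_neq_rev.
have sp : swap_fun i p = i by rewrite /swap_fun eqxx.
have si : swap_fun i i = p by rewrite /swap_fun eqxx; case: eqP.
have srp : swap_fun i (rev_ord p) = rev_ord i.
  rewrite /swap_fun eqxx rev_eqC (negPf pr); case: eqP => // <-.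
  by rewrite rev_ordK.
have sri : swap_fun i (rev_ord i) = rev_ord p.
  rewrite /swap_fun eqxx [rev_ord i == i]rev_eqC (negPf ir).
  case: eqP => [<-|_]; first by rewrite rev_ordK.
  by case: eqP.
have so a : a \notin [:: p; i; rev_ord p; rev_ord i] -> swap_fun i a = a.
  by rewrite !inE !negb_or /swap_fun => /and4P[/negPf-> /negPf-> /negPf-> /negPf->].
have swapK : involutive (swap_fun i).
  move=> a; have [|/so sa] := boolP (a \in [:: p; i; rev_ord p; rev_ord i]); last by rewrite !sa.
  by rewrite !inE => /or4P[]/eqP->; rewrite ?(sp, si, srp, sri).
have swapN a : swap_fun i (rev_ord a) = rev_ord (swap_fun i a).
  have [|na] := boolP (a \in [:: p; i; rev_ord p; rev_ord i]).
    by rewrite !inE => /or4P[]/eqP->; rewrite ?(sp, si, srp, sri, rev_ordK).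
  rewrite !so //; move: na; rewrite !inE !rev_eqC !rev_ordK.
  by rewrite !negb_or => /and4P[-> -> -> ->].
have sP : [forall a, perm (can_inj swapK) (rev_ord a) == rev_ord (perm (can_inj swapK) a)].
  by apply/forallP => a; rewrite !permE swapN.
exists (SPerm sP); last by rewrite [LHS]permE /swap_fun eqxx.
apply/presP => a; rewrite [X in colour lam X]permE /swap_fun.
do ![case: eqP => [->|_]] => //; by rewrite ?col_rev ?ci ?lam_p.
Qed.

(** Strip mu-simple right descents from the swap. Such a descent s_j of an element of W_lam is also
    lam-simple, and an element preserving both colourings fixes p, the only point with the colours
    al and be. *)
Lemma shift_exists i : i != rev_ord i -> colour lam i = al ->
  exists x, [/\ pres (colour lam) x, inc (colour mu) x & x p = i].
Proof.
move=> ir ci; have [x xl <-] := swap_exists ir ci; move: xl.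
elim/(rmin_ind (f := colour mu)): x => [x xm xl|j x fj xj IHx xl]; first by exists x.
have sl : simple (colour lam) j.
  have /presP xV : pres (colour lam) ((x * sgen j)^-1)%g by rewrite presV.
  apply: (asc_or_simple (@col_mono _ _ _) xV).
  by rewrite invMg sgenV asc_sgen negbK.
have sp : sgen j p = p.
  have /presP cl := pres_sgen sl; have /presP cm := pres_sgen fj.
  have [//|sp] := eqVneq (sgen j p) p.
  have := cl p; have := cm p; have [->|sr] := eqVneq (sgen j p) (rev_ord p).
    rewrite !col_rev lam_p mu_p => /(congr1 val) + /(congr1 val).
    by rewrite /= !subSS be_al; lia.
  rewrite -off_p // => -> /esym; rewrite lam_p mu_p => /eqP.
  by rewrite eq_sym (negPf be_neq_al).
have [] := IHx; first by rewrite presMr ?pres_sgen in xl.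
by move=> x' [x'l x'm x'p]; exists x'; rewrite spermM sp.
Qed.

Lemma shift_unique x y : pres (colour lam) x -> inc (colour mu) x ->
  pres (colour lam) y -> inc (colour mu) y -> x p = y p -> x = y.
Proof.
move=> xl xm yl ym xyp; have vl : pres (colour lam) (x^-1 * y)%g by rewrite presMl ?presV.
have vm : pres (colour mu) (x^-1 * y)%g.
  by apply: fix_p_pres => //; rewrite spermM -xyp spermK.
have := rmin_eq vm xm ym (mulKVg _ _) => /(canRL (mulKVg _)).
by rewrite mulg1.
Qed.

Section Element.
Variable x : sperm d.
Hypothesis xl : pres (colour lam) x.
Hypothesis xm : inc (colour mu) x.
Let i := x p.

Lemma lam_i : colour lam i = al.
Proof. by have /presP-> := xl. Qed.

Lemma i_neq_rev : i != rev_ord i.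
Proof. by rewrite /i -spermN (inj_eq (@sperm_inj d x)) p_neq_rev. Qed.

(** [oddp], taken for the colours other than al and -al, extracts the part of x on these points.
    There lam and mu agree, so this part is increasing on the blocks of lam and preserves them,
    hence is 1. *)
Lemma shift_fix a : colour lam a != al -> colour lam a != rev_ord al -> x a = a.
Proof.
pose par k := (k != al) && (k != rev_ord al).
have par_rev k : par (rev_ord k) = par k.
  by rewrite /par rev_eqC (inj_eq rev_ord_inj) andbC.
move=> ca car; have : oddp (colour lam) par_rev x = 1%g; last first.
  by move/(congr1 (fun w : sperm d => w a)); rewrite sperm1 oddpE // /par ca car.
have := presp_oddp par_rev xl => /andP[ol _].
apply: (pres_inc1 ol); apply/incP => b c bc cE; rewrite !oddpE // -cE.
case: ifP => // /andP[cb cbr]; have /incP := xm; apply=> //.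
have off e : par (colour lam e) -> colour lam e = colour mu e.
  by move=> /andP[e1 e2]; apply: off_p;
    [apply: contraNneq e1|apply: contraNneq e2] => ->; rewrite ?col_rev lam_p.
by rewrite -!off // /par -?cE cb cbr.
Qed.

Definition above := [set r | [&& colour lam r == al, (i < r)%N & r != rev_ord i]].

(** Off p and -p the colourings agree, so x is increasing there on the blocks of lam. Only p, the
    last point of its block, is moved down, past the points of [above]. *)
Lemma shift_invP a b : [&& (a < b)%N, a != rev_ord b & ((x^-1)%g b < (x^-1)%g a)%N] =
  (a == i) && (b \in above) || (b == rev_ord i) && (rev_ord a \in above).
Proof.
have half c : c \in above ->
    [/\ (i < c)%N, i != rev_ord c & ((x^-1)%g c < (x^-1)%g i)%N].
  rewrite inE => /and3P[/eqP cc ic cr]; split=> //; first by rewrite -rev_eqC eq_sym.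
  rewrite /i spermK; apply: lam_lt_p.
    by apply: contraTneq ic => cp; rewrite /i -cp spermKV ltnn.
  by have /presP-> : pres (colour lam) (x^-1)%g by rewrite presV.
apply/and3P/orP => [[ab nab lt]|]; last first.
  case=> /andP[/eqP-> /half[h1 h2 h3]]; first by split.
  split; first by rewrite -ltn_rev rev_ordK.
    by move: h2; rewrite !rev_ordK eq_sym.
  by rewrite spermN -ltn_rev rev_ordK -spermN.
set b1 := (x^-1)%g b in lt; set a1 := (x^-1)%g a in lt.
have aE : a = x a1 by rewrite spermKV.
have bE : b = x b1 by rewrite spermKV.
have /presP xl' := xl.
have cE : colour lam a1 = colour lam b1.
  apply: sint_eq; apply/eqP; rewrite eqn_leq andbC col_mono ?(ltnW lt) //=.
  by rewrite -(xl' a1) -(xl' b1) -aE -bE col_mono // ltnW.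
have [a1p|a1p] := eqVneq a1 p.
  have ai : a = i by rewrite aE a1p.
  left; rewrite -ai eqxx inE -ai ab -rev_eqC [rev_ord b == a]eq_sym nab bE xl' -cE a1p.
  by rewrite lam_p eqxx.
have [b1p|b1p] := eqVneq b1 p.
  by have := lam_lt_p a1p; rewrite cE b1p lam_p -b1p ltnNge (ltnW lt) => /(_ erefl).
have [a1r|a1r] := eqVneq a1 (rev_ord p).
  have := @lam_lt_p (rev_ord b1); rewrite rev_eqC.
  have b1r : b1 != rev_ord p by rewrite -a1r neq_ltn lt.
  rewrite b1r col_rev -cE a1r col_rev rev_ordK lam_p => /(_ isT erefl).
  by rewrite -ltn_rev rev_ordK -a1r ltnNge (ltnW lt).
have [b1r|b1r] := eqVneq b1 (rev_ord p).
  have bi : b = rev_ord i by rewrite bE b1r spermN.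
  have cra : colour lam (rev_ord a) = al.
    by rewrite col_rev aE xl' cE b1r col_rev rev_ordK lam_p.
  right; rewrite bi eqxx inE cra eqxx (inj_eq rev_ord_inj) -ltn_rev rev_ordK -bi ab.
  by move: nab; rewrite bi rev_ordK.
have := xm => /incP/(_ _ _ lt); rewrite -!off_p // => /(_ (esym cE)).
by rewrite -aE -bE ltnNge (ltnW ab).
Qed.

End Element.
End Shift.

Lemma parity_not_rev m n (k : sint (m + n)) : parity k -> k != rev_ord k.
Proof.
apply: contraTneq => kE; rewrite /parity -leqNgt.
have := sval_intN k; rewrite -kE; lia.
Qed.

(** * Length of x and odd inversions of x^-1 y *)

Section ShiftStatistics.
Variables d m n : nat.
Variables (lam mu nu : wcomp d m n) (p : sint d) (al be : sint (m + n)).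
Implicit Types (a b r : sint d) (j k l : sint (m + n)).
Hypothesis lam_p : colour lam p = al.
Hypothesis mu_p : colour mu p = be.
Hypothesis be_al : (be : nat) = al.+1.
Hypothesis off_p : forall a, a != p -> a != rev_ord p -> colour lam a = colour mu a.
Variable x : sperm d.
Hypothesis xl : pres (colour lam) x.
Hypothesis xm : inc (colour mu) x.
Let i := x p.
Let S := above lam p al x.
Let invP := shift_invP lam_p mu_p be_al off_p xl xm.

Definition negp (c : sint d * sint d) := (rev_ord c.2, rev_ord c.1).

Lemma negpK : involutive negp.
Proof. by case=> a b; rewrite /negp /= !rev_ordK. Qed.

Lemma half_card_neg (D : {set sint d * sint d}) (Q : {set sint d * sint d}) :
  D = Q :|: negp @: Q -> [disjoint Q & negp @: Q] -> #|D|./2 = #|Q|.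
Proof.
move=> -> dj; rewrite cardsU (disjoint_setI0 dj) cards0 subn0.
by rewrite (card_imset _ (can_inj negpK)) addnn doubleK.
Qed.

Lemma mem_negp (Q : {set sint d * sint d}) a b :
  ((a, b) \in negp @: Q) = ((rev_ord b, rev_ord a) \in Q).
Proof. by rewrite -[(a, b)]negpK (mem_imset _ _ (can_inj negpK)). Qed.

Lemma lam_above a : a \in S -> [/\ colour lam a = al, (i < a)%N & a != rev_ord i].
Proof. by rewrite inE => /and3P[/eqP]. Qed.

Lemma len_shift : len x = #|S|.
Proof.
have inj_i : injective (fun r : sint d => (i, r)) by move=> a b [].
rewrite -lenV /len /len2 -(card_imset (mem S) inj_i); apply: half_card_neg.
  apply/setP => -[a b]; rewrite inE /= [RHS]inE mem_negp invP; congr (_ || _).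
    apply/andP/imsetP => [[/eqP-> bS]|[c cS [-> ->]]]; last by rewrite eqxx.
    by exists b.
  rewrite -rev_eqC; apply/andP/imsetP => [[/eqP-> aS]|[c cS [-> ->]]]; last by rewrite eqxx.
  by exists (rev_ord a).
apply/pred0Pn => -[[a b]] /= /andP[/imsetP[c /lam_above[_ _ ci] [-> ->]]].
by rewrite mem_negp => /imsetP[c' _ []] /eqP; rewrite rev_eqC (negPf ci).
Qed.

Lemma oddw_shift : oddw lam x = if parity al then x else 1%g.
Proof.
have fixx a : parity (colour lam a) != parity al -> x a = a.
  move=> pa; apply: (shift_fix lam_p off_p xl xm); apply: contraNneq pa => ->;
  by rewrite ?parity_rev.
apply: spermP => a; rewrite oddpE //; case: ifP => pa; case: ifP => pal //.
- by rewrite sperm1 fixx // pa pal.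
- by rewrite fixx // pa pal.
- by rewrite sperm1.
Qed.

Section Row.
Variable y : sperm d.
Hypothesis yl : inc (colour lam) (y^-1)%g.
Hypothesis yn : inc (colour nu) y.
Let X := (x^-1 * y)%g.
Let a0 := (y^-1)%g i.
Let k0 := colour nu a0.

Lemma ya0 : y a0 = i. Proof. by rewrite spermKV. Qed.

Lemma Xa0 : X a0 = p. Proof. by rewrite spermM ya0 spermK. Qed.

Lemma lam_X a : colour lam (X a) = colour lam (y a).
Proof. by rewrite spermM; have /presP-> : pres (colour lam) (x^-1)%g by rewrite presV. Qed.

Lemma card_sumZ (I : finType) (P : pred I) :
  #|[set a | P a]|%:Z = \sum_a (P a : nat)%:Z.
Proof.
rewrite -sum1dep_card big_mkcond (big_morph Posz PoszD (erefl _)).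
by apply: eq_bigr => a _; case: (P a).
Qed.

(** x^-1 preserves the blocks of lam, so X and y have the same rows for lam. Passing to mu moves
    only a0 and -a0, since X a0 = p. *)
Lemma kappa_shift : kappa mu X nu = kappa lam y nu - Etheta al k0 + Etheta be k0.
Proof.
apply/matrixP => k l; rewrite !kappaE.
have -> : (kappa lam y nu - Etheta al k0 + Etheta be k0) k l =
    kappa lam y nu k l - Etheta al k0 k l + Etheta be k0 k l by rewrite !mxE.
rewrite kappaE !card_sumZ (bigD1 a0) //= (bigD1 (rev_ord a0)) /=; last first.
  rewrite /a0 -spermN (inj_eq (@sperm_inj d _)).
  by rewrite eq_sym (i_neq_rev lam_p mu_p be_al).
rewrite [in RHS](bigD1 a0) //= [in RHS](bigD1 (rev_ord a0)) /=; last first.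
  rewrite /a0 -spermN (inj_eq (@sperm_inj d _)).
  by rewrite eq_sym (i_neq_rev lam_p mu_p be_al).
have -> : \sum_(a | (a != a0) && (a != rev_ord a0))
      ((colour mu (X a) == k) && (colour nu a == l) : nat)%:Z =
    \sum_(a | (a != a0) && (a != rev_ord a0))
      ((colour lam (y a) == k) && (colour nu a == l) : nat)%:Z.
  apply: eq_bigr => a /andP[aa ar]; rewrite -lam_X off_p //.
    by rewrite -Xa0 (inj_eq (@sperm_inj d _)).
  by rewrite -Xa0 -spermN (inj_eq (@sperm_inj d _)).
rewrite !spermN !col_rev Xa0 ya0 mu_p (lam_i lam_p xl) -/k0 /Etheta !mxE.
rewrite ![k == _]eq_sym ![l == _]eq_sym.
have natzb (b : bool) : b%:R = b%:Z :> int by case: b.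
rewrite !natzb; have shuffle (s t s' t' z : int) :
  s' + (t' + z) = s + (t + z) - (s + t) + (s' + t') by ring.
exact: shuffle.
Qed.

(** [lower] gives the inversions of X inside the row of p, [higher] those inside the column of a0.
    Up to negation, and when that row or column is odd, these are all that [oddpair] counts. *)
Definition lower := [set r | (colour lam r == be) && ((y^-1)%g r < a0)%N].
Definition higher := [set r in S | colour nu ((y^-1)%g r) == k0].

Definition lower_pairs : {set sint d * sint d} :=
  [set ((y^-1)%g r, a0) | r in [set r in lower | parity be]].
Definition higher_pairs : {set sint d * sint d} :=
  [set (a0, (y^-1)%g r) | r in [set r in higher | parity k0]].

Lemma yV_inj : injective (y^-1)%g.
Proof. exact: sperm_inj. Qed.

Lemma lam_shift_fix b : colour lam b = be -> x b = b.
Proof.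
by move=> cb; apply: (shift_fix lam_p off_p xl xm);
  rewrite cb ?(be_neq_al be_al) ?(be_neq_ral be_al).
Qed.

Lemma lower_off_p r : colour lam r = be -> r != p /\ r != rev_ord p.
Proof.
move=> cr; split; apply: contra_eq_neq cr => ->; rewrite ?col_rev lam_p eq_sym.
  exact: be_neq_al.
exact: be_neq_ral.
Qed.

Lemma mem_lower_pairs a b : (a, b) \in lower_pairs =
  [&& b == a0, parity be, colour lam (y a) == be & (a < a0)%N].
Proof.
apply/imsetP/and4P => [[r + [-> ->]]|[/eqP-> pb ca aa]].
  by rewrite !inE spermKV => /andP[/andP[-> ->] ->].
by exists (y a); rewrite ?spermK // !inE spermK ca aa pb.
Qed.

Lemma mem_higher_pairs a b : (a, b) \in higher_pairs =
  [&& a == a0, parity k0, y b \in S & colour nu b == k0].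
Proof.
apply/imsetP/and4P => [[r + [-> ->]]|[/eqP-> pk bS cb]].
  by rewrite [_ \in [set _ in _ | _]]inE [_ \in higher]inE spermKV => /andP[/andP[-> ->] ->].
exists (y b); last by rewrite spermK.
by rewrite [_ \in [set _ in _ | _]]inE [_ \in higher]inE spermK bS cb pk.
Qed.

Lemma lower_pairs_inv a b : (a, b) \in lower_pairs ->
  (a, b) \in invset (oddpair mu nu X) X.
Proof.
rewrite mem_lower_pairs => /and4P[/eqP-> pb /eqP ca aa].
have [np nrp] := lower_off_p ca.
have Xa : X a = y a by rewrite spermM -{1}(lam_shift_fix ca) spermK.
have mua : colour mu (y a) = be by rewrite -off_p.
rewrite inE /= aa Xa0 Xa /oddpair Xa0 Xa mua mu_p eqxx pb /=.
rewrite (mu_gt_p lam_p mu_p be_al off_p) // andbT.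
apply: contraNneq (be_neq_ral be_al) => aE.
by rewrite -ca aE spermN ya0 col_rev (lam_i lam_p xl).
Qed.

Lemma higher_pairs_inv a b : (a, b) \in higher_pairs ->
  (a, b) \in invset (oddpair mu nu X) X.
Proof.
rewrite mem_higher_pairs => /and4P[/eqP-> pk bS /eqP cb].
have [lb ib nb] := lam_above bS.
have := invP i (y b); rewrite eqxx bS /= => /and3P[_ nib Xlt].
rewrite inE /= !spermM ya0 Xlt /oddpair cb -/k0 eqxx pk orbT /= andbT.
apply/andP; split; last by rewrite -(inj_eq (@sperm_inj d y)) spermN ya0.
have /incP yV := yl; rewrite -[b](spermK y); apply: yV => //.
by rewrite (lam_i lam_p xl) lb.
Qed.

Lemma oddpair_neg a b : oddpair mu nu X (rev_ord b) (rev_ord a) = oddpair mu nu X a b.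
Proof.
rewrite /oddpair !spermN !col_rev !(inj_eq rev_ord_inj) !parity_rev.
by rewrite [_ == colour mu (X a)]eq_sym [_ == colour nu a]eq_sym;
  congr (_ || _); case: eqP => // ->.
Qed.

Lemma invset_neg (P : rel (sint d)) (w : sperm d) a b :
  (forall a b, P (rev_ord b) (rev_ord a) = P a b) ->
  ((rev_ord b, rev_ord a) \in invset P w) = ((a, b) \in invset P w).
Proof.
move=> PN; rewrite !inE /= !ltn_rev !spermN !ltn_rev PN.
by rewrite (inj_eq rev_ord_inj) -rev_eqC [rev_ord b == a]eq_sym.
Qed.

(** Inside a column y is increasing, so x^-1 reverses the images and [shift_invP] applies. Inside a
    row of mu avoiding p and -p the lam-rows agree too, and both x and y^-1 are increasing there; so
    an inversion must involve p or -p. *)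
Lemma inv_pairs a b : (a, b) \in invset (oddpair mu nu X) X ->
  let Q := lower_pairs :|: higher_pairs in (a, b) \in Q \/ (rev_ord b, rev_ord a) \in Q.
Proof.
move=> ab_inv Q; have := ab_inv; rewrite inE /= => /and4P[ab nab].
rewrite /oddpair => /orP[/andP[/eqP cX pX]|/andP[/eqP cN pN]] lt; last first.
  have /incP yi := yn; have yab := yi _ _ ab cN.
  have := invP (y a) (y b); rewrite yab -spermN (inj_eq (@sperm_inj d y)) nab /=.
  rewrite -!spermM lt => /esym /orP[/andP[/eqP ya bS]|/andP[/eqP yb aS]].
    have aE : a = a0 by rewrite /a0 -[i]/(x p) -ya spermK.
    left; rewrite inE; apply/orP; right.
    by rewrite mem_higher_pairs aE eqxx bS -cN aE eqxx /k0 -aE pN.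
  have bE : rev_ord b = a0.
    by rewrite /a0 -[i]/(x p) -[x p]rev_ordK -yb spermN spermK.
  right; rewrite inE; apply/orP; right.
  by rewrite mem_higher_pairs bE eqxx spermN aS !col_rev cN -col_rev bE eqxx /k0 -bE
    col_rev parity_rev -cN pN.
have wlog_row a' b' : (a', b') \in invset (oddpair mu nu X) X ->
    colour mu (X a') = colour mu (X b') -> parity (colour mu (X a')) ->
    X b' = p -> (a', b') \in Q.
  rewrite inE /= => /and4P[ab' nab' _ lt'] cX' pX' Xb.
  have bE : b' = a0 by apply: (@sperm_inj d X); rewrite Xb Xa0.
  rewrite inE; apply/orP; left; rewrite mem_lower_pairs bE eqxx.
  rewrite cX' Xb mu_p in pX'; rewrite pX' -bE ab' andbT /=.
  have Xap : X a' != p by rewrite -Xb neq_ltn lt' orbT.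
  have Xar : X a' != rev_ord p.
    apply: contraNneq (parity_not_rev pX') => Xa.
    by move: cX'; rewrite Xa Xb col_rev mu_p => ->.
  by rewrite -lam_X off_p // cX' Xb mu_p.
have [Xb|Xb] := eqVneq (X b) p; first by left; apply: wlog_row.
have [Xa|Xa] := eqVneq (X a) (rev_ord p).
  right; apply: wlog_row; rewrite ?invset_neg //; try exact: oddpair_neg.
  - by rewrite !spermN !col_rev cX.
  - by rewrite spermN col_rev parity_rev -cX.
  - by rewrite spermN Xa rev_ordK.
have cXb : X b <> rev_ord p.
  move=> Xbr; have := @mu_gt_p _ _ _ lam mu p al be lam_p mu_p be_al off_p (rev_ord (X a)).
  rewrite rev_eqC Xa col_rev cX Xbr col_rev rev_ordK mu_p => /(_ isT erefl).
  by rewrite -ltn_rev rev_ordK -Xbr ltnNge (ltnW lt).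
have cXa : X a <> p.
  move=> Xap; have := @mu_gt_p _ _ _ lam mu p al be lam_p mu_p be_al off_p (X b) Xb.
  by rewrite -cX Xap mu_p => /(_ erefl); rewrite -Xap ltnNge (ltnW lt).
have lamE : colour lam (y a) = colour lam (y b).
  by rewrite -!lam_X !off_p //; apply/eqP.
have muE : colour mu (X a) = colour mu (X b) by [].
have /incP xi := xm; have := xi _ _ lt (esym muE).
rewrite !spermM !spermKV => yba; have /incP yi := yl.
by have := yi _ _ yba (esym lamE); rewrite !spermK ltnNge (ltnW ab).
Qed.

Lemma oddinv_shift : oddinv mu nu X =
  ((if parity be then #|lower| else 0) + (if parity k0 then #|higher| else 0))%N.
Proof.
rewrite /oddinv (@half_card_neg _ (lower_pairs :|: higher_pairs)).
- have -> : #|lower_pairs :|: higher_pairs| = (#|lower_pairs| + #|higher_pairs|)%N.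
    rewrite cardsU (_ : _ :&: _ = finset.set0) ?cards0 ?subn0 //.
    apply/setP => -[a b]; rewrite !inE mem_lower_pairs mem_higher_pairs.
    by apply/negP => /andP[/and4P[_ _ _ lt] /andP[/eqP aE _]]; rewrite aE ltnn in lt.
  congr (_ + _)%N; rewrite card_imset.
  - by case: parity; [apply: eq_card|apply: eq_card0] => r; rewrite !inE ?andbT ?andbF.
  - by move=> r r' [/yV_inj].
  - by case: parity; [apply: eq_card|apply: eq_card0] => r; rewrite [LHS]inE ?andbT ?andbF.
  - by move=> r r' [/yV_inj].
- apply/setP => -[a b]; rewrite [RHS]inE mem_negp; apply/idP/orP => [/inv_pairs//|].
  have QI a' b' : (a', b') \in lower_pairs :|: higher_pairs ->
      (a', b') \in invset (oddpair mu nu X) X.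
    by rewrite inE => /orP[/lower_pairs_inv|/higher_pairs_inv].
  by case=> /QI //; rewrite invset_neg //; exact: oddpair_neg.
(* Every pair of Q contains a0 and none contains -a0, so Q is disjoint from its negative. *)
have Qa0 a b : (a, b) \in lower_pairs :|: higher_pairs -> a != rev_ord b /\ (a = a0 \/ b = a0).
  move=> abQ; split; last first.
    move: abQ; rewrite inE mem_lower_pairs mem_higher_pairs.
    by case/orP=> /andP[/eqP ->]; [right|left].
  have : (a, b) \in invset (oddpair mu nu X) X.
    by move: abQ; rewrite inE => /orP[/lower_pairs_inv|/higher_pairs_inv].
  by rewrite inE => /and4P[].
have a0r : a0 != rev_ord a0.
  by rewrite /a0 -spermN (inj_eq yV_inj) (i_neq_rev lam_p mu_p be_al).
apply/pred0Pn => -[[a b]] /= /andP[/Qa0[nab aQ]]; rewrite mem_negp => /Qa0[_].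
case: aQ => aE [] rE.
- by rewrite rE aE eqxx in nab.
- by move: a0r; rewrite -{2}aE rE eqxx.
- by move: a0r; rewrite -{2}aE rE eqxx.
- by move: nab; rewrite aE -rE rev_ordK eqxx.
Qed.

End Row.
End ShiftStatistics.

(** The exponents are the ranks in S counted from the top, so each number below #|S| occurs once. *)
Lemma geom_rank M (S : {set 'I_M}) (z : laurent) :
  \sum_(i in S) z ^+ #|[set r in S | (i < r)%N]| = qint z #|S|.
Proof.
move: {-1}#|S| (erefl #|S|) => k; elim: k S => [|k IHk] S Sk.
  by rewrite (cards0_eq Sk) big_set0 /qint big_ord0.
have [i0 i0S] : exists i, i \in S by apply/set0Pn; rewrite -card_gt0 Sk.
case: (@arg_minnP _ i0 (mem S) (@nat_of_ord M) i0S) => j; rewrite -[mem S j]/(j \in S) => jS jmin.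
have Sj : #|S :\ j| = k by have := cardsD1 j S; rewrite jS Sk => -[].
have gt r : r \in S :\ j -> (j < r)%N.
  rewrite !inE => /andP[rj /jmin]; rewrite leq_eqVlt => /orP[/eqP/val_inj jr|//].
  by rewrite jr eqxx in rj.
rewrite (big_setD1 j) //= /qint big_ord_recr /= addrC; congr (_ + _).
  rewrite -/(qint z k) -(IHk _ Sj); apply: eq_bigr => i iS.
  congr (z ^+ _); apply: eq_card => r; rewrite !inE.
  by case: eqP => // ->; rewrite ltnNge (ltnW (gt _ iS)) andbF.
congr (z ^+ _); rewrite -Sj; apply: eq_card => r; rewrite [LHS]inE.
apply/andP/idP => [[rS jr]|rS]; last by rewrite gt //; move: rS; rewrite inE => /andP[].
by rewrite !inE rS andbT neq_ltn jr orbT.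
Qed.

Lemma rev_fix_eq N (a b : sint N) : a == rev_ord a -> b == rev_ord b -> a = b.
Proof.
by move=> /eqP/(congr1 val) + /eqP/(congr1 val) => /= + ?; move=> *; apply: sint_eq; lia.
Qed.

Lemma rev_center N : rev_ord (sint_nat N 0) = sint_nat N 0.
Proof. by apply: sint_eq; rewrite val_rev val_sint_nat //; lia. Qed.

(** * Counting points by matrix entries *)

Section Count.
Variables d m n : nat.
Variables (lam mu nu : wcomp d m n) (p : sint d) (al be : sint (m + n)).
Implicit Types (a b r : sint d) (j k l : sint (m + n)).
Hypothesis lam_p : colour lam p = al.
Hypothesis mu_p : colour mu p = be.
Hypothesis be_al : (be : nat) = al.+1.
Hypothesis off_p : forall a, a != p -> a != rev_ord p -> colour lam a = colour mu a.
Variable y : sperm d.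
Hypothesis yl : inc (colour lam) (y^-1)%g.
Hypothesis yn : inc (colour nu) y.
Let K := kappa lam y nu.
Let down k : 'M[int]_((m + n).*2.+1) := K - Etheta al k + Etheta be k.

Definition cell k := [set r | [&& r != rev_ord r, colour lam r == al &
  colour nu ((y^-1)%g r) == k]].

Let z0 := sint_nat d 0.

Lemma eq_z0 r : (r == rev_ord r) = (r == z0).
Proof.
by apply/idP/eqP => [rr|->]; [apply: rev_fix_eq rr _|]; rewrite rev_center eqxx.
Qed.

Lemma colour_z0 (la : wcomp d m n) k : (colour la z0 == k) = (k == rev_ord k).
Proof.
have cz : colour la z0 == rev_ord (colour la z0) by rewrite -col_rev rev_center.
by apply/eqP/idP => [<-//|kr]; apply: rev_fix_eq.
Qed.

Lemma yV_z0 : (y^-1)%g z0 = z0.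
Proof. by apply/eqP; rewrite -eq_z0 -spermN rev_center. Qed.

Lemma card_cell k : K al k = #|cell k|%:Z + ((al == rev_ord al) && (k == rev_ord k))%:R.
Proof.
rewrite /K kappa_rows (cardsD1 z0) inE yV_z0 !colour_z0 addnC PoszD.
congr (Posz _ + _); last by case: (_ && _).
by apply: eq_card => r; rewrite !inE -eq_z0.
Qed.

Lemma al_be : (al == be) = false.
Proof. by rewrite eq_sym (negPf (be_neq_al be_al)). Qed.

Lemma al_rbe : (al == rev_ord be) = false.
Proof. by rewrite -rev_eqC eq_sym (negPf (be_neq_ral be_al)). Qed.

(** If al = k = 0 as integers, E^theta_00 = 2 E_00 subtracts one more, which is balanced by the
    point 0 missing from the cell. *)
Lemma down_al k : down k al k = #|cell k|%:Z - 1.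
Proof.
have -> : down k al k = K al k - Etheta al k al k + Etheta be k al k by rewrite !mxE.
by rewrite card_cell /Etheta !mxE !eqxx al_be al_rbe /=; ring.
Qed.

Section Element.
Variable x : sperm d.
Hypothesis xl : pres (colour lam) x.
Hypothesis xm : inc (colour mu) x.
Let i := x p.
Let k := colour nu ((y^-1)%g i).

(** On column k the map y is increasing and row be comes after row al, so a point of row be in this
    column comes after a0. Oddness of be excludes be = -be, where E^theta_(be,k) would contribute at
    column -k. *)
Lemma card_lower : parity be ->
  (#|lower lam p be x y|)%:Z = \sum_(j : sint (m + n) | (j < k)%N) down k be j.
Proof.
move=> pb; have lE : lower lam p be x y =
    [set r | (colour lam r == be) && (colour nu ((y^-1)%g r) < k)%N].
  apply/setP => r; rewrite !inE; case: eqP => //= cr.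
  apply/idP/idP => [lt|lt]; last first.
    by rewrite ltnNge; apply: contraL lt => /(col_mono (colour nu)); rewrite -leqNgt.
  rewrite ltn_neqAle col_mono ?(ltnW lt) // andbT; apply/eqP => /sint_eq ck.
  have /incP yi := yn; have := yi _ _ lt ck; rewrite !spermKV ltnNge ltnW //.
  rewrite ltnNge; apply/negP => /(col_mono (colour lam)).
  by rewrite cr (lam_i lam_p xl) be_al ltnn.
rewrite lE (card_rel_split (fun r => colour lam r == be) (fun j : sint (m + n) => j < k)%N).
rewrite (big_morph Posz PoszD (erefl _)); apply: eq_bigr => j jk.
rewrite -kappa_rows -/K.
have -> : down k be j = K be j - Etheta al k be j + Etheta be k be j by rewrite !mxE.
rewrite /Etheta !mxE (negPf (be_neq_al be_al)) (negPf (be_neq_ral be_al)).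
rewrite (negPf (parity_not_rev pb)) (_ : j == k = false) ?andbF /= ?addr0 ?subr0 //.
by apply/negbTE; rewrite neq_ltn jk.
Qed.

Lemma card_above : (#|above lam p al x|)%:Z =
  (#|higher lam nu p al x y|)%:Z + \sum_(j : sint (m + n) | (k < j)%N) down k al j.
Proof.
(* -i is not in [above]. It can lie in U only if al = -al, and then the second unit of
   E^theta_(al,k) removes it from the sum as well. *)
pose U := [set r | (colour lam r == al) && (k < colour nu ((y^-1)%g r))%N].
have ir := i_neq_rev lam_p mu_p be_al x.
have ci := lam_i lam_p xl.
have /incP yi := yl.
have aE : #|above lam p al x| = (#|higher lam nu p al x y| + #|U :\ rev_ord i|)%N.
  rewrite -(cardsID [set r | colour nu ((y^-1)%g r) == k]); congr (_ + _)%N.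
    by apply: eq_card => r; rewrite !inE.
  apply: eq_card => r; rewrite !inE; case: (colour lam r =P al) => [cr|]; last by rewrite !andbF.
  rewrite /= -/i; case: (r =P rev_ord i) => [|_]; first by rewrite !andbF.
  rewrite andbT /=; apply/andP/idP => [[ck ir']|kr].
    rewrite ltn_neqAle eq_sym (inj_eq val_inj) ck /= /k col_mono //.
    by apply/ltnW/yi => //; rewrite ci cr.
  split; first by rewrite neq_ltn kr orbT.
  rewrite ltnNge leq_eqVlt negb_or; apply/andP; split.
    by apply: contraTN kr => /eqP/sint_eq->; rewrite /k ltnn.
  apply: contraTN kr => ri; rewrite -leqNgt /k col_mono // ltnW // yi //.
  by rewrite cr -ci.
have UE : (#|U|)%:Z = \sum_(j : sint (m + n) | (k < j)%N) K al j.
  rewrite /U (card_rel_split (fun r => colour lam r == al) (fun j : sint (m + n) => k < j)%N).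
  rewrite (big_morph Posz PoszD (erefl _)); apply: eq_bigr => j _.
  by rewrite /K kappa_rows.
have dE : \sum_(j : sint (m + n) | (k < j)%N) down k al j = (#|U|)%:Z - (rev_ord i \in U : nat)%:Z.
  rewrite UE inE spermN !col_rev -/k ci.
  have E j : (k < j)%N -> down k al j = K al j - ((rev_ord al == al) && (j == rev_ord k))%:R.
    move=> kj; have -> : down k al j = K al j - Etheta al k al j + Etheta be k al j by rewrite !mxE.
    rewrite /Etheta !mxE al_be al_rbe -[al == rev_ord al]rev_eqC.
    rewrite eqxx /= (_ : j == k = false) ?add0r ?addr0 //.
    by apply/negbTE; rewrite neq_ltn kj orbT.
  rewrite (eq_bigr _ E) sumrB; congr (_ - _).
  case: (rev_ord al == al); last by rewrite big1.
  rewrite /= big_mkcond (bigD1 (rev_ord k)) //= eqxx big1 => [|j /negPf->]; last by case: ifP.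
  by rewrite addr0; case: ifP.
rewrite aE dE (cardsD1 (rev_ord i) U) !PoszD; ring.
Qed.

(** The left side omits -i and the right side omits 0. Either both or neither lie in U: each does
    exactly when al and k are the middle index and i < 0. *)
Lemma card_higher : #|higher lam nu p al x y| = #|[set r in cell k | (i < r)%N]|.
Proof.
pose U := [set r | [&& colour lam r == al, (i < r)%N & colour nu ((y^-1)%g r) == k]].
have -> : higher lam nu p al x y = U :\ rev_ord i.
  apply/setP => r; rewrite !inE -/i -/k; case: (colour lam r == al); case: (i < r)%N;
  by case: (r == rev_ord i); case: (_ == k).
have -> : [set r in cell k | (i < r)%N] = U :\ z0.
  apply/setP => r; rewrite !inE eq_z0; case: (colour lam r == al); case: (i < r)%N;
  by case: (r == z0); case: (_ == k).
have := cardsD1 (rev_ord i) U; rewrite (cardsD1 z0 U).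
suff -> : (z0 \in U) = (rev_ord i \in U) by move/addnI.
rewrite !inE yV_z0 !colour_z0 spermN !col_rev -/k (lam_i lam_p xl).
rewrite [al == _]eq_sym [k == _]eq_sym; congr [&& _, _ & _].
by rewrite val_rev val_sint_nat // addn0; have := ltn_ord i; lia.
Qed.

Lemma term_shift : kappa mu (x^-1 * y)%g nu = down k /\
  qddot al ^+ len x * chi true ^+ oddinv mu nu (x^-1 * y)%g =
  qdot be ^ (\sum_(j : sint (m + n) | (j < k)%N) down k be j) *
  qddot al ^ (\sum_(j : sint (m + n) | (k < j)%N) down k al j) *
  (qddot al * chi (parity k)) ^+ #|[set r in cell k | (i < r)%N]|.
Proof.
split; first exact: kappa_shift.
have qU : qddot al \is a GRing.unit.
  by rewrite /qddot; case: parity; rewrite ?unitrN ?unitr1 ?q_unit.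
rewrite (oddinv_shift lam_p mu_p be_al off_p xl xm yl yn) -/k.
rewrite (len_shift lam_p mu_p be_al off_p xl xm) card_higher.
set h := #|[set r in _ | _]|.
have -> : qdot be ^ (\sum_(j : sint (m + n) | (j < k)%N) down k be j) =
    chi true ^+ (if parity be then #|lower lam p be x y| else 0%N).
  rewrite /qdot; case: ifP => pb; last by rewrite exp1rz expr0.
  by rewrite -card_lower.
have -> : qddot al ^+ #|above lam p al x| =
    qddot al ^ (\sum_(j : sint (m + n) | (k < j)%N) down k al j) * qddot al ^+ h.
  by rewrite exprnP card_above card_higher -/h addrC exprzDr // mulrC.
rewrite exprMn exprD.
have -> : chi true ^+ (if parity k then h else 0%N) = chi (parity k) ^+ h.
  by case: (parity k); rewrite ?expr1n.
by rewrite mulrACA; congr (_ * _); apply: mulrC.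
Qed.

End Element.
End Count.

Lemma right_min_coset d m n (lam mu : wcomp d m n) (x : sperm d) :
  inc (colour mu) x -> kappa lam x mu = kappa lam 1%g mu -> pres (colour lam) x.
Proof.
move=> xm kE; rewrite -presV -[(x^-1)%g]mul1g -{1}invg1 -{1}invg1.
apply: (@left_min_coset _ _ _ mu lam); rewrite ?invgK //.
  by apply/incP; exact: increasing1.
by rewrite !kappa_tr kE.
Qed.

(** * Coefficients of the product *)

Section Product.
Variables d m n : nat.
Variables (lam mu nu : wcomp d m n) (p : sint d) (al be : sint (m + n)).
Implicit Types (a b r : sint d) (j k l : sint (m + n)).
Hypothesis lam_p : colour lam p = al.
Hypothesis mu_p : colour mu p = be.
Hypothesis be_al : (be : nat) = al.+1.
Hypothesis off_p : forall a, a != p -> a != rev_ord p -> colour lam a = colour mu a.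
Variables (H : algType laurent) (T : sperm d -> H).
Hypothesis HT : is_hecke T.
Variables A B : 'M[int]_((m + n).*2.+1).
Hypothesis BE : B = kappa lam 1%g mu.
Hypothesis Bb : parity_bound B.
Variable y : sperm d.
Hypothesis yl : inc (colour lam) (y^-1)%g.
Hypothesis yn : inc (colour nu) y.

Let Ak k : 'M[int]_((m + n).*2.+1) := A + Etheta al k - Etheta be k.

Definition struct_coef k : laurent :=
  qdot be ^ (\sum_(j : sint (m + n) | (j < k)%N) A be j) *
  qddot al ^ (\sum_(j : sint (m + n) | (k < j)%N) A al j).

(** By [oddw_shift] the odd part of x is x or 1, so its coefficient is (- q)^-l(x) or 1. This is
    where qddot = -1 or q comes from. *)
Lemma zeta_shift x : pres (colour lam) x -> inc (colour mu) x ->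
  zeta lam mu B x * q ^+ len x = qddot al ^+ len x.
Proof.
move=> xl xm; have i1 N (f : coloring d N) : inc f 1%g by apply/incP; exact: increasing1.
have zE : zeta lam mu B x = sgnw lam x.
  have := leigen_pres (@parity_rev m n) (@leigen_zeta d m n lam mu B Bb) xl (g := 1%g).
  rewrite invg1 mulg1 => -> //; rewrite zeta_min ?invg1 //.
  by rewrite BE eqxx mulr1.
rewrite zE ffunE xl /= -[oddp _ _ _]/(oddw lam x).
rewrite (oddw_shift lam_p off_p xl xm) /qddot; case: (parity al); last first.
  by rewrite len1 expr0 invr1 mul1r.
have qu : (- q) ^+ len x \is a GRing.unit by rewrite unitrX // unitrN q_unit.
have -> : q ^+ len x = (-1) ^+ len x * (- q) ^+ len x by rewrite -exprMn mulN1r opprK.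
by rewrite mulrCA mulVr // mulr1.
Qed.

(** By [shift_exists] and [shift_unique], x runs once over the cell through i = x p; the exponents
    are then ranks. *)
Lemma shift_sum (F : sperm d -> laurent) k :
  (forall x, pres (colour lam) x -> inc (colour mu) x ->
     colour nu ((y^-1)%g (x p)) = k ->
     F x = (qddot al * chi (parity k)) ^+ #|[set r in cell lam nu al y k | (x p < r)%N]|) ->
  \sum_(x | [&& pres (colour lam) x, inc (colour mu) x & colour nu ((y^-1)%g (x p)) == k]) F x
  = qint (qddot al * chi (parity k)) #|cell lam nu al y k|.
Proof.
move=> FE; rewrite -geom_rank.
pose D := [set x : sperm d |
  [&& pres (colour lam) x, inc (colour mu) x & colour nu ((y^-1)%g (x p)) == k]].
have -> : cell lam nu al y k = [set (x : sperm d) p | x in D].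
  apply/setP => i; rewrite inE; apply/and3P/imsetP => [[ir /eqP ci ck]|[x + ->]].
    have [x [xl xm xp]] := shift_exists lam_p mu_p be_al off_p ir ci.
    by exists x; rewrite ?inE ?xl ?xm ?xp.
  rewrite inE => /and3P[xl xm xk]; split=> //; first exact: (i_neq_rev lam_p mu_p be_al).
  by rewrite (lam_i lam_p xl).
rewrite big_imset /=; last first.
  move=> x x'; rewrite !inE => /and3P[xl xm _] /and3P[xl' xm' _].
  exact: (shift_unique off_p xl xm xl' xm').
apply: eq_big => [x|x /and3P[xl xm /eqP xk]]; first by rewrite inE.
rewrite FE //; congr (_ ^+ _); apply: eq_card => r; rewrite !inE; congr (_ && _).
apply/and3P/imsetP => [[ir /eqP ci ck]|[x' + ->]].
  have [x' [x'l x'm x'p]] := shift_exists lam_p mu_p be_al off_p ir ci.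
  by exists x'; rewrite ?inE ?x'l ?x'm ?x'p.
rewrite inE => /and3P[x'l x'm x'k]; split=> //; first exact: (i_neq_rev lam_p mu_p be_al).
by rewrite (lam_i lam_p x'l).
Qed.

Lemma AkE k : (kappa lam y nu == Ak k) = (kappa lam y nu - Etheta al k + Etheta be k == A).
Proof.
by rewrite /Ak; apply/eqP/eqP => [->|<-]; rewrite addrAC; [rewrite subrK addrK|rewrite addrK subrK].
Qed.

(** The terms are grouped by the column k of y^-1(x p). By [kappa_shift] a group contributes only if
    [kappa lam y nu] is [Ak k], and then [term_shift] makes it a geometric sum. *)
Lemma product_coef :
  coefs HT ((\sum_(x | inc (colour mu) x) zeta lam mu B x *: T x) *
            elt T (zeta mu nu A)) y =
  \sum_k (if kappa lam y nu == Ak k then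
     struct_coef k * qint (qddot al * chi (parity k)) (absz (A al k + 1)) else 0).
Proof.
rewrite mulr_suml coefs_sum (bigID (pres (colour lam))) /= addrC big1 ?add0r; last first.
  move=> x /andP[xm xl]; rewrite ffunE; case: eqP => [kE|]; last by rewrite scale0r mul0r coefs0.
  by rewrite (right_min_coset xm) // kE in xl.
rewrite (partition_big (fun x : sperm d => colour nu ((y^-1)%g (x p))) xpredT) //=.
apply: eq_bigr => k _.
have term x : pres (colour lam) x -> inc (colour mu) x ->
    coefs HT (zeta lam mu B x *: T x * elt T (zeta mu nu A)) y =
    qddot al ^+ len x * zeta mu nu A (x^-1 * y)%g.
  move=> xl xm; rewrite -scalerAl coefsZ coefs_Tmul; last first.
    by rewrite (len_presl (f := colour lam)) ?presV // lenV.
  by rewrite eltK mulrA zeta_shift.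
rewrite AkE; case: eqP => [kA|nkA]; last first.
  apply: big1 => x /andP[/andP[xm xl] /eqP xk]; rewrite term // ffunE.
  case: eqP => [xA|]; last by rewrite mulr0.
  by case: nkA; rewrite -xk -(kappa_shift nu lam_p mu_p be_al off_p) //.
have cellE : (absz (A al k + 1)) = #|cell lam nu al y k|.
  by rewrite -kA (down_al lam nu be_al) // subrK.
rewrite cellE -(shift_sum (F := fun x => (qddot al * chi (parity k)) ^+
  #|[set r in cell lam nu al y k | (x p < r)%N]|)) // mulr_sumr.
apply: eq_big => [x|x /andP[/andP[xm xl] /eqP xk]].
  by rewrite andbA [X in X && _]andbC.
have [kE tE] := term_shift lam_p mu_p be_al off_p yl yn xl xm.
rewrite xk in kE tE; rewrite term // ffunE kE kA eqxx tE.
by rewrite /struct_coef -kA.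
Qed.

End Product.

(** * The multiplication formula *)

Section Multiplication.
Variables d m n : nat.
Implicit Types (lam mu nu : wcomp d m n) (g x y : sperm d) (i j k l : sint (m + n)).
Implicit Types (al be : sint (m + n)) (A B : 'M[int]_((m + n).*2.+1)).

Lemma EthetaE i j k l : Etheta i j k l =
  ((k == i) && (l == j))%:R + ((k == rev_ord i) && (l == rev_ord j))%:R.
Proof. by rewrite /Etheta !mxE. Qed.

Lemma Etheta_rev i j : Etheta (rev_ord i) (rev_ord j) = Etheta i j.
Proof. by rewrite /Etheta !rev_ordK addrC. Qed.

Lemma sum_pred1 k (b : bool) : \sum_l (b && (l == k))%:R = b%:R :> int.
Proof.
case: b; last by rewrite big1.
by rewrite (bigD1 k) //= eqxx big1 ?addr0 // => l /negPf->.
Qed.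

Lemma Etheta_row i j k : \sum_l Etheta i j k l = (k == i)%:R + (k == rev_ord i)%:R.
Proof.
by under eq_bigr do rewrite EthetaE; rewrite big_split /= !sum_pred1.
Qed.

Lemma Etheta_col i j l : \sum_k Etheta i j k l = (l == j)%:R + (l == rev_ord j)%:R.
Proof.
under eq_bigr do rewrite EthetaE ![_ && (l == _)]andbC.
by rewrite big_split /= !sum_pred1.
Qed.

Lemma sum_diag B k : is_diag_mx B -> \sum_l B k l = B k k.
Proof.
move=> /is_diag_mxP Bd; rewrite (bigD1 k) //= big1 ?addr0 // => l lk.
by rewrite Bd // eq_sym.
Qed.

Lemma sum_diag_col B l : is_diag_mx B -> \sum_k B k l = B l l.
Proof.
move=> /is_diag_mxP Bd; rewrite (bigD1 l) //= big1 ?addr0 // => k lk.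
by rewrite Bd.
Qed.

Lemma diag_blocks lam mu al be k : is_diag_mx (kappa lam 1%g mu - Etheta al be) ->
  #|block lam k|%:Z = #|block mu k|%:Z + (k == al)%:R + (k == rev_ord al)%:R
    - (k == be)%:R - (k == rev_ord be)%:R.
Proof.
move=> Bd; rewrite -(kappa_row_sum lam 1%g mu k) -(kappa_col_sum lam 1%g mu k).
have := sum_diag k Bd; have := sum_diag_col k Bd; set D := _ - _.
have E i j : kappa lam 1%g mu i j = D i j + Etheta al be i j.
  have -> : D i j = kappa lam 1%g mu i j - Etheta al be i j by rewrite !mxE.
  by rewrite subrK.
move=> Dc Dr; under eq_bigr do rewrite E; under [in RHS]eq_bigr do rewrite E.
rewrite !big_split /= Dc Dr Etheta_row Etheta_col; ring.
Qed.

Lemma diag_shift lam mu al be : (be : nat) = al.+1 ->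
  is_diag_mx (kappa lam 1%g mu - Etheta al be) -> exists p,
  [/\ colour lam p = al, colour mu p = be &
      forall a, a != p -> a != rev_ord p -> colour lam a = colour mu a].
Proof.
move=> be_al /is_diag_mxP Bd.
have E k l : k != l -> kappa lam 1%g mu k l = Etheta al be k l.
  move=> kl; have := Bd k l kl.
  have -> : (kappa lam 1%g mu - Etheta al be) k l = kappa lam 1%g mu k l - Etheta al be k l.
    by rewrite !mxE.
  by move/subr0_eq.
pose U := [set r | (colour lam r == al) && (colour mu r == be)].
have KE k l : kappa lam 1%g mu k l = #|[set r | (colour lam r == k) && (colour mu r == l)]|%:Z.
  by rewrite kappaE; congr Posz; apply: eq_card => r; rewrite !inE sperm1.
have ab := be_neq_al be_al; have rab := be_neq_ral be_al.
(* al and be are not both the middle index, so the entry of E^theta_(al,be) at (al,be) is 1 and not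
   2; hence a single point p. *)
have nr : (al == rev_ord al) && (be == rev_ord be) = false.
  apply/negP => /andP[/eqP/(congr1 val)/= a1 /eqP/(congr1 val)/= b1].
  by rewrite !subSS in a1 b1; have := ltn_ord be; lia.
have U1 : #|U| = 1%N.
  have := E al be; rewrite eq_sym ab => /(_ isT).
  by rewrite KE EthetaE !eqxx nr => UE; apply/eqP; rewrite -eqz_nat UE.
have /cards1P[p Up] : #|U| == 1%N by rewrite U1.
have : p \in U by rewrite Up set11.
rewrite inE => /andP[/eqP lp /eqP mp]; exists p; split=> // a ap ar.
have [//|lm] := eqVneq (colour lam a) (colour mu a).
have : kappa lam 1%g mu (colour lam a) (colour mu a) != 0.
  by rewrite KE eqz_nat cards_eq0; apply/set0Pn; exists a; rewrite inE !eqxx.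
rewrite E // EthetaE; case: (boolP (_ && _)) => [aU|_] /=.
  by have : a \in U; [rewrite inE|rewrite Up inE (negPf ap)].
rewrite add0r; case: (boolP (_ && _)) => //= raU _.
have : rev_ord a \in U by rewrite inE !col_rev !rev_eqC.
by rewrite Up inE rev_eqC (negPf ar).
Qed.

Lemma qpar_same al k : parity k = parity al ->
  qddot al * chi (parity k) = qpar al.
Proof.
move=> ->; rewrite /qddot /qpar /chi; case: (parity al).
  by rewrite mulN1r opprK expr1 exprN1.
by rewrite mulr1 expr0 expr1z.
Qed.

Lemma qpar_mixed al k : parity k != parity al -> qddot al * chi (parity k) = -1.
Proof.
rewrite /qddot; case: (parity al); case: (parity k) => //= _; first by rewrite mulr1.
by rewrite mulrN divrr ?q_unit.
Qed.

Lemma Etheta_ge0 i j k l : 0 <= Etheta i j k l.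
Proof. by rewrite EthetaE; case: (_ && _); case: (_ && _). Qed.

Lemma Xi_rev A k l : A \in Xi d m n -> A (rev_ord k) (rev_ord l) = A k l.
Proof.
by rewrite inE => /and4P[_ _ /forallP/(_ k)/forallP/(_ l)/eqP-> _].
Qed.

Lemma Xi_ge0 A k l : A \in Xi d m n -> 0 <= A k l.
Proof. by rewrite inE => /and4P[/forallP/(_ k)/forallP/(_ l)]. Qed.

Lemma center_parity k : k = rev_ord k -> parity k = false.
Proof. by move=> kr; apply/negP => /parity_not_rev/eqP. Qed.

(* If row al and column k have different parities, the geometric sum has ratio *)
(* -1 and one or two terms; it vanishes exactly when the new matrix has the    *)
(* forbidden entry 2.                                                          *)
Lemma shift_term lam nu al be k A y : (be : nat) = al.+1 ->
  A \in Xi d m n -> kappa lam y nu = A + Etheta al k - Etheta be k ->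
  qint (qddot al * chi (parity k)) (absz (A al k + 1)) =
  qint (qpar al) (absz (A al k + 1)) * (A + Etheta al k - Etheta be k \in Xi d m n)%:R.
Proof.
move=> be_al AXi KE; have Ab := Xi_bound AXi.
have AkE k' l' : (A + Etheta al k - Etheta be k) k' l' =
    A k' l' + Etheta al k k' l' - Etheta be k k' l' by rewrite !mxE.
have [pk|pk] := eqVneq (parity k) (parity al).
  suff -> : A + Etheta al k - Etheta be k \in Xi d m n by rewrite mulr1 qpar_same.
  rewrite -KE; apply: kappa_Xi; rewrite KE => k' l' kl; rewrite AkE.
  (* The increased entries lie at (al,k) and its negative, where the parities agree and the bound
     asks nothing. *)
  have -> : Etheta al k k' l' = 0.
    rewrite EthetaE; case: (k' =P al) => [e1|_]; case: (l' =P k) => [e2|_] /=;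
    rewrite ?add0r; first (by rewrite e1 e2 pk eqxx in kl);
    case: (k' =P rev_ord al) => [e3|_] //=; case: (l' =P rev_ord k) => [e4|_] //=;
    by rewrite e3 e4 !parity_rev pk eqxx in kl.
  by rewrite addr0; have := Ab _ _ kl; have := Etheta_ge0 be k k' l'; lia.
have nc : (al == rev_ord al) && (k == rev_ord k) = false.
  by apply/negP => /andP[/eqP/center_parity pa /eqP/center_parity pk']; rewrite pa pk' in pk.
rewrite qpar_mixed //; have A1 := Ab al k; rewrite eq_sym in A1.
have := Xi_ge0 al k AXi; have := A1 pk.
have [A0 _ _|An0 Ale Age] := eqVneq (A al k) 0.
  rewrite A0 /= /qint !big_ord1 !expr0.
  suff -> : A + Etheta al k - Etheta be k \in Xi d m n by rewrite mulr1.
  rewrite -KE; apply: kappa_Xi; rewrite KE => k' l' kl; rewrite AkE.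
  apply: (@le_trans _ _ (A k' l' + Etheta al k k' l')).
    by have := Etheta_ge0 be k k' l'; lia.
  rewrite EthetaE; case: (boolP ((k' == al) && _)) => [/andP[/eqP-> /eqP->]|_].
    by rewrite A0 nc.
  case: (boolP (_ && _)) => [/andP[/eqP-> /eqP->]|_]; first by rewrite Xi_rev // A0.
  by rewrite !addr0 Ab.
have A1' : A al k = 1 by lia.
have -> : A + Etheta al k - Etheta be k \in Xi d m n = false.
  apply/negP => /Xi_bound/(_ al k); rewrite eq_sym pk => /(_ isT).
  rewrite AkE A1' !EthetaE !eqxx nc [al == be]eq_sym (negPf (be_neq_al be_al)).
  by rewrite -rev_eqC [_ == be]eq_sym (negPf (be_neq_ral be_al)).
by rewrite mulr0 A1' /qint !big_ord_recr big_ord0 /= expr0 expr1 add0r subrr.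
Qed.

End Multiplication.

(** * Multiplication in the Schur algebra *)

Section MainFormula.
Variables (d m n : nat) (H : algType laurent) (T : sperm d -> H).
Hypothesis HT : is_hecke T.
Implicit Types (lam mu nu : wcomp d m n) (g x y : sperm d) (i j k l : sint (m + n)).
Implicit Types (al be : sint (m + n)) (A B : 'M[int]_((m + n).*2.+1)).

Lemma e_mul_shift lam mu nu g al be A B : (be : nat) = al.+1 ->
  A = kappa mu g nu -> B = kappa lam 1%g mu -> A \in Xi d m n -> B \in Xi d m n ->
  is_diag_mx (B - Etheta al be) ->
  e_ T B * e_ T A = \sum_k (struct_coef al be A k * qint (qpar al) (absz (A al k + 1)))
    *: e_ T (A + Etheta al k - Etheta be k).
Proof.
move=> be_al AE BE AXi BXi Bd.
have Ab := Xi_bound AXi; have Bb := Xi_bound BXi.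
have [p [lam_p mu_p off_p]] : exists p, [/\ colour lam p = al, colour mu p = be &
    forall a, a != p -> a != rev_ord p -> colour lam a = colour mu a].
  by apply: diag_shift => //; rewrite -BE.
pose Ak k : 'M[int]_((m + n).*2.+1) := A + Etheta al k - Etheta be k.
have Arow k : \sum_l A k l = #|block mu k|%:Z by rewrite AE kappa_row_sum.
have Acol l : \sum_k A k l = #|block nu l|%:Z by rewrite AE kappa_col_sum.
have Brow k : \sum_l B k l = #|block lam k|%:Z by rewrite BE kappa_row_sum.
have Bcol l : \sum_k B k l = #|block mu l|%:Z by rewrite BE kappa_col_sum.
have AkE k k' l : Ak k k' l = A k' l + Etheta al k k' l - Etheta be k k' l by rewrite !mxE.
have Akrow k k' : \sum_l Ak k k' l = #|block lam k'|%:Z.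
  under eq_bigr do rewrite AkE.
  rewrite sumrB big_split /= Arow !Etheta_row [RHS](@diag_blocks _ _ _ lam mu al be) -?BE //.
  by rewrite opprD !addrA.
have Akcol k l : \sum_k' Ak k k' l = #|block nu l|%:Z.
  under eq_bigr do rewrite AkE.
  by rewrite sumrB big_split /= Acol !Etheta_col addrK.
have [Aout Agen] := e_zeta HT AXi Arow Acol.
have [Bout Bgen] := e_zeta HT BXi Brow Bcol.
have Akout k mu' h : mu' != nu -> e_ T (Ak k) (xymod_in T mu' h) = 0.
  move=> mn; have [AkXi|/negPf AkXi] := boolP (Ak k \in Xi d m n).
    have [out _] := e_zeta HT AkXi (Akrow k) (Akcol k); exact: out.
  by rewrite /e_ AkXi.
(* The indicator is there because zeta of a matrix outside [Xi] may be nonzero, while e of it is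
   0. *)
pose E k := elt T [ffun x => (Ak k \in Xi d m n)%:R * zeta lam nu (Ak k) x].
have Akgen k : val (e_ T (Ak k) (xymod_in T nu 1)) =
    place lam (E k).
  rewrite /E; have [AkXi|/negPf AkXi] := boolP (Ak k \in Xi d m n).
    have [_ ->] := e_zeta HT AkXi (Akrow k) (Akcol k).
    by congr (place _ (elt _ _)); apply/ffunP => x; rewrite [RHS]ffunE mulr1n mul1r.
  rewrite /e_ AkXi; apply/ffunP => l; rewrite !ffunE /elt big1 ?if_same // => x _.
  by rewrite ffunE mulr0n mul0r scale0r.
pose c k := struct_coef al be A k * qint (qpar al) (absz (A al k + 1)).
have schur_sumE (F : sint (m + n) -> schur m n T) z : (\sum_k F k) z = \sum_k F k z.
  by elim/big_rec2: _ => // k u w _ <-.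
have B0 : e_ T B 0 = 0 by have := schur_sum (e_ T B) (fun i : 'I_0 => 0); rewrite !big_ord0.
apply: (schur_eq (nu := nu)) => [mu' h mn|mu' h mn|].
- by rewrite schurM Aout.
- by rewrite schur_sumE big1 // => k _; rewrite schurZ Akout // scaler0.
pose h := \sum_(x | inc (colour mu) (x^-1)%g) zeta mu nu A x *: T x.
have Ah : elt T (zeta mu nu A) = xy T mu * h by exact: zeta_factorl.
pose Y := \sum_(x | inc (colour mu) x) zeta lam mu B x *: T x.
have BY : elt T (zeta lam mu B) = Y * xy T mu by exact: zeta_factorr.
have eA : e_ T A (xymod_in T nu 1) = xymod_in T mu h.
  apply: val_inj; rewrite Agen Ah; apply/ffunP => l; rewrite !ffunE.
  by case: eqP.
have key : Y * elt T (zeta mu nu A) = \sum_k c k *: E k.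
  have sumE : \sum_k c k *: E k =
      elt T [ffun x => \sum_k c k * ((Ak k \in Xi d m n)%:R * zeta lam nu (Ak k) x)].
    apply: (coefsP (HT := HT)) => x; rewrite coefs_sum eltK ffunE.
    by apply: eq_bigr => k _; rewrite coefsZ eltK ffunE.
  rewrite sumE -[LHS](coefsK HT); congr elt.
  apply: (bieigen_eq (f := colour lam) (f' := colour nu) (par := @parity m n)).
  - rewrite Ah mulrA -BY; apply: leigen_mulr; exact: leigen_zeta.
  - move=> i x fi ix; rewrite [LHS]ffunE [X in _ * X]ffunE mulr_sumr; apply: eq_bigr => k _.
    have [AkXi|_] := boolP (Ak k \in Xi d m n); last by rewrite !mulr0n !mul0r !mulr0.
    by rewrite (@leigen_zeta _ _ _ lam nu _ (Xi_bound AkXi) i x fi ix) !mulr1n !mul1r mulrCA.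
  - by apply: reigen_mull; exact: reigen_zeta.
  - move=> i x fi ix; rewrite [LHS]ffunE [X in _ * X]ffunE mulr_sumr; apply: eq_bigr => k _.
    have [AkXi|_] := boolP (Ak k \in Xi d m n); last by rewrite !mulr0n !mul0r !mulr0.
    by rewrite (@reigen_zeta _ _ _ lam nu _ (Xi_bound AkXi) i x fi ix) !mulr1n !mul1r mulrCA.
  move=> y yl yn; rewrite (product_coef lam_p mu_p be_al off_p HT A BE Bb yl yn) ffunE.
  apply: eq_bigr => k _; rewrite zeta_min //; case: eqP => [KE|]; last by rewrite !mulr0.
  by rewrite mulr1 /c -mulrA; congr (_ * _); apply: shift_term KE.
have /is_schurP[_ BM] := valP (e_ T B).
have LE : (e_ T B * e_ T A) (xymod_in T nu 1) = Defs.ract (e_ T B (xymod_in T mu 1)) h.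
  by rewrite schurM eA xymod_in_ract; apply: BM.
rewrite schur_sumE LE; apply: val_inj; rewrite [RHS]raddf_sum.
apply/ffunP => l; rewrite sum_ffunE [LHS]ffunE.
have -> : xymod_val (e_ T B (xymod_in T mu 1)) l = place lam (elt T (zeta lam mu B)) l.
  by rewrite -Bgen.
transitivity (\sum_k c k *: place lam (E k) l).
  have [->|ll] := eqVneq l lam.
    rewrite (eq_bigr (fun k => c k *: E k)) => [|k _]; last by rewrite ffunE eqxx.
    have pB : place lam (elt T (zeta lam mu B)) lam = Y * xy T mu by rewrite ffunE eqxx.
    by apply: etrans key; rewrite pB -mulrA -Ah.
  by rewrite ffunE (negPf ll) mul0r big1 // => k _; rewrite ffunE (negPf ll) scaler0.
apply: eq_bigr => k _; rewrite -Akgen.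
transitivity ((c k *: val (e_ T (Ak k) (xymod_in T nu 1))) l).
  by rewrite [RHS]ffunE.
by [].
Qed.

Lemma qint_double (z : laurent) b : qint z b.*2 = qint z b * (z ^+ b + 1).
Proof.
rewrite /qint -addnn big_split_ord /= mulrDr mulr1 addrC; congr (_ + _).
by rewrite mulr_suml; apply: eq_bigr => i _; rewrite exprD mulrC.
Qed.

(** The set counted is stable under negation and contains 0, the only point equal to its
    negative. *)
Lemma kappa_center_odd lam x mu : exists b,
  kappa lam x mu (sint_nat (m + n) 0) (sint_nat (m + n) 0) = b.*2.+1%:Z.
Proof.
set z := sint_nat (m + n) 0; have zr : rev_ord z = z by exact: rev_center.
pose S := [set a | (colour lam (x a) == z) && (colour mu a == z)].
have Sr a : (rev_ord a \in S) = (a \in S).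
  by rewrite !inE spermN !col_rev !rev_eqC zr.
pose c := sint_nat d 0; have cr : rev_ord c = c by exact: rev_center.
have vc : (c : nat) = d by rewrite val_sint_nat // addn0.
have cS : c \in S.
  have xc : x c = c by apply: (@rev_fix_eq d); rewrite -?spermN cr eqxx.
  by rewrite inE xc; apply/andP; split; apply/eqP/(@rev_fix_eq (m + n));
    rewrite -?col_rev ?cr ?zr eqxx.
pose P := [set a in S | (c < a)%N].
exists #|P|; rewrite kappaE -/S (cardsD1 c) cS /= add1n; congr (Posz _.+1).
have -> : S :\ c = P :|: (@rev_ord d.*2.+1) @: P.
  apply/setP => a; rewrite !inE -[in X in _ || X](rev_ordK a) (mem_imset _ _ (@rev_ord_inj _)).
  rewrite [rev_ord a \in P]inE Sr.
  have -> : (c < rev_ord a)%N = (a < c)%N by rewrite -{1}cr ltn_rev.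
  rewrite inE -andb_orr andbC; congr (_ && _); rewrite orbC -(inj_eq val_inj).
  exact: neq_ltn.
rewrite cardsU (_ : _ :&: _ = finset.set0) ?cards0 ?subn0.
  by rewrite card_imset ?addnn //; exact: rev_ord_inj.
apply/setP => a; rewrite !inE -[in X in _ && X](rev_ordK a) (mem_imset _ _ (@rev_ord_inj _)).
rewrite inE -{2}cr ltn_rev; apply/negP => /andP[/andP[_ h1] /andP[_ h2]].
by rewrite ltnNge (ltnW h2) in h1.
Qed.

End MainFormula.

Theorem proposition3p4 (d m n : nat) (H : algType laurent) (T : sperm d -> H)
    (lam lam' mu nu : wcomp d m n) (g : sperm d)
    (A B C : 'M[int]_((m + n).*2.+1)) (h : 'I_(m + n)) :
  (0 < d)%N -> is_hecke T ->
  g \in Dcirc mu nu -> 1%g \in Dcirc lam mu -> 1%g \in Dcirc lam' mu ->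
  A = kappa mu g nu -> B = kappa lam 1%g mu -> C = kappa lam' 1%g mu ->
  A \in Xi d m n -> B \in Xi d m n -> C \in Xi d m n ->
  let z0 := sint_nat (m + n) 0 in
  let h0 := sint_nat (m + n) h in
  let h1 := sint_nat (m + n) h.+1 in
  let Ah (k : sint (m + n)) := A + Etheta h0 k - Etheta h1 k in
  let Ach (k : sint (m + n)) := A - Etheta h0 k + Etheta h1 k in
  (is_diag_mx (B - Etheta h0 h1) ->
     ((h : nat) <> 0%N ->
        e_ T B * e_ T A =
        \sum_(k : sint (m + n)) (qdot h1 ^ (\sum_(j : sint (m + n) | (j < k)%N) A h1 j) *
                qddot h0 ^ (\sum_(j : sint (m + n) | (k < j)%N) A h0 j) *
                qint (qpar h0) (absz (A h0 k + 1))) *: e_ T (Ah k)) /\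
     ((h : nat) = 0%N ->
        e_ T B * e_ T A =
        (qdot h1 ^ (\sum_(j : sint (m + n) | (j < z0)%N) A h1 j) *
         qddot h0 ^ (\sum_(j : sint (m + n) | (z0 < j)%N) A h0 j) *
         qintc (absz (A z0 z0 + 1))) *: e_ T (Ah z0) +
        \sum_(k : sint (m + n) | k != z0)
          (qdot h1 ^ (\sum_(j : sint (m + n) | (j < k)%N) A h1 j) *
           qddot h0 ^ (\sum_(j : sint (m + n) | (k < j)%N) A h0 j) *
           qint (qpar h0) (absz (A h0 k + 1))) *: e_ T (Ah k))) /\
  (is_diag_mx (C - Etheta h1 h0) ->
     e_ T C * e_ T A =
     \sum_(k : sint (m + n)) (qdot h0 ^ (\sum_(j : sint (m + n) | (k < j)%N) A h0 j) *
             qddot h1 ^ (\sum_(j : sint (m + n) | (j < k)%N) A h1 j) *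
             qint (qpar h1) (absz (A h1 k + 1))) *: e_ T (Ach k)).
Proof.
move=> _ HT _ _ _ AE BE CE AXi BXi CXi z0 h0 h1 Ah Ach.
have hN := ltn_ord h.
have v0 : (h0 : nat) = (m + n + h)%N by rewrite val_sint_nat // ltnW.
have v1 : (h1 : nat) = (m + n + h).+1 by rewrite val_sint_nat // addnS.
have sc k : struct_coef h0 h1 A k = qdot h1 ^ (\sum_(j : sint (m + n) | (j < k)%N) A h1 j) *
  qddot h0 ^ (\sum_(j : sint (m + n) | (k < j)%N) A h0 j) by [].
split=> [Bd|Cd].
  have E := e_mul_shift HT (etrans v1 (congr1 S (esym v0))) AE BE AXi BXi Bd.
  split=> [_|h_0]; first exact: E.
  have h00 : h0 = z0 by rewrite /h0 /z0 h_0.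
  have [b bE] := kappa_center_odd mu g nu.
  (* As a_00 is odd, a_00 + 1 = 2a with a = b + 1, and [2a]_q = [a]_q (q^a + 1) turns the general
     coefficient into [2a]_c. *)
  have aE : absz (A z0 z0 + 1) = b.+1.*2 by rewrite AE bE; lia.
  have qE : qint (qpar h0) (absz (A h0 z0 + 1)) = qintc (absz (A z0 z0 + 1)).
    rewrite h00 aE /qintc doubleK qint_double.
    by rewrite /qpar (center_parity (esym (rev_center _))) expr0 expr1z.
  rewrite -qE; apply: etrans E _; exact: bigD1.
pose r0 := rev_ord h0; pose r1 := rev_ord h1.
have r01 : (r0 : nat) = r1.+1.
  rewrite /r0 /r1 !val_rev v0 v1; lia.
have Cd' : is_diag_mx (C - Etheta r1 r0) by rewrite Etheta_rev.
(* Replacing k by -k restores the indices h and h + 1 and exchanges the conditions j < k and j >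
   k. *)
rewrite (e_mul_shift HT r01 AE CE AXi CXi Cd') (reindex_inj rev_ord_inj) /=.
apply: eq_bigr => k _; congr (_ *: e_ T _); last first.
  by rewrite !Etheta_rev /Ach addrAC.
have Ar i j : A (rev_ord i) (rev_ord j) = A i j by apply: Xi_rev AXi.
rewrite /struct_coef /r0 /r1 /qdot /qddot /qpar !parity_rev Ar.
congr (_ ^ _ * _ ^ _ * _).
  rewrite (reindex_inj rev_ord_inj) /=; apply: eq_big => j; rewrite ?ltn_rev //.
rewrite (reindex_inj rev_ord_inj) /=; apply: eq_big => j; rewrite ?ltn_rev //.
Qed.
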